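(* Let $T:\mathbb{R}/\mathbb{Z}\to\mathbb{R}/\mathbb{Z}$ be a $\mathcal{C}^1$ uniformly expanding map and let $x\mapsto\mu_x\in\mathcal{P}(\mathbb{N})$ be a continuous map on $\mathbb{R}/\mathbb{Z}$ with $\mu_x\notin\{\delta_0,\delta_1\}$ for all $x$; let $\varphi$, $q$, $\lambda_F$, $\lambda_u$ be the associated generating function, probability of extinction and Lyapunov exponents (see context). Let $k\in\mathbb{N}$ (possibly $k=0$) and $\alpha\in(0,1]$. Assume: (a) $k+\alpha<\frac{|\lambda_F|}{\lambda_u}$; (b) $T$ is a $\mathcal{C}^{k+1}$ uniformly expanding transformation of $\mathbb{R}/\mathbb{Z}$; (c) for every $T$-ergodic Borel probability measure $\nu$ on $\mathbb{R}/\mathbb{Z}$, $\nu(q^{-1}(\{1\}))=0$; (d) $\varphi$ is $\mathcal{C}^{k+1}$ on $\mathbb{R}/\mathbb{Z}\times[0,1)$; (e) $q(x)>0$ for all $x\in\mathbb{R}/\mathbb{Z}$. Then $q$ is $\mathcal{C}^k$, and its $k$-th derivative $q^{(k)}$ is $\alpha$-Hölder continuous.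
   Context: $\mathbb{N}=\{0,1,2,\dots\}$. A $\mathcal{C}^1$ map $T$ of the circle is uniformly expanding if there is $\kappa>1$ with $|T'(x)|\ge\kappa$ for all $x$. $\mathcal{P}(\mathbb{N})$ is the set of probability measures on $\mathbb{N}$ with the topology of the $\ell^1$ norm. Generating function: for $x\in\mathbb{R}/\mathbb{Z}$, $s\in[0,1]$, $\varphi(x,s)=\sum_{j\ge0}\mu_x(j)s^j$. Iterates: $\varphi^{(0)}(x,s)=s$ and $\varphi^{(n)}(x,s)=\varphi(x,\varphi^{(n-1)}(Tx,s))$ for $n\ge1$; equivalently $\varphi^{(n)}(x,s)=\mathbb{E}[s^{Z_n(x)}]$, where $Z_0(x)=1$, $Z_{n+1}(x)=\sum_{j=1}^{Z_n(x)}Y_{n,j}(x)$ with $(Y_{n,j}(x))$ independent and $Y_{n,j}(x)\sim\mu_{T^nx}$. Probability of extinction: $q(x)=\lim_{n\to\infty}\varphi^{(n)}(x,0)$ (an increasing limit). $\partial_s$ denotes the partial derivative in the second variable. Lyapunov exponents: $$\lambda_F=\lim_{n\to\infty}\frac1n\sup_{x\in\mathbb{R}/\mathbb{Z}}\log\big(\partial_s\varphi^{(n)}(x,q(T^nx))\big),\qquad \lambda_u=\lim_{n\to\infty}\frac1n\sup_{x\in\mathbb{R}/\mathbb{Z}}\log|(T^n)'(x)|.$$ Both limits exist under the stated hypotheses. *)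

(* Defs.v *)
From HB Require Import structures.
From mathcomp Require Import all_boot all_order all_algebra.
From mathcomp Require Import all_classical all_reals all_analysis.

Set Implicit Arguments.
Unset Strict Implicit.
Unset Printing Implicit Defensive.

Import Order.TTheory GRing.Theory Num.Theory.
Import numFieldTopology.Exports numFieldNormedType.Exports.

Local Open Scope classical_set_scope.
Local Open Scope ring_scope.

(** * The circle *)

(** Membership in [int_subgroup R] unfolds to [_ \is a Num.int]. *)
Definition int_subgroup (R : realType) : zmodClosed R :=
  GRing.ZmodClosed.clone R (@Num.int_num_subdef R) _.

(** R/Z: the quotient of the group R by its subgroup of integers, with the
    quotient topology. *)
Definition circle (R : realType) : Type :=
  quotient_topology {ideal_quot int_subgroup R}.

HB.instance Definition _ (R : realType) :=
  PointedTopological.on (circle R).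

Definition circle_pi (R : realType) (a : R) : circle R :=
  (\pi_(circle R) a)%qT.

Definition circle_dist (R : realType) (x y : circle R) : R :=
  inf [set d : R | exists a b : R,
         [/\ circle_pi a = x, circle_pi b = y & d = `|a - b|]].

Definition borel_circle (R : realType) : Type :=
  g_sigma_algebraType (@open (circle R)).

HB.instance Definition _ (R : realType) := Measurable.on (borel_circle R).

(** * Regularity on the line and on the circle *)

Definition Cr_line (R : realType) (r : nat) (f : R -> R) : Prop :=
  (forall i, (i < r)%N -> forall a, derivable (derive1n i f) a 1) /\
  continuous (derive1n r f).

(** Real functions on the circle are differentiated through the local
    diffeomorphism [circle_pi]; the derivatives of the periodic function
    [f \o circle_pi] are again periodic, so the representative is immaterial. *)
Definition Cr_circle_fun (R : realType) (r : nat) (f : circle R -> R) : Prop :=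
  Cr_line r (f \o @circle_pi R).

Definition circle_deriven (R : realType) (r : nat) (f : circle R -> R)
    (x : circle R) : R :=
  derive1n r (f \o @circle_pi R) (repr x).

Definition holder_circle (R : realType) (alpha : R) (f : circle R -> R) : Prop :=
  exists C : R, forall x y : circle R,
    `|f x - f y| <= C * (circle_dist x y) `^ alpha.

Definition is_lift (R : realType) (T : circle R -> circle R) (F : R -> R) : Prop :=
  forall a : R, T (circle_pi a) = circle_pi (F a).

(** A self-map of the circle is of class C^r iff it has a C^r lift to R. *)
Definition Cr_circle_map (R : realType) (r : nat) (T : circle R -> circle R) :
    Prop :=
  exists F : R -> R, is_lift T F /\ Cr_line r F.

(** Derivative of a lift at a representative. Two lifts differentiable at
    representatives of [x] have the same derivative there (locally they differ
    by an integer constant), so for differentiable [T] this value is unique. *)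
Definition circle_map_derive (R : realType) (T : circle R -> circle R)
    (x : circle R) : R :=
  xget 0 [set d : R | exists (F : R -> R) (a : R),
            [/\ is_lift T F, continuous F, circle_pi a = x
              & is_derive a 1 F d]].

Definition uniformly_expanding (R : realType) (T : circle R -> circle R) : Prop :=
  exists kappa : R, 1 < kappa /\
    forall x, kappa <= `|circle_map_derive T x|.

(** * Derivatives relative to a subset of the line *)

(** One-sided at the end points of an interval. *)
Definition is_derive_within (R : realType) (A : set R) (f : R -> R) (s d : R) :
    Prop :=
  (f t - f s) / (t - s) @[t --> within A s^'] --> d.

(** Extended-real variant: the left derivative at 1 of the generating function
    of a distribution with infinite mean is +oo. *)
Definition ederive_within (R : realType) (A : set R) (f : R -> R) (s : R) :
    \bar R :=
  lim (((f t - f s) / (t - s))%:E @[t --> within A s^']).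

(** Class C^r on R x [0,1[ : all partial derivatives of order at most [r]
    (one-sided in the second variable at 0) exist and are continuous there. *)
Fixpoint Cr_strip (R : realType) (r : nat) (f : R -> R -> R) : Prop :=
  {within [set z : R * R | 0 <= z.2 < 1],
     continuous (fun z : R * R => f z.1 z.2)} /\
  if r is r'.+1 then
    exists fx fs : R -> R -> R,
      [/\ forall a s : R, 0 <= s < 1 -> is_derive a 1 (fun b => f b s) (fx a s),
          forall a s : R, 0 <= s < 1 -> is_derive_within `[0, 1[ (f a) s (fs a s),
          Cr_strip r' fx
        & Cr_strip r' fs]
  else True.

Definition Cr_circle_strip (R : realType) (r : nat) (phi : circle R -> R -> R) :
    Prop :=
  Cr_strip r (fun a s => phi (circle_pi a) s).

(** * Offspring distributions and extinction *)

Definition l1_dist (R : realType) (P Q : probability nat R) : \bar R :=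
  (\sum_(0 <= j <oo) `|P [set j] - Q [set j]|)%E.

Definition l1_continuous (R : realType) (mu : circle R -> probability nat R) :
    Prop :=
  forall x, l1_dist (mu y) (mu x) @[y --> x] --> 0%E.

(** Only meaningful for [0 <= s <= 1]. *)
Definition genfun (R : realType) (mu : circle R -> probability nat R)
    (x : circle R) (s : R) : R :=
  limn (series (fun j => fine (mu x [set j]) * s ^+ j)).

Fixpoint genfun_iter (R : realType) (T : circle R -> circle R)
    (mu : circle R -> probability nat R) (n : nat) (x : circle R) (s : R) : R :=
  if n is n'.+1 then genfun mu x (genfun_iter T mu n' (T x) s) else s.

Definition extinction (R : realType) (T : circle R -> circle R)
    (mu : circle R -> probability nat R) (x : circle R) : R :=
  limn (fun n => genfun_iter T mu n x 0).

(** * Ergodic measures *)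

Definition ergodic (R : realType) (T : circle R -> circle R)
    (nu : probability (borel_circle R) R) : Prop :=
  (forall A : set (borel_circle R), measurable A -> nu (T @^-1` A) = nu A) /\
  (forall A : set (borel_circle R), measurable A -> T @^-1` A = A ->
     nu A = 0%E \/ nu A = 1%E).

(** * Lyapunov exponents *)

Definition ds_genfun_iter (R : realType) (T : circle R -> circle R)
    (mu : circle R -> probability nat R) (n : nat) (x : circle R) (s : R) :
    \bar R :=
  ederive_within `[0, 1] (genfun_iter T mu n x) s.

Definition lyap_F (R : realType) (T : circle R -> circle R)
    (mu : circle R -> probability nat R) : \bar R :=
  limn (fun n => ((n%:R)^-1%:E * ereal_sup (range (fun x : circle R =>
    lne (ds_genfun_iter T mu n x (extinction T mu (iter n T x))))))%E).

Definition lyap_u (R : realType) (T : circle R -> circle R) : \bar R :=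
  limn (fun n => ((n%:R)^-1%:E * ereal_sup (range (fun x : circle R =>
    lne (`|circle_map_derive (iter n T) x|%:E))))%E).

(* Main.v *)
(** Put [w = 1 - q], [W x w = 1 - phi(x, 1 - w)] and [psi_s = log (W(., s) / s)],
    which increases as [s] decreases to 0.

    First, [w] is bounded away from 0. Let [beta] be the supremum over [s] and
    over continuous [h] of [inf (psi_s - h + h o T)]. If [psi_s - h + h o T >= 0]
    for some [s] and [h], then [log w_n - h], with [w_n(x) = 1 - phi^(n)(x, 0)],
    is bounded below by induction on [n]. Otherwise [beta <= 0], and an extreme
    point of the set of invariant states [L] such that [L psi_s <= beta] for all
    [s] is an ergodic measure [nu] with [nu psi_s <= 0]. If [w > 0]
    [nu]-almost everywhere, then [log w(x) - log w(T x) <= log (dphi/ds)(x, 1)]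
    is a coboundary, so equality holds almost everywhere, hence almost every
    [mu_x] is carried by {0, 1} and [w < w o T] almost everywhere, which
    contradicts invariance; thus [nu(q = 1) > 0].

    Now [q <= 1 - delta] gives [lambda_F <= 0] by convexity, hence [lambda_F < 0]
    and [q] is a uniform limit of the functions [phi^(n)(., 0)]. By
    [k + alpha < |lambda_F| / lambda_u] there is a bounded weight adapted to the
    cocycle [A |F'|^(k + alpha)], where [A(x) = dphi/ds(x, q(T x))]. Each derivative
    [v] of [q] solves [v = g + A F'^j (v o F)] with a [g] involving only lower
    order derivatives, and along such an equation smallness of increments is
    propagated from the scale of [F a - F b] to that of [a - b]. *)

Require Import Defs.
From HB Require Import structures.
From mathcomp Require Import all_boot all_order all_algebra.
From mathcomp Require Import all_classical all_reals all_analysis.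
From mathcomp Require Import ring lra measurable_realfun.

Set Implicit Arguments.
Unset Strict Implicit.
Unset Printing Implicit Defensive.

Import Order.TTheory GRing.Theory Num.Theory.
Import numFieldTopology.Exports numFieldNormedType.Exports.

Local Open Scope classical_set_scope.
Local Open Scope ring_scope.

(** * Cocycle equations over an expanding map *)

(** The mean of [mu x] may be infinite, so the logarithm of the derivative at 1 need not be a
    continuous function; ergodic optimization is run on the increasing sequence [psi] of continuous
    functions instead. A second obstacle there is that [log w] need not be integrable, so its
    coboundary cannot simply be integrated to 0: it is truncated, and the error lives on sets
    shrinking to [q = 1]. In the regularity part no derivative of [q] may be presupposed. The
    candidate is the solution of the formally differentiated equation, given by a Neumann series,
    and only afterwards is the remainder of the first order expansion shown to be small. The weight
    is needed because contraction is only asymptotic: it is known for products along long orbit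
    segments, not at each point. The bounds [0 < q] and [q <= 1 - delta] confine [q] to a compact
    part of the open interval, where one-sided and two-sided derivatives agree and expansions of the
    generating function are uniform. The analysis takes place on the line, where periodicity
    supplies the compactness. *)

Lemma scale_bound (R : realType) (F : R -> R) (kap : R) (D om rho : R -> R -> R)
    (th c t0 M : R) :
  1 < kap -> (forall a b, kap * `|a - b| <= `|F a - F b|) ->
  0 <= th -> th < 1 -> 0 < t0 ->
  (forall a b, 0 <= om a b) ->
  (forall a b, t0 <= `|a - b| -> D a b <= M * om a b) ->
  (forall a b, `|a - b| <= t0 -> 0 <= rho a b) ->
  (forall a b, `|a - b| <= t0 -> D a b <= c * om a b + rho a b * D (F a) (F b)) ->
  (forall a b, `|a - b| <= t0 -> rho a b * om (F a) (F b) <= th * om a b) ->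
  exists C, 0 <= C /\ forall a b, a != b -> D a b <= C * om a b.
Proof.
move=> kap1 Fexp th0 th1 t00 om0 Dbig rho0 Drec rhoom.
(* Chosen so that [c + th * C <= C]: one use of the recursion then reproduces the bound. [M] serves
   the pairs that are already [t0]-apart. *)
pose C := Num.max 0 (Num.max M (c / (1 - th))).
have th1' : 0 < 1 - th by rewrite subr_gt0.
have C0 : 0 <= C by rewrite /C le_max lexx.
have CM : M <= C by rewrite /C !le_max lexx orbT.
have Cc : c + th * C <= C.
  have : c / (1 - th) <= C by rewrite /C !le_max lexx !orbT.
  by rewrite ler_pdivrMr// mulrBr mulr1 lerBrDr (mulrC C).
exists C; split => // a b ab.
(* Induction on the number of applications of [F] after which expansion has separated the pair by
   [t0]; this is why [a != b] is required. *)
have P n : forall a b, t0 <= kap ^+ n * `|a - b| -> D a b <= C * om a b.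
  elim: n => [|n IH] {ab}a {}b; rewrite ?expr0 ?mul1r.
    by move=> /Dbig/le_trans; apply; exact: ler_wpM2r.
  move=> h; have [t0ab|abt0] := leP t0 `|a - b|.
    by apply: (le_trans (Dbig _ _ t0ab)); exact: ler_wpM2r.
  have {}abt0 := ltW abt0.
  have DF : D (F a) (F b) <= C * om (F a) (F b).
    apply: IH; apply: (le_trans h); rewrite exprSr -mulrA ler_wpM2l//.
    by rewrite exprn_ge0// (le_trans ler01)// ltW.
  apply: (le_trans (Drec _ _ abt0)).
  apply: (@le_trans _ _ (c * om a b + C * (th * om a b))).
    rewrite lerD2l; apply: (le_trans (ler_wpM2l (rho0 _ _ abt0) DF)).
    by rewrite mulrCA ler_wpM2l// rhoom.
  by rewrite mulrA -mulrDl ler_wpM2r// (mulrC C).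
have ab0 : 0 < `|a - b| by rewrite normr_gt0 subr_eq0.
have [n hn] : exists n, t0 <= kap ^+ n * `|a - b|.
  have kap0 : `|kap^-1| < 1.
    by rewrite gtr0_norm ?invr_gt0 ?(lt_trans ltr01)// invf_lt1// (lt_trans ltr01).
  have /cvgrPdist_lt/(_ (`|a - b| / t0)) := cvg_expr kap0.
  rewrite divr_gt0// => /(_ isT)[n _ /(_ n (leqnn n))] /=.
  rewrite sub0r normrN ger0_norm ?exprn_ge0 ?invr_ge0 ?(le_trans ler01) 1?ltW//.
  rewrite ltr_pdivlMr// exprVn mulrC ltr_pdivrMr ?exprn_gt0 ?(lt_trans ltr01)//.
  by rewrite mulrC => /ltW ?; exists n.
exact: P hn.
Qed.

(** Companion of [scale_bound] for little-o estimates. A pair at distance at most [t / K ^+ n] stays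
    [t]-close for [n] steps, so the recursion can be used [n] times: each use damps the a priori
    constant [C] by [th], and the inhomogeneous terms sum to at most [c / (1 - th)]. *)
Lemma scale_small (R : realType) (F : R -> R) (K : R) (D om rho : R -> R -> R)
    (th c t C : R) :
  1 <= K -> (forall a b, `|F a - F b| <= K * `|a - b|) ->
  0 <= th -> th < 1 -> 0 < t ->
  (forall a b, D a b <= C * om a b) ->
  (forall a b, `|a - b| <= t -> 0 <= rho a b) ->
  (forall a b, `|a - b| <= t -> D a b <= c * om a b + rho a b * D (F a) (F b)) ->
  (forall a b, `|a - b| <= t -> rho a b * om (F a) (F b) <= th * om a b) ->
  0 <= c -> 0 <= C -> (forall a b, 0 <= om a b) ->
  forall n a b, K ^+ n * `|a - b| <= t ->
  D a b <= (c / (1 - th) + th ^+ n * C) * om a b.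
Proof.
move=> K1 FK th0 th1 t00 Dbig rho0 Drec rhoom c0 C0 om0.
have th1' : 0 < 1 - th by rewrite subr_gt0.
have cE : c + th * (c / (1 - th)) = c / (1 - th).
  by field; rewrite lt0r_neq0.
elim=> [|n IH] a b h.
  rewrite expr0 mul1r; apply: (le_trans (Dbig _ _)); rewrite ler_wpM2r//.
  by rewrite lerDr divr_ge0// ltW.
have K0 : 0 <= K ^+ n by rewrite exprn_ge0// (le_trans ler01).
have abt : `|a - b| <= t.
  by apply: le_trans h; rewrite ler_peMl// exprn_ege1.
have DF : D (F a) (F b) <= (c / (1 - th) + th ^+ n * C) * om (F a) (F b).
  by apply: IH; apply: le_trans h; rewrite exprSr -mulrA ler_wpM2l.
apply: (le_trans (Drec _ _ abt)).
have h1 := ler_wpM2l (rho0 _ _ abt) DF.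
apply: (@le_trans _ _ (c * om a b + (c / (1 - th) + th ^+ n * C) * (rho a b * om (F a) (F b)))).
  by rewrite lerD2l mulrCA.
apply: (@le_trans _ _ (c * om a b + (c / (1 - th) + th ^+ n * C) * (th * om a b))).
  rewrite lerD2l ler_wpM2l ?rhoom// addr_ge0 ?mulr_ge0 ?exprn_ge0//.
  by rewrite invr_ge0 ltW.
by rewrite -{2}cE exprS le_eqVlt; apply/orP; left; apply/eqP; ring.
Qed.

(** Neumann series of the operator sending [p] to [m * (p o F)]; the weight [W] turns the pointwise
    hypothesis on [m] into a contraction by [th]. *)
Lemma cocycle_fixpoint (R : realType) (F g m W : R -> R) (th G : R) :
  0 <= th -> th < 1 -> (forall a, 0 <= W a) -> (forall a, `|g a| <= G * W a) ->
  (forall a, `|m a| * W (F a) <= th * W a) ->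
  exists p : R -> R, (forall a, p a = g a + m a * p (F a)) /\
    exists C, forall a, `|p a| <= C * W a.
Proof.
move=> th0 th1 W0 gW mW.
(* The [n]-th term of the series: the product of [m] over the first [n] points of the orbit of [a],
   times [g] at the next point. *)
pose fix u n a {struct n} : R := if n is n'.+1 then m a * u n' (F a) else g a.
have uW n a : `|u n a| <= G * W a * th ^+ n.
  elim: n a => [|n IH] a; first by rewrite expr0 mulr1.
  rewrite /= normrM.
  apply: (le_trans (ler_wpM2l (normr_ge0 _) (IH _))).
  have -> : `|m a| * (G * W (F a) * th ^+ n) = G * th ^+ n * (`|m a| * W (F a)) by ring.
  have -> : G * W a * th ^+ n.+1 = G * th ^+ n * (th * W a) by rewrite exprS; ring.
  (* No sign is assumed of [G]; a negative one forces [W] to vanish identically. *)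
  have [G0|G0] := leP 0 G.
    by rewrite ler_wpM2l// mulr_ge0// exprn_ge0.
  have Wa0 b : W b = 0.
    apply/eqP; rewrite eq_le W0 andbT.
    have := le_trans (normr_ge0 _) (gW b).
    by rewrite nmulr_rge0.
  by rewrite !Wa0 !mulr0.
have cvgu a : cvgn (series (u ^~ a)).
  apply: normed_cvg.
  apply: (@series_le_cvg _ _ (geometric (G * W a) th)) => [n|n|n|].
  - exact: normr_ge0.
  - by rewrite /geometric/= mulr_ge0 ?exprn_ge0// (le_trans (normr_ge0 _) (gW a)).
  - exact: uW.
  - by apply: is_cvg_geometric_series; rewrite ger0_norm.
exists (fun a => limn (series (u ^~ a))); split=> [a|].
  have h : (fun n => series (u ^~ a) n.+1) = (fun n => g a + m a * series (u ^~ (F a)) n).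
    apply/funext => n; rewrite /series/= big_nat_recl//=; congr (_ + _).
    by rewrite mulr_sumr.
  have h1 : (fun n => series (u ^~ a) n.+1) @ \oo --> limn (series (u ^~ a)).
    by rewrite (cvg_shiftS (series (u ^~ a))); exact: cvgu.
  rewrite h in h1; have h2 : (fun n => g a + m a * series (u ^~ (F a)) n) @ \oo -->
      g a + m a * limn (series (u ^~ (F a))).
    by apply: cvgD; [exact: cvg_cst|apply: cvgM; [exact: cvg_cst|exact: cvgu]].
  by rewrite -(cvg_lim (@Rhausdorff R) h1) (cvg_lim (@Rhausdorff R) h2).
exists (G / (1 - th)) => a.
rewrite -(cvg_lim (@Rhausdorff R) (cvg_norm (cvgu a))).
apply: limr_le; first by apply: is_cvg_norm; exact: cvgu.
near=> n.
rewrite /series/=.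
apply: (le_trans (ler_norm_sum _ _ _)).
apply: (@le_trans _ _ (\sum_(0 <= k < n) geometric (G * W a) th k)).
  by apply: ler_sum => i _; exact: uW.
have := @geometric_seriesE R (G * W a) th.
rewrite lt_eqF// => /(_ isT) => /(congr1 (fun f => f n)) /=.
rewrite /series /= => ->.
rewrite [leRHS]mulrAC ler_pM2r ?invr_gt0 ?subr_gt0//.
rewrite mulrBr mulr1 gerBl mulr_ge0 ?exprn_ge0//.
exact: le_trans (normr_ge0 _) (gW a).
Unshelve. all: by end_near.
Qed.

(** Uniform strict differentiability. It includes the continuity of [f'], as exchanging [a] and [b]
    shows ([udiff_continuous]). *)
Definition udiff (R : realType) (f f' : R -> R) : Prop :=
  forall e : R, 0 < e -> exists2 t : R, 0 < t &
    forall a b, `|a - b| <= t -> `|f a - f b - f' b * (a - b)| <= e * `|a - b|.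

(** Linearization of an equation [v a = f a (v (F a))] that does not presuppose [v] differentiable:
    the increment of [v o F] is kept as it is, also in the error. It covers the nonlinear equation
    of [q] and the linear ones of its derivatives. *)
Definition udiff_cocycle (R : realType) (F v g H : R -> R) : Prop :=
  forall e : R, 0 < e -> exists2 t : R, 0 < t & forall a b, `|a - b| <= t ->
    `|v a - v b - g b * (a - b) - H b * (v (F a) - v (F b))|
      <= e * (`|a - b| + `|v (F a) - v (F b)|).

(** Passage from the infinitesimal contraction to pairs of nearby points. The margin [e] added to
    the modulus of [H b] will absorb the error term of [udiff_cocycle] in [v (F a) - v (F b)]. *)
Lemma contraction_near_diagonal (R : realType) (F F' H W : R -> R)
    (K th th' al Wm : R) :
  0 <= al -> al <= 1 -> 1 <= K -> (forall a b, `|F a - F b| <= K * `|a - b|) ->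
  udiff F F' -> (forall b, 1 <= `|F' b|) ->
  (forall b, 1 <= W b) -> (forall b, W b <= Wm) ->
  0 <= th -> th < th' ->
  (forall b, `|H b| * `|F' b| `^ al * W (F b) <= th * W b) ->
  exists2 e : R, 0 < e & exists2 t : R, 0 < t & forall a b, `|a - b| <= t ->
    (`|H b| + e) * (`|F a - F b| `^ al * W (F b)) <= th' * (`|a - b| `^ al * W b).
Proof.
move=> al0 al1 K1 FK uF F'1 W1 Wm_ th0 thth' HW.
have Wm1 : 1 <= Wm by apply: le_trans (W1 0) (Wm_ 0).
have K0 : 0 <= K by apply: le_trans K1.
have S0 : 0 < th + K * Wm.
  by rewrite ltr_wpDl// mulr_gt0// ?(lt_le_trans ltr01).
(* Solves [th + e * (th + K * Wm) = th'], the total factor reached at the end. *)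
pose e := (th' - th) / (th + K * Wm).
have e0 : 0 < e by rewrite divr_gt0// subr_gt0.
exists e => //; have [t t0 ht] := uF _ e0; exists t => // a b /ht {}ht.
have W0 c : 0 <= W c by rewrite (le_trans ler01).
have hF : `|F a - F b| <= `|F' b| * (1 + e) * `|a - b|.
  rewrite -(subrK (F' b * (a - b)) (F a - F b)) (le_trans (ler_normD _ _))//.
  have -> : `|F' b| * (1 + e) * `|a - b| =
    `|F' b| * (e * `|a - b|) + `|F' b| * `|a - b| by ring.
  rewrite normrM lerD2r (le_trans ht)// ler_peMl ?F'1// mulr_ge0//.
  exact: ltW.
have e1 : 0 <= 1 + e by rewrite addr_ge0// ltW.
(* Here [al <= 1] enters, through [(1 + e) ^ al <= 1 + e], and in [hp2] through [K ^ al <= K]. *)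
have hp1 : `|F a - F b| `^ al <= `|F' b| `^ al * (1 + e) * `|a - b| `^ al.
  apply: (@le_trans _ _ ((`|F' b| * (1 + e) * `|a - b|) `^ al)).
    by rewrite ge0_ler_powR// ?nnegrE ?mulr_ge0.
  rewrite !powRM ?mulr_ge0// ler_wpM2r ?powR_ge0// ler_wpM2l ?powR_ge0//.
  rewrite -[leRHS]powRr1// ler_powR// lerDl ltW//.
have hp2 : `|F a - F b| `^ al <= K * `|a - b| `^ al.
  apply: (@le_trans _ _ ((K * `|a - b|) `^ al)).
    by rewrite ge0_ler_powR// ?nnegrE ?mulr_ge0.
  by rewrite powRM// ler_wpM2r ?powR_ge0// -[leRHS]powRr1// ler_powR.
set X := `|a - b| `^ al in hp1 hp2 *; have X0 : 0 <= X by exact: powR_ge0.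
rewrite mulrDl.
have h1 : `|H b| * (`|F a - F b| `^ al * W (F b)) <= th * W b * ((1 + e) * X).
  apply: (@le_trans _ _ (`|H b| * (`|F' b| `^ al * (1 + e) * X * W (F b)))).
    by rewrite ler_wpM2l// ler_wpM2r.
  have -> : `|H b| * (`|F' b| `^ al * (1 + e) * X * W (F b)) =
     `|H b| * `|F' b| `^ al * W (F b) * ((1 + e) * X) by ring.
  by rewrite ler_wpM2r// mulr_ge0.
have h2 : e * (`|F a - F b| `^ al * W (F b)) <= e * (K * X * Wm * W b).
  rewrite ler_wpM2l ?(ltW e0)//.
  apply: (@le_trans _ _ (K * X * Wm)).
    by apply: ler_pM => //; exact: powR_ge0.
  by rewrite ler_peMr// !mulr_ge0// (le_trans ler01).
apply: (le_trans (lerD h1 h2)).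
have -> : th * W b * ((1 + e) * X) + e * (K * X * Wm * W b)
  = (th + e * (th + K * Wm)) * (X * W b) by ring.
by rewrite ler_wpM2r ?mulr_ge0// /e mulfVK ?lt0r_neq0// subrKC.
Qed.

(** The gauge is the distance to the power [al], times [W b]. At large scale the bound is trivial
    because [v] is bounded, and [scale_bound] carries it to small scales. *)
Lemma cocycle_holder (R : realType) (F F' v g H W : R -> R)
    (kap K th al Wm V G : R) :
  0 < al -> al <= 1 -> 1 < kap -> (forall a b, kap * `|a - b| <= `|F a - F b|) ->
  1 <= K -> (forall a b, `|F a - F b| <= K * `|a - b|) ->
  udiff F F' -> (forall b, 1 <= `|F' b|) ->
  (forall b, 1 <= W b) -> (forall b, W b <= Wm) ->
  0 <= th -> th < 1 ->
  (forall b, `|H b| * `|F' b| `^ al * W (F b) <= th * W b) ->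
  (forall b, `|v b| <= V) -> (forall b, `|g b| <= G) ->
  udiff_cocycle F v g H ->
  exists2 C : R, 0 <= C & forall a b, `|v a - v b| <= C * `|a - b| `^ al.
Proof.
move=> al0 al1 kap1 Fkap K1 FK uF F'1 W1 Wm_ th0 th1 HW vV gG vH.
have [th' tt' t'1] : exists2 th' : R, th < th' & th' < 1.
  by exists ((th + 1) / 2); lra.
have [e e0 [t t0 ht]] :=
  contraction_near_diagonal (ltW al0) al1 K1 FK uF F'1 W1 Wm_ th0 tt' HW.
have [t' t'0 ht'] := vH _ e0.
(* With [s <= 1] the linear term in the distance is at most its [al]-th power. *)
pose s := Num.min 1 (Num.min t t').
have s0 : 0 < s by rewrite !lt_min ltr01 t0.
have s1 : s <= 1 by rewrite ge_min lexx.
have st : s <= t by rewrite !ge_min lexx orbT.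
have st' : s <= t' by rewrite !ge_min lexx !orbT.
have W0 c : 0 <= W c by rewrite (le_trans ler01).
have G0 : 0 <= G := le_trans (normr_ge0 _) (gG 0).
have V0 : 0 <= V := le_trans (normr_ge0 _) (vV 0).
have hab a b : `|a - b| <= s -> `|a - b| <= `|a - b| `^ al * W b.
  move=> abs; have [->|ab0] := eqVneq `|a - b| 0.
    by rewrite mulr_ge0 ?powR_ge0.
  rewrite -[leLHS]mulr1 ler_pM// -[leLHS]powRr1//.
  rewrite ger_powR// (le_trans abs)// andbT lt_def ab0/=.
  exact: normr_ge0.
have [|a b sab|a b _|a b abs|a b abs|C [C0 hC]] := @scale_bound R F kap
  (fun a b => `|v a - v b|)
  (fun a b => `|a - b| `^ al * W b) (fun a b => `|H b| + e) th' (G + e) s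
  (2 * V / s `^ al) kap1 Fkap (le_trans th0 (ltW tt')) t'1 s0.
- by move=> a b; rewrite mulr_ge0 ?powR_ge0.
- apply: (@le_trans _ _ (2 * V)).
    by rewrite (le_trans (ler_normB _ _))// mulr2n mulrDl mul1r lerD.
  rewrite mulrAC ler_pdivlMr ?powR_gt0// ler_wpM2l ?mulr_ge0//.
  rewrite -[leLHS]mulr1 ler_pM ?powR_ge0// ge0_ler_powR ?nnegrE// ltW//.
- by rewrite addr_ge0// ltW.
- have h1 := ht' a b (le_trans abs st').
  have h2 : `|v a - v b| <= `|v a - v b - g b * (a - b) - H b * (v (F a) - v (F b))|
      + (`|g b| * `|a - b| + `|H b| * `|v (F a) - v (F b)|).
    rewrite -!normrM; apply: le_trans (lerD (lexx _) (ler_normD _ _)).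
    apply: le_trans (ler_normD _ _); rewrite le_eqVlt; apply/orP; left.
    by apply/eqP; congr `|_|; ring.
  apply: (le_trans h2); apply: (le_trans (lerD h1 (lexx _))).
  have h3 : (`|g b| + e) * `|a - b| <= (G + e) * (`|a - b| `^ al * W b).
    by rewrite ler_pM ?hab// ?lerD2r// addr_ge0// ltW.
  by rewrite mulrDl in h3 *; rewrite mulrDl mulrDr; lra.
- exact: ht (le_trans abs st).
exists (C * Wm) => [|a b]; first by rewrite mulr_ge0// (le_trans _ (Wm_ 0)).
have [->|ab] := eqVneq a b.
  by rewrite !subrr normr0 mulr_ge0 ?powR_ge0// mulr_ge0// (le_trans _ (Wm_ 0)).
apply: (le_trans (hC _ _ ab)).
by rewrite -mulrA ler_wpM2l// mulrC ler_wpM2r ?powR_ge0.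
Qed.

(** With [p] solving the differentiated equation, the remainder [D] of the first order expansion
    satisfies the same kind of recursion as the increments of [v]. Then [scale_bound] gives a
    remainder of the order of the distance, and [scale_small] improves it to little-o. *)
Lemma cocycle_udiff (R : realType) (F F' v g H W : R -> R)
    (kap K th Wm V G Hm : R) :
  1 < kap -> (forall a b, kap * `|a - b| <= `|F a - F b|) ->
  1 <= K -> (forall a b, `|F a - F b| <= K * `|a - b|) ->
  udiff F F' -> (forall b, 1 <= `|F' b|) ->
  (forall b, 1 <= W b) -> (forall b, W b <= Wm) ->
  0 <= th -> th < 1 ->
  (forall b, `|H b| * `|F' b| * W (F b) <= th * W b) ->
  (forall b, `|v b| <= V) -> (forall b, `|g b| <= G) -> (forall b, `|H b| <= Hm) ->
  udiff_cocycle F v g H ->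
  exists2 p : R -> R, forall b, p b = g b + H b * F' b * p (F b) & udiff v p.
Proof.
move=> kap1 Fkap K1 FK uF F'1 W1 Wm_ th0 th1 HW vV gG HHm vH.
have [th' tt' t'1] : exists2 th' : R, th < th' & th' < 1.
  by exists ((th + 1) / 2); lra.
have HW1 b : `|H b| * `|F' b| `^ 1 * W (F b) <= th * W b.
  by rewrite powRr1.
have [e0 e00 [t t0 ht]] :=
  contraction_near_diagonal ler01 (lexx 1) K1 FK uF F'1 W1 Wm_ th0 tt' HW1.
have W0 c : 0 <= W c by rewrite (le_trans ler01).
have G0 : 0 <= G := le_trans (normr_ge0 _) (gG 0).
have V0 : 0 <= V := le_trans (normr_ge0 _) (vV 0).
have Hm0 : 0 <= Hm := le_trans (normr_ge0 _) (HHm 0).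
have Wm0 : 0 <= Wm := le_trans (W0 0) (Wm_ 0).
have K0 : 0 <= K := le_trans ler01 K1.
have [|b|p [pE [P0 pP0]]] := @cocycle_fixpoint R F g (fun b => H b * F' b) W th G th0 th1 W0.
- by move=> a; apply: (le_trans (gG a)); rewrite ler_peMr.
- by rewrite normrM.
have [P P_0 pP] : exists2 P : R, 0 <= P & forall b, `|p b| <= P.
  exists (Num.max 0 P0 * Wm) => [|b]; first by rewrite mulr_ge0// le_max lexx.
  apply: (le_trans (pP0 b)); rewrite (@le_trans _ _ (Num.max 0 P0 * W b))//.
    by rewrite ler_wpM2r// le_max lexx orbT.
  by rewrite ler_wpM2l// le_max lexx.
exists p => //.
pose D a b := `|v a - v b - p b * (a - b)|.
pose om a b := `|a - b| `^ 1 * W b.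
have omE a b : om a b = `|a - b| * W b by rewrite /om powRr1.
have om0 a b : 0 <= om a b by rewrite omE mulr_ge0.
(* Total coefficient of the distance in the recursion for [D]: the direct error, the error through
   [v (F a) - v (F b)], and the error of [F] seen through [H b * p (F b)]. *)
pose Q := 1 + K * P + Hm * P.
have Q1 : 1 <= Q by rewrite /Q -addrA lerDl addr_ge0// mulr_ge0.
have Q0 : 0 < Q by rewrite (lt_le_trans ltr01).
have rec e : 0 < e -> e <= e0 -> exists2 s : R, 0 < s & s <= t /\ forall a b, `|a - b| <= s ->
    D a b <= e * Q * om a b + (`|H b| + e0) * D (F a) (F b).
  move=> e_0 ee0; have [t1 t10 ht1] := vH _ e_0; have [t2 t20 ht2] := uF _ e_0.
  exists (Num.min t (Num.min t1 t2)); first by rewrite !lt_min t0 t10.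
  split; first by rewrite ge_min lexx.
  move=> a b; rewrite !le_min => /and3P[abt abt1 abt2].
  have {}ht1 := ht1 _ _ abt1; have {}ht2 := ht2 _ _ abt2.
  have e1 : v a - v b - p b * (a - b) =
    (v a - v b - g b * (a - b) - H b * (v (F a) - v (F b)))
    + H b * (v (F a) - v (F b) - p (F b) * (F a - F b))
    + H b * p (F b) * (F a - F b - F' b * (a - b)).
    by rewrite (pE b); ring.
  have h1 : D a b <= e * (`|a - b| + `|v (F a) - v (F b)|)
     + `|H b| * D (F a) (F b) + Hm * P * (e * `|a - b|).
    rewrite {1}/D e1; apply: (le_trans (ler_normD _ _)); apply: lerD.
      by apply: (le_trans (ler_normD _ _)); apply: lerD => //; rewrite normrM.
    by rewrite !normrM; apply: ler_pM; rewrite ?mulr_ge0 ?ler_pM.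
  have h2 : `|v (F a) - v (F b)| <= D (F a) (F b) + P * (K * `|a - b|).
    rewrite -[X in `|X|](subrK (p (F b) * (F a - F b))).
    apply: (le_trans (ler_normD _ _)); rewrite lerD2l normrM.
    by apply: ler_pM.
  have h3 : `|a - b| <= om a b by rewrite omE ler_peMr.
  have D0 : 0 <= D (F a) (F b) by exact: normr_ge0.
  apply: (le_trans h1).
  apply: (@le_trans _ _ (e * Q * `|a - b| + (`|H b| + e) * D (F a) (F b))).
    have := ler_wpM2l (ltW e_0) h2; rewrite /Q; nra.
  by apply: lerD; rewrite ?ler_wpM2l ?ler_wpM2r ?lerD2l// mulr_ge0// ltW.
have rho0 (a b : R) : 0 <= `|H b| + e0 by rewrite addr_ge0// ltW.
have [s0 s00 [s0t hs0]] := rec e0 e00 (lexx _).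
have th'0 : 0 <= th' := le_trans th0 (ltW tt').
have [|a b sab|a b _|a b abs|a b abs|C [C0 hC]] := @scale_bound R F kap
  D om (fun a b => `|H b| + e0) th' (e0 * Q) s0
  (2 * V / s0 + P) kap1 Fkap th'0 t'1 s00.
- exact: om0.
- apply: (@le_trans _ _ ((2 * V / s0 + P) * `|a - b|)); last first.
    by rewrite omE ler_wpM2l ?addr_ge0 ?mulr_ge0 ?invr_ge0 ?(ltW s00)// ler_peMr.
  apply: (le_trans (ler_normB _ _)); rewrite mulrDl lerD//.
    rewrite mulrAC ler_pdivlMr// ler_pM ?(ltW s00)// (le_trans (ler_normB _ _))//.
    by rewrite mulr2n mulrDl mul1r lerD.
  by rewrite normrM ler_wpM2r.
- exact: rho0.
- exact: hs0.
- exact: ht (le_trans abs s0t).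
have hC' a b : D a b <= C * om a b.
  have [->|/hC//] := eqVneq a b.
  by rewrite /D !subrr mulr0 subr0 normr0 mulr_ge0.
move=> e e_0.
have Wm1 : 0 < Wm + 1 by rewrite ltr_wpDl.
pose e' := e / (Wm + 1) / 2.
have e'0 : 0 < e' by rewrite !divr_gt0.
(* [d] makes [d * Q / (1 - th') <= e'], and [n] below makes [th' ^+ n * C <= e']: the two terms of
   [scale_small] share [e / (Wm + 1)] equally. *)
pose d := Num.min e0 (e' * (1 - th') / Q).
have t'10 : 0 < 1 - th' by rewrite subr_gt0.
have d0 : 0 < d by rewrite lt_min e00 divr_gt0// mulr_gt0.
have de0 : d <= e0 by rewrite ge_min lexx.
have [s s_0 [st hs]] := rec d d0 de0.
have [n hn] : exists n, th' ^+ n * C <= e'.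
  have th'n : `|th'| < 1 by rewrite ger0_norm.
  have C1 : 0 < C + 1 by rewrite ltr_wpDl.
  have /cvgrPdist_lt/(_ (e' / (C + 1))) := cvg_expr th'n.
  rewrite divr_gt0// => /(_ isT)[n _ /(_ n (leqnn n))] /=.
  rewrite sub0r normrN ger0_norm ?exprn_ge0// ltr_pdivlMr// => /ltW h; exists n.
  by apply: le_trans h; rewrite ler_wpM2l ?exprn_ge0// lerDl.
have Kn : 0 < K ^+ n by rewrite exprn_gt0// (lt_le_trans ltr01).
exists (s / K ^+ n); first by rewrite divr_gt0.
move=> a b; rewrite ler_pdivlMr// mulrC => abs.
have dQ0 : 0 <= d * Q by rewrite mulr_ge0// ltW.
have := @scale_small R F K D om (fun a b => `|H b| + e0) th' (d * Q) s C K1 FK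
  th'0 t'1 s_0 hC' (fun a b _ => rho0 a b) hs
  (fun a b abs => ht a b (le_trans abs st)) dQ0 C0 om0 n a b abs.
move/le_trans; apply.
apply: (@le_trans _ _ ((e' + e') * om a b)).
  rewrite ler_wpM2r// lerD// ler_pdivrMr// -ler_pdivlMr//.
  by rewrite ge_min lexx orbT.
rewrite omE mulrCA mulrC ler_wpM2r//.
have -> : e' + e' = e / (Wm + 1) by rewrite /e'; field; rewrite lt0r_neq0.
rewrite mulrAC ler_pdivrMr// ler_wpM2l ?(ltW e_0)//.
by rewrite (le_trans (Wm_ b))// lerDl.
Qed.

(** * Functions of class C^r *)

Lemma is_deriveP (R : realType) (f : R -> R) (a d : R) :
  is_derive a 1 f d <->
  forall e : R, 0 < e -> exists2 t : R, 0 < t &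
    forall b, `|b - a| < t -> `|f b - f a - d * (b - a)| <= e * `|b - a|.
Proof.
have E h e : h != 0 -> (`|d - h^-1 *: ((f \o shift a) (h *: 1) - f a)| <= e) =
    (`|f (h + a) - f a - d * (h + a - a)| <= e * `|h + a - a|).
  move=> h0; rewrite /= scaler1 addrK -ler_pdivrMr ?normr_gt0//.
  rewrite -normf_div distrC; congr (`|_| <= e).
  by rewrite /GRing.scale/=; field.
split=> [fd e e0|h].
  have /cvgrPdist_le/(_ _ e0) : (fun h : R => h^-1 *: ((f \o shift a) (h *: 1) - f a)) @ 0^' --> d.
    have := @ex_derive _ _ _ a 1 f d fd.
    by rewrite /derivable => /cvgP; rewrite -(@derive_val _ _ _ a 1 f d fd).
  rewrite near_withinE => /nbhs_ballP[t /= t0 ht]; exists t => // b bat.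
  have [->|ba] := eqVneq b a; first by rewrite !subrr mulr0 subrr normr0 mulr0.
  have ba0 : b - a != 0 by rewrite subr_eq0.
  have := ht (b - a); rewrite /ball/= sub0r normrN => /(_ bat ba0).
  by rewrite E// subrK.
have hc : (fun h : R => h^-1 *: ((f \o shift a) (h *: 1) - f a)) @ 0^' --> d.
  apply/cvgrPdist_le => e e0; have [t t0 ht] := h e e0.
  rewrite near_withinE; apply/nbhs_ballP; exists t => //= x.
  rewrite /ball/= sub0r normrN => xt x0; rewrite E//.
  by apply: ht; rewrite addrK.
apply: DeriveDef; first by apply/cvg_ex; exists d.
exact: cvg_lim hc.
Qed.

Lemma is_derive_unique (R : realType) (f : R -> R) (a d d' : R) :
  is_derive a 1 f d -> is_derive a 1 f d' -> d = d'.
Proof. by move=> h h'; rewrite -(@derive_val _ _ _ _ _ _ _ h) (@derive_val _ _ _ _ _ _ _ h'). Qed.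

Lemma is_derive_continuous (R : realType) (f : R -> R) (a d : R) :
  is_derive a 1 f d -> {for a, continuous f}.
Proof.
by move=> h; apply: differentiable_continuous; apply/derivable1_diffP; exact: ex_derive.
Qed.

Lemma mvt_ball (R : realType) (f f' : R -> R) (a t b c : R) :
  (forall x, `|x - a| < t -> is_derive x 1 f (f' x)) ->
  `|b - a| < t -> `|c - a| < t ->
  exists2 x, `|x - a| < t & f b - f c = f' x * (b - c).
Proof.
move=> fd.
have H b' c' : c' <= b' -> `|b' - a| < t -> `|c' - a| < t ->
    exists2 x, `|x - a| < t & f b' - f c' = f' x * (b' - c').
  move=> cb bt ct.
  have sub x : x \in `[c', b'] -> `|x - a| < t.
    rewrite in_itv/= => /andP[cx xb]; move: bt ct; rewrite !ltr_norml.
    by move=> /andP[b1 b2] /andP[c1 c2]; apply/andP; split; lra.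
  have [| |x xcb ->] := @MVT_segment R f f' c' b' cb.
  - by move=> x xcb; apply/fd/sub; exact: subset_itv_oo_cc.
  - apply: continuous_in_subspaceT => x; rewrite inE => xcb.
    exact: is_derive_continuous (fd _ (sub _ xcb)).
  - by exists x => //; exact: sub.
have [cb|/ltW bc] := leP c b; first exact: H.
move=> bt ct; have [x xt h] := H _ _ bc ct bt; exists x => //.
by rewrite -(opprB (f c)) h -mulrN opprB.
Qed.

(** The same class as [Cr_line], by [Cr_lineP]; the derivative is a witness here, so that sums,
    products and compositions go by induction on [r]. *)
Fixpoint Cr (R : realType) (r : nat) (f : R -> R) : Prop :=
  if r is r'.+1 then
    exists2 f' : R -> R, (forall a : R, is_derive a 1 f (f' a)) & Cr r' f'
  else continuous f.

Lemma Cr_lineP (R : realType) (r : nat) (f : R -> R) : Cr_line r f <-> Cr r f.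
Proof.
elim: r f => [|r IH] f /=.
  by split=> [[]//|fc]; split.
split=> [[fd fc]|[f' fd /IH[f'd f'c]]].
  exists (derive1 f).
    move=> a; apply: DeriveDef; last by rewrite derive1E.
    exact: (fd 0 isT).
  apply/IH; split=> [i ir a|]; last by rewrite -derive1Sn.
  by rewrite -derive1Sn; exact: fd.
have f'E : (derive1 f) = f'.
  by apply/funext => a; rewrite derive1E; exact: derive_val.
split=> [[_ a|i ir a]|]; last by rewrite derive1Sn f'E.
- exact: ex_derive.
- by rewrite derive1Sn f'E; exact: f'd.
Qed.

Lemma Cr_continuous (R : realType) (r : nat) (f : R -> R) : Cr r f -> continuous f.
Proof. by case: r => //= r [f' fd _] a; exact: is_derive_continuous (fd a). Qed.

Lemma Cr_pred (R : realType) (r : nat) (f : R -> R) : Cr r.+1 f -> Cr r f.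
Proof.
elim: r f => [|r IH] f; first by move=> h; exact: (Cr_continuous h).
by move=> [f' fd /IH f'r]; exists f'.
Qed.

Lemma Cr_le (R : realType) (r r' : nat) (f : R -> R) : (r' <= r)%N -> Cr r f -> Cr r' f.
Proof.
move=> /subnK <-; elim: (r - r')%N => // n IH.
by rewrite addSn => /Cr_pred.
Qed.

Lemma Cr_derive (R : realType) (r : nat) (f f' : R -> R) :
  (forall a : R, is_derive a 1 f (f' a)) -> Cr r.+1 f -> Cr r f'.
Proof.
move=> fd [g gd gr]; suff -> : f' = g by [].
by apply/funext => a; exact: is_derive_unique (fd a) (gd a).
Qed.

Lemma Cr_cst (R : realType) (r : nat) (c : R) : Cr r (fun=> c).
Proof.
elim: r c => [|r IH] c; first exact: cst_continuous.
by exists (fun=> 0) => // a; exact: is_derive_cst.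
Qed.

Lemma CrD (R : realType) (r : nat) (f g : R -> R) :
  Cr r f -> Cr r g -> Cr r (fun a => f a + g a).
Proof.
elim: r f g => [|r IH] f g; first by move=> fc gc a; apply: cvgD; [exact: fc|exact: gc].
move=> [f' fd fr] [g' gd gr]; exists (fun a => f' a + g' a); last exact: IH.
by move=> a; exact: is_deriveD.
Qed.

Lemma CrM (R : realType) (r : nat) (f g : R -> R) :
  Cr r f -> Cr r g -> Cr r (fun a => f a * g a).
Proof.
elim: r f g => [|r IH] f g; first by move=> fc gc a; apply: cvgM; [exact: fc|exact: gc].
move=> hf hg; have hf1 := Cr_pred hf; have hg1 := Cr_pred hg.
move: hf hg => [f' fd fr] [g' gd gr].
exists (fun a => f a * g' a + g a * f' a); last by apply: CrD; exact: IH.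
by move=> a; exact: is_deriveM.
Qed.

Lemma CrX (R : realType) (r n : nat) (f : R -> R) :
  Cr r f -> Cr r (fun a => f a ^+ n).
Proof.
move=> fr; elim: n => [|n IH]; first exact: Cr_cst.
by under eq_fun do rewrite exprS; exact: CrM.
Qed.

Lemma Cr_comp (R : realType) (r : nat) (f g : R -> R) :
  Cr r f -> Cr r g -> Cr r (fun a => f (g a)).
Proof.
elim: r f g => [|r IH] f g.
  by move=> fc gc a; apply: (@continuous_comp _ _ _ g f); [exact: gc|exact: fc].
move=> hf hg; have hg1 := Cr_pred hg.
move: hf hg => [f' fd fr] [g' gd gr].
exists (fun a => f' (g a) * g' a); last by apply: CrM => //; exact: IH.
by move=> a; exact: is_derive1_comp.
Qed.

Lemma is_derive_within_interior (R : realType) (f : R -> R) (s d : R) :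
  0 < s < 1 -> is_derive_within `[0, 1[ f s d -> is_derive s 1 f d.
Proof.
move=> /andP[s0 s1] /cvgrPdist_le h; apply/is_deriveP => e e0.
have := h e e0; rewrite near_withinE near_withinE => /nbhs_ballP[t /= t0 ht].
exists (Num.min t (Num.min s (1 - s))).
  by rewrite !lt_min t0 s0 subr_gt0.
move=> b; rewrite !lt_min => /and3P[bt bs b1s].
have [->|bs0] := eqVneq b s; first by rewrite !subrr mulr0 subrr normr0 mulr0.
have := ht b; rewrite /ball/= distrC => /(_ bt bs0).
rewrite in_itv/=; move: bs b1s; rewrite !ltr_norml => /andP[h1 h2] /andP[h3 h4].
have -> : 0 <= b < 1 by apply/andP; split; lra.
move=> /(_ isT); rewrite -ler_pdivrMr ?normr_gt0 ?subr_eq0// -normf_div distrC.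
congr (`|_| <= e); field; by rewrite subr_eq0.
Qed.

Definition strip_continuous (R : realType) (f : R -> R -> R) : Prop :=
  {within [set z : R * R | 0 <= z.2 < 1], continuous (fun z : R * R => f z.1 z.2)}.

Lemma Cr_strip_continuous (R : realType) (r : nat) (f : R -> R -> R) :
  Cr_strip r f -> strip_continuous f.
Proof. by case: r => [|r] []. Qed.

Lemma strip_continuousP (R : realType) (f : R -> R -> R) :
  strip_continuous f -> forall a s, 0 <= s < 1 -> forall e : R, 0 < e ->
  exists2 t : R, 0 < t & forall b y, `|b - a| < t -> `|y - s| < t -> 0 <= y < 1 ->
    `|f b y - f a s| <= e.
Proof.
move=> /subspace_continuousP fc a s s01 e e0.
have /cvgrPdist_le/(_ _ e0) := fc (a, s) s01.
rewrite near_withinE => /nbhs_ballP[t /= t0 ht]; exists t => // b y ba ys y01.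
by rewrite distrC; apply: (ht (b, y)) => //; split; rewrite /ball/= distrC.
Qed.

Lemma strip_comp_continuous (R : realType) (f : R -> R -> R) (u : R -> R) :
  strip_continuous f -> (forall a, 0 <= u a < 1) -> continuous u ->
  continuous (fun a => f a (u a)).
Proof.
move=> fc u01 uc a; apply/cvgrPdist_le => e e0.
have [t t0 ht] := strip_continuousP fc a (u01 a) e0.
have /cvgrPdist_lt/(_ _ t0)/nbhs_ballP[t2 /= t20 ht2] := uc a.
apply/nbhs_ballP; exists (Num.min t t2); first by rewrite /= lt_min t0.
move=> b; rewrite /ball/= lt_min => /andP[bt bt2]; rewrite distrC; apply: ht => //.
  by rewrite distrC.
by rewrite distrC; exact: ht2.
Qed.

(** Mean value theorem along the path from [(c, z)] to [(c, y)] to [(b, y)], which stays where both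
    partial derivatives oscillate by at most [e]. The base point [(c, z)] is left free for the sake
    of uniformity later. *)
Lemma strip_strict_diff (R : realType) (f fx fs : R -> R -> R) (a s : R) :
  (forall a s : R, 0 <= s < 1 -> is_derive a 1 (fun b => f b s) (fx a s)) ->
  (forall a s : R, 0 <= s < 1 -> is_derive_within `[0, 1[ (f a) s (fs a s)) ->
  strip_continuous fx -> strip_continuous fs -> 0 < s < 1 ->
  forall e : R, 0 < e -> exists2 t : R, 0 < t & forall b c y z,
    `|b - a| < t -> `|c - a| < t -> `|y - s| < t -> `|z - s| < t ->
    `|f b y - f c z - fx c z * (b - c) - fs c z * (y - z)| <=
      e * (`|b - c| + `|y - z|).
Proof.
move=> dx ds cx cs s01 e e0.
have [s0 s1] := andP s01.
have s01' : 0 <= s < 1 by rewrite ltW.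
have e20 : 0 < e / 2 by rewrite divr_gt0.
have [t1 t10 ht1] := strip_continuousP cx a s01' e20.
have [t2 t20 ht2] := strip_continuousP cs a s01' e20.
pose t := Num.min (Num.min t1 t2) (Num.min s (1 - s)).
have t0 : 0 < t by rewrite !lt_min t10 t20 s0 subr_gt0.
have tt1 : t <= t1 by rewrite !ge_min lexx.
have tt2 : t <= t2 by rewrite !ge_min lexx !orbT.
have t01 x : `|x - s| < t -> 0 < x < 1.
  rewrite !lt_min => /and3P[_]; rewrite !ltr_norml => /andP[h1 h2] /andP[h3 h4].
  by apply/andP; split; lra.
have t01' x : `|x - s| < t -> 0 <= x < 1.
  by move=> /t01/andP[x0 ->]; rewrite ltW.
exists t => // b c y z ba ca ys zs.
have [xi xia hxi] := @mvt_ball R (fun b => f b y) (fx^~ y) a t b c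
  (fun x _ => dx x y (t01' _ ys)) ba ca.
have [ze zes hze] := @mvt_ball R (f c) (fs c) s t y z
  (fun x xs => is_derive_within_interior (t01 _ xs) (ds c x (t01' _ xs))) ys zs.
have -> : f b y - f c z - fx c z * (b - c) - fs c z * (y - z) =
   (fx xi y - fx c z) * (b - c) + (fs c ze - fs c z) * (y - z).
  have {}hxi : f b y - f c y = fx xi y * (b - c) := hxi.
  have -> : f b y - f c z = (f b y - f c y) + (f c y - f c z) by ring.
  by rewrite hxi hze; ring.
have hb (g : R -> R -> R) t' b1 y1 b2 y2 : t <= t' ->
   (forall b y, `|b - a| < t' -> `|y - s| < t' -> 0 <= y < 1 -> `|g b y - g a s| <= e / 2) ->
   `|b1 - a| < t -> `|y1 - s| < t -> `|b2 - a| < t -> `|y2 - s| < t ->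
   `|g b1 y1 - g b2 y2| <= e.
  move=> tt' h h1 h2 h3 h4.
  rewrite -(subrK (g a s) (g b1 y1)) -addrA (le_trans (ler_normD _ _))//.
  rewrite (splitr e) lerD//; last rewrite distrC.
    by apply: h; rewrite ?t01'// (lt_le_trans _ tt').
  by apply: h; rewrite ?t01'// (lt_le_trans _ tt').
rewrite (le_trans (ler_normD _ _))// !normrM [leRHS]mulrDr lerD// ler_wpM2r//.
  exact: (hb fx t1).
exact: (hb fs t2).
Qed.

Lemma strip_comp_is_derive (R : realType) (f fx fs : R -> R -> R) (u u' : R -> R) (a : R) :
  (forall a s : R, 0 <= s < 1 -> is_derive a 1 (fun b => f b s) (fx a s)) ->
  (forall a s : R, 0 <= s < 1 -> is_derive_within `[0, 1[ (f a) s (fs a s)) ->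
  strip_continuous fx -> strip_continuous fs -> 0 < u a < 1 ->
  is_derive a 1 u (u' a) ->
  is_derive a 1 (fun a => f a (u a)) (fx a (u a) + fs a (u a) * u' a).
Proof.
move=> dx ds cx cs u01 ud; apply/is_deriveP => e e0.
have [L L0 hL] : exists2 L : R, 0 < L & `|u' a| + 1 <= L /\ `|fs a (u a)| + 1 <= L.
  exists (`|u' a| + `|fs a (u a)| + 1); first by rewrite ltr_wpDl// addr_ge0.
  by rewrite !lerD2r lerDl lerDr.
pose e1 := Num.min 1 (e / (1 + 2 * L)).
have L1 : 0 < 1 + 2 * L by rewrite addr_gt0// mulr_gt0.
have e10 : 0 < e1 by rewrite lt_min ltr01 divr_gt0.
have [t t0 ht] := strip_strict_diff a dx ds cx cs u01 e10.
have [t1 t10 ht1] := (is_deriveP _ _ _).1 ud _ e10.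
have /cvgrPdist_lt/(_ _ t0)/nbhs_ballP[t2 /= t20 ht2] := is_derive_continuous ud.
exists (Num.min t (Num.min t1 t2)); first by rewrite !lt_min t0 t10.
move=> b; rewrite !lt_min => /and3P[bt bt1 bt2].
have {}ht1 := ht1 _ bt1.
have {}ht2 : `|u b - u a| < t.
  by have := ht2 b; rewrite /ball/= distrC (distrC (u a)); apply.
have {ht} h : `|f b (u b) - f a (u a) - fx a (u a) * (b - a) - fs a (u a) * (u b - u a)|
    <= e1 * (`|b - a| + `|u b - u a|).
  by apply: ht => //; rewrite subrr normr0.
have h1 : `|u b - u a| <= L * `|b - a|.
  rewrite -(subrK (u' a * (b - a)) (u b - u a)) (le_trans (ler_normD _ _))//.
  rewrite normrM (le_trans (lerD ht1 (lexx _)))// -mulrDl ler_wpM2r//.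
  by case: hL => + _; apply: le_trans; rewrite addrC lerD2l ge_min lexx.
have -> : f b (u b) - f a (u a) - (fx a (u a) + fs a (u a) * u' a) * (b - a) =
  (f b (u b) - f a (u a) - fx a (u a) * (b - a) - fs a (u a) * (u b - u a))
  + fs a (u a) * (u b - u a - u' a * (b - a)) by ring.
rewrite (le_trans (ler_normD _ _))// normrM.
apply: (@le_trans _ _ (e1 * (`|b - a| + L * `|b - a|) + L * (e1 * `|b - a|))).
  apply: lerD; first by apply: (le_trans h); rewrite ler_wpM2l ?(ltW e10)// lerD2l.
  apply: ler_pM => //; case: hL => _; apply: le_trans; by rewrite lerDl.
have -> : e1 * (`|b - a| + L * `|b - a|) + L * (e1 * `|b - a|) =
  e1 * (1 + 2 * L) * `|b - a| by ring.
by rewrite ler_wpM2r// -ler_pdivlMr// ge_min lexx orbT.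
Qed.

Lemma Cr_strip_pred (R : realType) (r : nat) (f : R -> R -> R) :
  Cr_strip r.+1 f -> Cr_strip r f.
Proof.
elim: r f => [|r IH] f; first by case.
by move=> [fc [fx [fs [dx ds /IH hx /IH hs]]]]; split => //; exists fx, fs.
Qed.

Lemma Cr_strip_comp (R : realType) (r : nat) (f : R -> R -> R) (u : R -> R) :
  Cr_strip r f -> (forall a, 0 < u a < 1) -> Cr r u -> Cr r (fun a => f a (u a)).
Proof.
move=> + u01; have u01' a : 0 <= u a < 1 by have /andP[/ltW -> ->] := u01 a.
elim: r f => [|r IH] f hf hu.
  exact: strip_comp_continuous (Cr_strip_continuous hf) u01' hu.
have hu1 := Cr_pred hu; case: hu => u' ud u'r.
case: hf => [fc [fx [fs [dx ds hx hs]]]].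
exists (fun a => fx a (u a) + fs a (u a) * u' a).
  move=> a; exact: (strip_comp_is_derive dx ds (Cr_strip_continuous hx)
    (Cr_strip_continuous hs) (u01 a) (ud a)).
by apply: CrD; [exact: IH|apply: CrM => //; exact: IH].
Qed.

(** * Periodic functions *)

(** A Lebesgue number argument: [P t x] gets easier as [t] decreases, so local thresholds on a
    compact set have a common positive lower bound. *)
Lemma compact_uniform (R : realType) (X : topologicalType) (A : set X)
    (P : R -> X -> Prop) :
  compact A -> (forall t t' x, 0 < t' -> t' <= t -> P t x -> P t' x) ->
  (forall x, A x -> exists2 t : R, 0 < t & \forall y \near x, P t y) ->
  exists2 t : R, 0 < t & forall x, A x -> P t x.
Proof.
move=> /compact_near_coveringP cA Pt AP.
have H : \forall i \near (0 : R)^'+, A `<=` P i.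
  apply: cA => x /AP[t t0 ht].
  exists (P t, [set i | 0 < i <= t]) => /=.
    split=> //; near=> i; apply/andP; split.
      by near: i; exact: nbhs_right_gt.
    by near: i; exact: nbhs_right_le.
  by move=> [y i] /= [h /andP[i0 it]]; exact: Pt h.
have : \forall i \near (0 : R)^'+, 0 < i /\ A `<=` P i.
  by apply: filterS2 H (nbhs_right_gt 0) => i h1 h2.
by move=> /filter_ex[t [t0 h]]; exists t.
Unshelve. all: by end_near.
Qed.

Definition periodic (R : realType) (T : Type) (f : R -> T) : Prop :=
  forall a, f (a + 1) = f a.

Lemma periodic_int (R : realType) (T : Type) (f : R -> T) (n : int) (a : R) :
  periodic f -> f (a + n%:~R) = f a.
Proof.
move=> fp.
have N (m : nat) b : f (b + m%:R) = f b.
  elim: m b => [|m IH] b; first by rewrite addr0.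
  by rewrite -addn1 natrD addrA fp IH.
case: (intP n) => [|m|m]; first by rewrite addr0.
  by rewrite -pmulrn N.
by rewrite -{2}(subrK m.+1%:R a) N mulrNz -pmulrn.
Qed.

Lemma fundamental_domain (R : realType) (a : R) :
  exists n : int, a + n%:~R \in `[0, 1].
Proof.
exists (- Num.floor a); rewrite in_itv/= mulrNz subr_ge0.
have /andP[h1 h2] := floor_itv a.
by rewrite h1/= lerBlDl (le_trans (ltW h2))// intrD.
Qed.

Lemma periodic_uniform (R : realType) (P : R -> R -> Prop) :
  (forall t t' a, 0 < t' -> t' <= t -> P t a -> P t' a) ->
  (forall t, periodic (P t)) ->
  (forall a, exists2 t : R, 0 < t & forall b, `|b - a| < t -> P t b) ->
  exists2 t : R, 0 < t & forall a, P t a.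
Proof.
move=> Pt Pp Pa.
have [|t t0 ht] := @compact_uniform R R `[0, 1]%classic P (@segment_compact _ _ _) Pt.
  move=> a _; have [t t0 ht] := Pa a; exists t => //.
  by apply/nbhs_ballP; exists t => //= b; rewrite /ball/= distrC; exact: ht.
exists t => // a; have [n an] := fundamental_domain a.
by rewrite -(periodic_int n a (Pp t)); exact: (ht _ an).
Qed.

Lemma continuous_ball (R : realType) (f : R -> R) (a e : R) :
  continuous f -> 0 < e ->
  exists2 t : R, 0 < t & forall b, `|b - a| < t -> `|f b - f a| < e.
Proof.
move=> fc e0; have /cvgrPdist_lt/(_ _ e0)/nbhs_ballP[t /= t0 ht] := fc a.
exists t => // b bt; rewrite distrC; apply: ht.
by rewrite /ball/= distrC.
Qed.

Lemma periodic_bounded (R : realType) (f : R -> R) :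
  continuous f -> periodic f -> exists M, forall a, `|f a| <= M.
Proof.
move=> fc fp.
(* Boundedness becomes a threshold property when the bound is written [t^-1]. *)
have [t t' a t'0 tt'|t a|a|t t0 ht] := @periodic_uniform R (fun t a => `|f a| <= t^-1).
- by move/le_trans; apply; rewrite lef_pV2// posrE// (lt_le_trans t'0).
- by rewrite fp.
- have [t t0 ht] := continuous_ball a fc ltr01.
  have M0 : 0 < `|f a| + 1 by rewrite ltr_wpDl.
  exists (Num.min t (`|f a| + 1)^-1); first by rewrite lt_min t0 invr_gt0.
  move=> b; rewrite lt_min => /andP[bt _].
  have h1 : `|f b| <= `|f a| + 1.
    rewrite -(subrK (f a) (f b)) (le_trans (ler_normD _ _))// addrC lerD2l.
    exact/ltW/ht.
  apply: (le_trans h1); rewrite -[leLHS]invrK lef_pV2 ?posrE ?invr_gt0//.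
    by rewrite ge_min lexx orbT.
  by rewrite lt_min t0 invr_gt0.
by exists t^-1.
Qed.

Lemma periodic_ucont (R : realType) (f : R -> R) :
  continuous f -> periodic f -> forall e : R, 0 < e ->
  exists2 t : R, 0 < t & forall a b, `|a - b| <= t -> `|f a - f b| <= e.
Proof.
move=> fc fp e e0.
have [t t' b t'0 tt'|t b|a|t t0 ht] :=
  @periodic_uniform R (fun t b => forall a, `|a - b| <= t -> `|f a - f b| <= e).
- by move=> h a ab; apply: h; exact: le_trans tt'.
- apply/propext; split => h a ab.
    have := h (a + 1); rewrite !fp => /(_ _); apply; apply: le_trans ab.
    by rewrite opprD addrACA subrr addr0.
  rewrite fp -{1}(subrK 1 a) fp; apply: h; apply: le_trans ab.
  by rewrite opprD addrA addrAC.
- have e20 : 0 < e / 2 by rewrite divr_gt0.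
  have [t t0 ht] := continuous_ball a fc e20.
  have t20 : 0 < t / 2 by rewrite divr_gt0.
  exists (t / 2) => // b ba c cb.
  rewrite -(subrK (f a) (f c)) -addrA (le_trans (ler_normD _ _))// (splitr e) lerD//.
    apply/ltW/ht; rewrite -(subrK b c) -addrA (le_lt_trans (ler_normD _ _))//.
    by rewrite (splitr t) ler_ltD.
  by rewrite distrC; apply/ltW/ht; rewrite (lt_le_trans ba)// ler_pdivrMr// ler_peMr ?(ltW t0)// ler1n.
by exists t => // a b; exact: ht.
Qed.

Lemma periodic_udiff (R : realType) (f f' : R -> R) :
  (forall a, is_derive a (1 : R) f (f' a)) -> continuous f' -> periodic f' -> udiff f f'.
Proof.
move=> fd f'c f'p e e0; have [t t0 ht] := periodic_ucont f'c f'p e0.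
have t20 : 0 < t / 2 by rewrite divr_gt0.
exists (t / 2) => // a b ab.
have t2t : t / 2 < t by rewrite ltr_pdivrMr// ltr_pMr// ltr1n.
have [|x xb ->] := @mvt_ball R f f' b t a b (fun x _ => fd x) (le_lt_trans ab t2t).
  by rewrite subrr normr0.
by rewrite -mulrBl normrM ler_wpM2r// ht// ltW.
Qed.

(** [strip_strict_diff] made uniform by compactness of [[0, 1] * [lo, hi]] and integer translations
    of the first variable. Only [z] has to lie in [[lo, hi]]; [y] follows, being [t]-close to it. *)
Lemma strip_udiff (R : realType) (f fx fs : R -> R -> R) (lo hi : R) :
  (forall a s : R, 0 <= s < 1 -> is_derive a 1 (fun b => f b s) (fx a s)) ->
  (forall a s : R, 0 <= s < 1 -> is_derive_within `[0, 1[ (f a) s (fs a s)) ->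
  strip_continuous fx -> strip_continuous fs -> 0 < lo -> hi < 1 ->
  periodic f -> (forall s, 0 < s < 1 -> periodic (fx^~ s)) ->
  (forall s, 0 < s < 1 -> periodic (fs^~ s)) ->
  forall e : R, 0 < e -> exists2 t : R, 0 < t & forall b c y z,
    `|b - c| <= t -> `|y - z| <= t -> lo <= z <= hi ->
    `|f b y - f c z - fx c z * (b - c) - fs c z * (y - z)| <=
      e * (`|b - c| + `|y - z|).
Proof.
move=> dx ds cx cs lo0 hi1 fp fxp fsp e e0.
pose P (t : R) (cz : R * R) := forall b y, `|b - cz.1| <= t -> `|y - cz.2| <= t ->
  `|f b y - f cz.1 cz.2 - fx cz.1 cz.2 * (b - cz.1) - fs cz.1 cz.2 * (y - cz.2)| <=
      e * (`|b - cz.1| + `|y - cz.2|).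
have [|t t' [c z] t'0 tt'|[c z] /=|t t0 ht] :=
  @compact_uniform R (R * R)%type (`[0, 1] `*` `[lo, hi])%classic P.
- by apply: compact_setX; exact: segment_compact.
- by move=> h b y bc yz; apply: h => //; exact: le_trans tt'.
- move=> [_]; rewrite in_itv/= => /andP[loz zhi].
  have z01 : 0 < z < 1 by rewrite (lt_le_trans lo0)// (le_lt_trans zhi).
  have [t t0 ht] := strip_strict_diff c dx ds cx cs z01 e0.
  have t20 : 0 < t / 2 by rewrite divr_gt0.
  have t2t : t / 2 < t by rewrite ltr_pdivrMr// ltr_pMr// ltr1n.
  exists (t / 2) => //; apply/nbhs_ballP; exists (t / 2) => // -[c' z'].
  rewrite /ball/= => -[]; rewrite /ball/= => cc' zz' b y /= bc' yz'.
  apply: ht; rewrite 1?distrC ?(lt_trans cc') ?(lt_trans zz')//.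
    rewrite -(subrK c' c) -addrA (le_lt_trans (ler_normD _ _))// (splitr t) ltr_leD//.
    by rewrite distrC.
  rewrite -(subrK z' z) -addrA (le_lt_trans (ler_normD _ _))// (splitr t) ltr_leD//.
  by rewrite distrC.
exists t => // b c y z bc yz /andP[loz zhi].
have [n cn] := fundamental_domain c.
have z01 : 0 < z < 1 by rewrite (lt_le_trans lo0)// (le_lt_trans zhi).
have := ht (c + n%:~R, z) _ (b + n%:~R) y; rewrite /= (periodic_int n b fp)
  (periodic_int n c fp) (periodic_int n c (fxp _ z01)) (periodic_int n c (fsp _ z01)).
rewrite opprD addrACA subrr addr0; apply => //.
by split => //=; rewrite in_itv/= loz.
Qed.

(** The product [H * (v o F)] is expanded without differentiating [v o F]: the mixed term
    [H' b * (a - b) * (v (F a) - v (F b))] is absorbed by the part of the error proportional to the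
    increment of [v o F]. *)
Lemma udiff_cocycle_linear (R : realType) (F v g g' H H' : R -> R) (V M : R) :
  (forall a, v a = g a + H a * v (F a)) -> udiff g g' -> udiff H H' ->
  (forall a, `|v a| <= V) -> (forall a, `|H' a| <= M) ->
  udiff_cocycle F v (fun b => g' b + H' b * v (F b)) H.
Proof.
move=> vE ug uH vV H'M e e0.
have V0 : 0 <= V := le_trans (normr_ge0 _) (vV 0).
have M0 : 0 <= M := le_trans (normr_ge0 _) (H'M 0).
have V1 : 0 < 1 + V by rewrite ltr_pwDl.
have M1 : 0 < 1 + M by rewrite ltr_pwDl.
pose e1 := e / (1 + V).
have e10 : 0 < e1 by rewrite divr_gt0.
have [t1 t10 ht1] := ug _ e10; have [t2 t20 ht2] := uH _ e10.
exists (Num.min (e / (1 + M)) (Num.min t1 t2)); first by rewrite !lt_min t10 t20 divr_gt0.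
move=> a b; rewrite !le_min => /and3P[ab /ht1{}ht1 /ht2{}ht2].
have -> : v a - v b - (g' b + H' b * v (F b)) * (a - b) - H b * (v (F a) - v (F b)) =
  (g a - g b - g' b * (a - b)) + (H a - H b - H' b * (a - b)) * v (F a)
  + H' b * (a - b) * (v (F a) - v (F b)) by rewrite (vE a) (vE b); ring.
rewrite (le_trans (ler_normD _ _))// [leRHS]mulrDr; apply: lerD.
  rewrite (le_trans (ler_normD _ _))// normrM.
  apply: (@le_trans _ _ (e1 * `|a - b| + e1 * `|a - b| * V)).
    by apply: lerD => //; exact: ler_pM.
  have -> : e1 * `|a - b| + e1 * `|a - b| * V = e1 * (1 + V) * `|a - b| by ring.
  by rewrite /e1 divfK ?lt0r_neq0.
rewrite !normrM ler_wpM2r//.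
move: ab; rewrite ler_pdivlMr// mulrC; apply: le_trans.
by rewrite ler_wpM2r// (le_trans (H'M b))// lerDr.
Qed.

(** * Bootstrapping the regularity of a fixed point *)

Lemma udiff_is_derive (R : realType) (f f' : R -> R) (a : R) :
  udiff f f' -> is_derive a (1 : R) f (f' a).
Proof.
move=> fu; apply/is_deriveP => e e0; have [t t0 ht] := fu e e0.
by exists t => // b bt; apply: ht; exact: ltW.
Qed.

Lemma udiff_continuous (R : realType) (f f' : R -> R) :
  udiff f f' -> continuous f'.
Proof.
move=> fu a; apply/cvgrPdist_le => e e0.
have e20 : 0 < e / 2 by rewrite divr_gt0.
have [t t0 ht] := fu _ e20; apply/nbhs_ballP; exists t => // b.
rewrite /ball/= => /ltW abt; have := ht _ _ abt; have := ht b a.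
rewrite distrC => /(_ abt) h1 h2.
have [->|ab] := eqVneq a b; first by rewrite subrr normr0 ltW.
have ab0 : 0 < `|a - b| by rewrite normr_gt0 subr_eq0.
rewrite -(ler_pM2r ab0) -normrM (splitr e) [leRHS]mulrDl.
have -> : (f' a - f' b) * (a - b) =
  (f a - f b - f' b * (a - b)) + (f b - f a - f' a * (b - a)) by ring.
by rewrite (le_trans (ler_normD _ _))// lerD// distrC (distrC a).
Qed.

Lemma periodic_derive (R : realType) (f f' : R -> R) :
  (forall a, is_derive a (1 : R) f (f' a)) -> periodic f -> periodic f'.
Proof.
move=> fd fp a; apply: (@is_derive_unique _ f a) => //.
apply/is_deriveP => e e0; have [t t0 ht] := (is_deriveP _ _ _).1 (fd (a + 1)) e e0.
exists t => // b bt; have := ht (b + 1).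
by rewrite !fp opprD addrACA subrr addr0; exact.
Qed.

Lemma periodic_comp (R : realType) (T : Type) (F : R -> R) (f : R -> T) (d : int) :
  (forall a, F (a + 1) = F a + d%:~R) -> periodic f -> periodic (fun a => f (F a)).
Proof. by move=> Fd fp a; rewrite Fd periodic_int. Qed.

Lemma degree_derive_periodic (R : realType) (F F' : R -> R) (d : int) :
  (forall a, is_derive a (1 : R) F (F' a)) -> (forall a, F (a + 1) = F a + d%:~R) ->
  periodic F'.
Proof.
move=> Fd Fdeg a.
suff h : is_derive a (1 : R) F (F' (a + 1)) by exact: is_derive_unique h (Fd a).
apply/is_deriveP => e e0; have [t t0 ht] := (is_deriveP _ _ _).1 (Fd (a + 1)) e e0.
exists t => // b bt; have := ht (b + 1).
by rewrite !Fdeg opprD addrACA subrr addr0 opprD addrACA subrr addr0; exact.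
Qed.

Section fixed_point_regularity.
Variables (R : realType) (F F' q A W : R -> R) (f : R -> R -> R).
Variables (k : nat) (d : int) (kap K th al Wm lo hi : R).
Hypotheses (al0 : 0 < al) (al1 : al <= 1) (kap1 : 1 < kap) (K1 : 1 <= K).
Hypotheses (th0 : 0 <= th) (th1 : th < 1) (lo0 : 0 < lo) (hi1 : hi < 1).
Hypothesis Fkap : forall a b, kap * `|a - b| <= `|F a - F b|.
Hypothesis FK : forall a b, `|F a - F b| <= K * `|a - b|.
Hypothesis Fd : forall a, is_derive a (1 : R) F (F' a).
Hypothesis Fdeg : forall a, F (a + 1) = F a + d%:~R.
Hypothesis Fr : Cr k.+1 F.
Hypothesis F'1 : forall a, 1 <= `|F' a|.
Hypothesis fr : Cr_strip k.+1 f.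
Hypothesis fp : periodic f.
Hypotheses (qc : continuous q) (qp : periodic q).
Hypothesis qlohi : forall a, lo <= q a <= hi.
Hypothesis qE : forall a, q a = f a (q (F a)).
Hypothesis Ad : forall a, is_derive (q (F a)) 1 (f a) (A a).
Hypotheses (W1 : forall a, 1 <= W a) (WWm : forall a, W a <= Wm).
Hypothesis AW : forall a, `|A a| * `|F' a| `^ (k%:R + al) * W (F a) <= th * W a.

Let q01 a : 0 < q a < 1.
Proof. by have /andP[h1 h2] := qlohi a; rewrite (lt_le_trans lo0)// (le_lt_trans h2). Qed.

(** As [F'] has modulus at least 1, the exponent [k + al] dominates those needed on the way:
    [n + al] with [n <= k] for a Hölder bound, and [n + 1] with [n < k] for one more derivative. *)
Let AW_le g a : g <= k%:R + al -> `|A a| * `|F' a| `^ g * W (F a) <= th * W a.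
Proof.
move=> gk; apply: le_trans (AW a); rewrite ler_wpM2r ?(le_trans ler01)//.
by rewrite ler_wpM2l// ler_powR.
Qed.

Let AWn n a : (n <= k)%N -> `|A a * F' a ^+ n| * `|F' a| `^ al * W (F a) <= th * W a.
Proof.
move=> nk; have := @AW_le (n%:R + al) a.
rewrite lerD2r ler_nat nk => /(_ isT); apply: le_trans.
rewrite powRD.
  by rewrite powR_mulrn// normrM normrX !mulrA.
by apply/implyP => _; rewrite gt_eqF// (lt_le_trans ltr01).
Qed.

Let AWS n a : (n < k)%N -> `|A a * F' a ^+ n| * `|F' a| * W (F a) <= th * W a.
Proof.
move=> nk; have := @AW_le (n.+1%:R) a.
have -> : n.+1%:R <= k%:R + al by rewrite (@le_trans _ _ k%:R) ?ler_nat// lerDl ltW.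
by rewrite powR_mulrn// exprSr normrM normrX !mulrA => /(_ isT).
Qed.

Let F'p : periodic F'. Proof. exact: degree_derive_periodic Fd Fdeg. Qed.

Let F'r : Cr k F'. Proof. exact: Cr_derive Fd Fr. Qed.

Let uF : udiff F F'.
Proof. by apply: periodic_udiff => //; exact: Cr_continuous F'r. Qed.

Let qFp : periodic (fun a => q (F a)). Proof. exact: periodic_comp Fdeg qp. Qed.

(** The nonlinear equation of [q] is linearized at [(a, q (F a))]: [g] is the partial derivative in
    the first variable there, and [A], given only pointwise as a derivative, is the other one. Hence
    both are as smooth as [q], up to order [k], which drives the bootstrap. *)
Let A_smooth_cocycle : exists g,
  [/\ udiff_cocycle F q g A, periodic g, periodic A,
      forall i, (i <= k)%N -> Cr i q -> Cr i g &
      forall i, (i <= k)%N -> Cr i q -> Cr i A].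
Proof.
have [fc [fx [fs [dx ds hx hs]]]] := fr.
have AE a : A a = fs a (q (F a)).
  apply: is_derive_unique (Ad a) _; apply: is_derive_within_interior => //.
  by apply: ds; have /andP[/ltW -> ->] := q01 (F a).
have fxp s : 0 < s < 1 -> periodic (fx^~ s).
  move=> /andP[/ltW s0 s1]; apply: (@periodic_derive _ (f^~ s)) => a.
    by apply: dx; rewrite s0.
  by rewrite fp.
have fsp s : 0 < s < 1 -> periodic (fs^~ s).
  move=> s01 a; have s01' : 0 <= s < 1 by have /andP[/ltW -> ->] := s01.
  apply: (@is_derive_unique _ (f a) s); last exact: is_derive_within_interior (ds a s s01').
  by rewrite -(fp a); exact: is_derive_within_interior (ds _ s s01').
have r_comp (g : R -> R -> R) i : (i <= k)%N -> Cr_strip k g -> Cr i q ->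
    Cr i (fun a => g a (q (F a))).
  move=> ik gr qr; apply: Cr_strip_comp => //.
    move: gr; rewrite -(subnK ik); elim: (k - i)%N => // n IH.
    by rewrite addSn => /Cr_strip_pred.
  by apply: Cr_comp => //; apply: Cr_le Fr; rewrite ltnW.
exists (fun a => fx a (q (F a))); split.
- move=> e e0.
  have [t t0 ht] := strip_udiff dx ds (Cr_strip_continuous hx) (Cr_strip_continuous hs)
    lo0 hi1 fp fxp fsp e0.
  have [t1 t10 ht1] := periodic_ucont qc qp t0.
  have K0 : 0 < K := lt_le_trans ltr01 K1.
  exists (Num.min t (t1 / K)); first by rewrite lt_min t0 divr_gt0.
  move=> a b; rewrite le_min => /andP[abt abt1]; rewrite AE (qE a) (qE b).
  apply: ht => //; apply: ht1; apply: (le_trans (FK _ _)).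
  by rewrite mulrC -ler_pdivlMr.
- by move=> a; rewrite (fxp _ _ a) qFp.
- by move=> a; rewrite !AE (fsp _ _ a) qFp.
- by move=> i ik; exact: r_comp.
- by move=> i ik qi; rewrite (_ : A = fun a => fs a (q (F a)));
    [exact: r_comp|exact/funext].
Qed.

(* [g] is as smooth as an expression in the derivatives of [q] of order less
   than [j]; differentiating once costs one order of [g] and raises [j] by one. *)
Let jet j v := exists g,
  [/\ Cr j q, v = derive1n j q, forall a, v a = g a + A a * F' a ^+ j * v (F a) &
      forall i, (i <= k.+1 - j)%N -> Cr (j.-1 + i) q -> Cr i g].

Let jetP j v : jet j v -> [/\ continuous v, periodic v & exists V, forall a, `|v a| <= V].
Proof.
move=> [g [qr -> _ _]].
have vc : continuous (derive1n j q) by have /Cr_lineP[] := qr.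
suff vp : periodic (derive1n j q) by split => //; exact: periodic_bounded.
elim: j qr {vc} => [|j IH] qr //.
have /Cr_lineP[dq _] := qr.
apply: (@periodic_derive _ (derive1n j q)); last exact/IH/Cr_pred.
by move=> a; rewrite derive1nS; apply: DeriveDef; [exact: dq|rewrite derive1E].
Qed.

(** The new inhomogeneous term [g' + H' * (v o F)] contains [v], hence [q] to order [j]; this is the
    shift by one in the count of smoothness. *)
Let jet_cocycle j v : (0 < j)%N -> (j <= k)%N -> jet j v ->
  exists g, [/\ udiff_cocycle F v g (fun a => A a * F' a ^+ j),
   exists G, forall a, `|g a| <= G, exists M, forall a, `|A a * F' a ^+ j| <= M &
   forall i, (i <= k - j)%N -> Cr (j + i) q -> Cr i g].
Proof.
move=> j0 jk hv; have [vc vp [V hV]] := jetP hv.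
have [g [qr vD vE gi]] := hv.
have [g0 [_ _ Ap _ Ai]] := A_smooth_cocycle.
pose H a := A a * F' a ^+ j.
have Hi i : (i <= k)%N -> Cr i q -> Cr i H.
  move=> ik qi; apply: CrM; first exact: Ai.
  by apply: CrX; apply: Cr_le F'r.
have Hp : periodic H by move=> a; rewrite /H Ap F'p.
have vFp : periodic (fun a => v (F a)) := periodic_comp Fdeg vp.
(* [jet] does not record that [g] is periodic, but the equation of [v] implies it. *)
have gp : periodic g.
  move=> a; have -> b : g b = v b - H b * v (F b) by rewrite vE addrK.
  by rewrite vp Hp vFp vE addrK.
have [g' g'd g'0] : Cr 1 g.
  apply: gi; first by rewrite subSn.
  by rewrite addn1 prednK.
have [H' H'd H'0] : Cr 1 H.
  by apply: Hi; [exact: leq_trans jk|exact: Cr_le qr].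
have g'p := periodic_derive g'd gp; have H'p := periodic_derive H'd Hp.
have [M HM] := periodic_bounded H'0 H'p.
exists (fun b => g' b + H' b * v (F b)); split.
- by apply: (udiff_cocycle_linear vE _ _ hV HM); exact: periodic_udiff.
- apply: periodic_bounded; last by move=> a; rewrite g'p H'p vFp.
  apply: (@CrD _ 0) => //; apply: (@CrM _ 0) => //; apply: (@Cr_comp _ 0) => //.
  exact: Cr_continuous Fr.
- by apply: periodic_bounded => //; apply: (Cr_continuous (Hi 0 _ _)) => //.
- move=> i ikj qi.
  have ik : (i.+1 <= k)%N.
    by rewrite -(subnK jk) -(prednK j0) addnS ltnS (leq_trans ikj)// prednK// leq_addr.
  apply: CrD.
    apply: (Cr_derive g'd); apply: gi; first by rewrite subSn.
    by rewrite -subn1 addnS -addSn -addn1 subnK.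
  apply: CrM.
    apply: (Cr_derive H'd); apply: Hi => //; apply: Cr_le qi.
    by rewrite -add1n leq_add2r.
  apply: Cr_comp; last by apply: Cr_le Fr; rewrite (leq_trans _ (leqnSn _))// ltnW.
  have qji : forall n i (u : R -> R), Cr (n + i) u -> Cr i (derive1n n u).
    elim=> // n IH i' u; rewrite addSn derive1Sn => -[u' u'd u'r]; apply: IH.
    suff -> : derive1 u = u' by [].
    by apply/funext => a; rewrite derive1E; exact: derive_val.
  by rewrite vD; exact: qji.
Qed.

(** Each use of [cocycle_udiff] gains one derivative and multiplies the coefficient by one more
    [F']. The order 1 starts from the nonlinear equation of [q], the higher ones from the linear
    equation of the previous derivative. *)
Let jet_exists j : (0 < j)%N -> (j <= k)%N -> exists v, jet j v.
Proof.
elim: j => // -[_ _ k0|j IH _ jk].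
  have [g [qg gp Ap gi Ai]] := A_smooth_cocycle.
  have [G hG] := periodic_bounded (gi 0 isT qc : continuous g) gp.
  have [M hM] := periodic_bounded (Ai 0 isT qc : continuous A) Ap.
  have [V hV] := periodic_bounded qc qp.
  have [b|p pE qpu] := cocycle_udiff kap1 Fkap K1 FK uF F'1 W1 WWm th0 th1 _ hV hG hM qg.
    by have := @AWS 0 b k0; rewrite expr0 mulr1.
  have qd a := udiff_is_derive a qpu.
  exists p, g; split.
  - by exists p => //; exact: udiff_continuous qpu.
  - by apply/funext => a; rewrite derive1n1 derive1E; apply/esym; exact: derive_val.
  - by move=> a; rewrite expr1.
  - by move=> i; rewrite subSS subn0 add0n; exact: gi.
have [v hv] := IH isT (ltnW jk).
have [vc vp [V hV]] := jetP hv.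
have [g [vg [G hG] [M hM] gi]] := @jet_cocycle j.+1 v isT (ltnW jk) hv.
have [b|p pE vpu] := cocycle_udiff kap1 Fkap K1 FK uF F'1 W1 WWm th0 th1 _ hV hG hM vg.
  exact: AWS.
have vd a := udiff_is_derive a vpu.
have [_ [qr vD _ _]] := hv.
have pD : p = derive1 v.
  by apply/funext => a; rewrite derive1E; apply/esym; exact: derive_val.
exists p, g; split.
- apply/Cr_lineP; have /Cr_lineP[dq _] := qr; split.
    move=> i; rewrite ltnS leq_eqVlt => /orP[/eqP -> a|]; last exact: dq.
    by rewrite -vD; exact: (@ex_derive _ _ _ _ _ _ _ (vd a)).
  by rewrite derive1nS -vD -pD; exact: udiff_continuous vpu.
- by rewrite derive1nS -vD.
- by move=> a; rewrite [in RHS]exprSr [in RHS]mulrA; exact: pE.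
- by move=> i; rewrite subSS; exact: gi.
Qed.

Lemma fixed_point_holder : Cr k q /\
  exists2 C : R, 0 <= C & forall a b,
    `|derive1n k q a - derive1n k q b| <= C * `|a - b| `^ al.
Proof.
(* For [k = 0] there is no derivative to work with, and the Hölder bound comes directly from the
   nonlinear equation. *)
have [k0|k0] := posnP k.
  have [g [qg gp Ap gi Ai]] := A_smooth_cocycle.
  have [G hG] := periodic_bounded (gi 0 isT qc : continuous g) gp.
  have [V hV] := periodic_bounded qc qp.
  rewrite k0; split=> //.
  apply: (cocycle_holder al0 al1 kap1 Fkap K1 FK uF F'1 W1 WWm th0 th1 _ hV hG qg) => b.
  by have := @AWn 0 b isT; rewrite expr0 mulr1.
have [v hv] := jet_exists k0 (leqnn k).
have [vc vp [V hV]] := jetP hv.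
have [g [vg [G hG] [M hM] gi]] := jet_cocycle k0 (leqnn k) hv.
have [_ [qr vD _ _]] := hv; split=> //; rewrite -vD.
apply: (cocycle_holder al0 al1 kap1 Fkap K1 FK uF F'1 W1 WWm th0 th1 _ hV hG vg) => b.
exact: AWn.
Qed.

End fixed_point_regularity.

(** * The circle *)

Lemma circle_piP (R : realType) (a b : R) :
  circle_pi a = circle_pi b <-> exists n : int, a = b + n%:~R.
Proof.
have E : (circle_pi a = circle_pi b) <-> (a - b \in int_subgroup R).
  by rewrite (Quotient.idealrBE (int_subgroup R)); split => [h|/eqP//]; apply/eqP.
rewrite E; split=> [/intrP[n ab]|[n ->]]; first by exists n; rewrite -ab subrKC.
by rewrite addrAC subrr add0r; apply/intrP; exists n.
Qed.

Lemma circle_pi_repr (R : realType) (x : circle R) : circle_pi (repr x) = x.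
Proof. exact: reprK. Qed.

Lemma circle_pi_periodic (R : realType) : periodic (@circle_pi R).
Proof. by move=> a; apply/circle_piP; exists 1. Qed.

Lemma circle_pi_comp_periodic (R : realType) (T : Type) (f : circle R -> T) :
  periodic (f \o @circle_pi R).
Proof. by move=> a; rewrite /= circle_pi_periodic. Qed.

Lemma circle_pi_continuous (R : realType) : continuous (@circle_pi R).
Proof. exact: pi_continuous. Qed.

Lemma circle_continuousP (R : realType) (Z : topologicalType) (f : circle R -> Z) :
  continuous f <-> continuous (f \o @circle_pi R).
Proof. exact: quotient_continuous. Qed.

Lemma circle_openP (R : realType) (U : set (circle R)) :
  open U <-> open (@circle_pi R @^-1` U).
Proof. by []. Qed.

Lemma circle_compact (R : realType) : compact [set: circle R].
Proof.
have -> : [set: circle R] = @circle_pi R @` `[0, 1]%classic.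
  apply/seteqP; split => x // _.
  have [n xn] := fundamental_domain (repr x).
  exists (repr x + n%:~R); first exact: xn.
  by rewrite -[RHS]circle_pi_repr; apply/circle_piP; exists n.
apply: continuous_compact; last exact: segment_compact.
by apply: continuous_subspaceT; exact: circle_pi_continuous.
Qed.

Lemma circle_fun_repr (R : realType) (T : Type) (f : R -> T) (a : R) :
  periodic f -> f (repr (circle_pi a)) = f a.
Proof.
move=> fp; have /circle_piP[n ->] := circle_pi_repr (circle_pi a).
exact: periodic_int.
Qed.

Lemma circle_fun_continuous (R : realType) (f : R -> R) :
  periodic f -> continuous f -> continuous (fun x : circle R => f (repr x)).
Proof.
move=> fp fc; apply/circle_continuousP.
by rewrite (_ : _ \o _ = f)//; apply/funext => a /=; exact: circle_fun_repr.
Qed.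

Lemma lift_continuous (R : realType) (T : circle R -> circle R) (F : R -> R) :
  is_lift T F -> continuous F -> continuous T.
Proof.
move=> TF Fc; apply/circle_continuousP.
rewrite (_ : _ \o _ = @circle_pi R \o F); last exact/funext.
by move=> a; apply: continuous_comp; [exact: Fc|exact: circle_pi_continuous].
Qed.

(** Two different values would force, by the intermediate value theorem, the smaller one plus 1/2 as
    a value. *)
Lemma continuous_int_constant (R : realType) (g : R -> R) :
  continuous g -> (forall a, exists n : int, g a = n%:~R) -> forall a b, g a = g b.
Proof.
move=> gc gint.
suff H a b : a <= b -> g a = g b.
  by move=> a b; have [/H//|/ltW/H] := leP a b.
move=> ab; apply/eqP; apply: contraT => gab.
pose m := Num.min (g a) (g b).
have [c _ gcE] : exists2 c, c \in `[a, b] & g c = m + 2^-1.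
  apply: IVT => //; first exact: continuous_subspaceT.
  rewrite lerDl invr_ge0 ler0n/=.
  have [n ga] := gint a; have [p gb] := gint b.
  rewrite /m; move: gab; rewrite ga gb eqr_int => np.
  have : (n < p) || (p < n) by rewrite -neq_lt.
  move=> /orP[np1|np1].
    have := np1; rewrite -(ltr_int R) => /ltW h; rewrite (min_idPl h) (max_idPr h).
    have : (n + 1 <= p) by rewrite lezD1.
    by rewrite -(ler_int R) intrD; lra.
  have := np1; rewrite -(ltr_int R) => /ltW h; rewrite (min_idPr h) (max_idPl h).
  have : (p + 1 <= n) by rewrite lezD1.
  by rewrite -(ler_int R) intrD; lra.
have [n mE] : exists n : int, m = n%:~R.
  by rewrite /m; case: leP => _; exact: gint.
have [p] := gint c; rewrite gcE mE => h.
have : (n < p) && (p < n + 1).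
  by rewrite -!(ltr_int R) intrD -h; apply/andP; split; lra.
by rewrite -lezD1 => /andP[h1 h2]; have := le_lt_trans h1 h2; rewrite ltxx.
Qed.

Lemma lift_unique (R : realType) (T : circle R -> circle R) (F G : R -> R) :
  is_lift T F -> is_lift T G -> continuous F -> continuous G ->
  exists n : int, forall a, G a = F a + n%:~R.
Proof.
move=> TF TG Fc Gc.
have FG a : exists n : int, G a = F a + n%:~R.
  by apply/circle_piP; rewrite -TF TG.
have [n n0] := FG 0; exists n => a.
have /(_ _ _ a 0) := @continuous_int_constant R (fun a => G a - F a).
rewrite n0 (addrAC (F 0)) subrr add0r => <-; first by rewrite subrKC.
  by move=> b; apply: cvgB; [exact: Gc|exact: Fc].
by move=> b; have [m ->] := FG b; exists m; rewrite addrAC subrr add0r.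
Qed.

(** Translating the variable by 1 turns a lift into another lift of the same map, so [lift_unique]
    applies. *)
Lemma lift_degree (R : realType) (T : circle R -> circle R) (F : R -> R) :
  is_lift T F -> continuous F -> exists d : int, forall a, F (a + 1) = F a + d%:~R.
Proof.
move=> TF Fc; apply: (lift_unique TF) => // [a|].
  by rewrite -TF circle_pi_periodic.
move=> a; apply: (@continuous_comp _ _ _ (fun a : R => a + 1) F); last exact: Fc.
by apply: cvgD; [exact: cvg_id|exact: cvg_cst].
Qed.

(** [xget] may select any lift and any representative; uniqueness of lifts up to an integer and
    periodicity of [F'] make the choice immaterial. *)
Lemma circle_map_deriveE (R : realType) (T : circle R -> circle R) (F F' : R -> R) :
  is_lift T F -> (forall a, is_derive a (1 : R) F (F' a)) ->
  forall a, circle_map_derive T (circle_pi a) = F' a.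
Proof.
move=> TF Fd a.
have Fc : continuous F by move=> b; exact: is_derive_continuous (Fd b).
rewrite /circle_map_derive; case: xgetP => [d _|/(_ (F' a))]; last first.
  by case; exists F, a.
move=> [G [b [TG Gc /circle_piP[m ->] Gd]]].
have [n GF] := lift_unique TF TG Fc Gc; have [D FD] := lift_degree TF Fc.
rewrite -(periodic_int m a (degree_derive_periodic Fd FD)).
apply: is_derive_unique (Fd _); apply/is_deriveP => e e0.
have [t t0 ht] := (is_deriveP _ _ _).1 Gd e e0; exists t => // c /ht.
by rewrite !GF opprD addrACA subrr addr0.
Qed.

(** [n] times the distance to the complement of [U], cut off at 1, the distance being taken on the
    line over all representatives [b]. The extra element 1 keeps the infimum meaningful when [U] is
    the whole circle. For open [U] these functions increase to its indicator. *)
Definition circle_urysohn (R : realType) (U : set (circle R)) (n : nat)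
    (x : circle R) : R :=
  Num.min 1 (n%:R * inf [set r | r = 1 \/
    exists2 b, ~ U (circle_pi b) & r = `|repr x - b|]).

Lemma circle_urysohnP (R : realType) (U : set (circle R)) : open U ->
  let chi := circle_urysohn U in
  [/\ forall n, continuous (chi n), forall n x, 0 <= chi n x <= 1,
      forall x n m, (n <= m)%N -> chi n x <= chi m x,
      forall x n, ~ U x -> chi n x = 0 &
      forall x, U x -> exists n, chi n x = 1].
Proof.
move=> Uo chi.
pose S a := [set r : R | r = 1 \/ exists2 b, ~ U (circle_pi b) & r = `|a - b|].
pose del a := inf (S a).
have S1 a : S a 1 by left.
have Slb a : lbound (S a) 0 by move=> r [->|[b _ ->]].
have Sinf a : has_inf (S a) by split; [exists 1|exists 0].
have del0 a : 0 <= del a by apply: lb_le_inf; [exists 1|exact: Slb].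
have del_lip a b : del a <= del b + `|a - b|.
  rewrite -lerBlDr; apply: lb_le_inf; first by exists 1.
  move=> r [->|[c Uc ->]].
    rewrite lerBlDr; apply: (@le_trans _ _ 1); last by rewrite lerDl.
    by apply: ge_inf; [exists 0|].
  rewrite lerBlDr; apply: (@le_trans _ _ `|a - c|).
    by apply: ge_inf; [exists 0|right; exists c].
  have -> : a - c = (b - c) + (a - b) by ring.
  exact: ler_normD.
have delp : periodic del.
  move=> a; congr inf; apply/seteqP; split => r [->|[b Ub ->]]; [by left| |by left|].
    right; exists (b - 1); last by congr `|_|; ring.
    by rewrite -circle_pi_periodic subrK.
  right; exists (b + 1); last by congr `|_|; ring.
  by rewrite circle_pi_periodic.
have delc : continuous del.
  move=> a; apply/cvgrPdist_le => e e0; apply/nbhs_ballP; exists e => // b.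
  rewrite /ball/= => /ltW abe; apply: le_trans abe; rewrite ler_norml.
  have := del_lip a b; have := del_lip b a; rewrite (distrC b) => h1 h2.
  by apply/andP; split; lra.
have chiE n x : chi n x = Num.min 1 (n%:R * del (repr x)) by [].
split.
- move=> n; apply: (@circle_fun_continuous R (fun a => Num.min 1 (n%:R * del a))).
    by move=> a; rewrite delp.
  move=> a; apply: (@continuous_min R R (fun=> 1) (fun a => n%:R * del a) a).
    exact: cvg_cst.
  by apply: cvgM; [exact: cvg_cst|exact: delc].
- by move=> n x; rewrite chiE ge_min lexx andbT le_min ler01 mulr_ge0.
- by move=> x n m nm; rewrite !chiE le_min ge_min lexx/= ge_min ler_wpM2r ?ler_nat ?orbT.
- move=> x n Ux; rewrite chiE; suff -> : del (repr x) = 0 by rewrite mulr0 min_r.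
  apply/eqP; rewrite eq_le del0 andbT; apply: ge_inf; first by exists 0.
  by right; exists (repr x); rewrite ?circle_pi_repr// subrr normr0.
- move=> x Ux; have : (@circle_pi R @^-1` U) (repr x) by rewrite /= circle_pi_repr.
  move=> hU; have /nbhs_ballP[t /= t0 ht] :=
    open_nbhs_nbhs (conj ((circle_openP U).1 Uo) hU).
  have d0 : 0 < del (repr x).
    apply: (@lt_le_trans _ _ (Num.min 1 t)); first by rewrite lt_min ltr01.
    apply: lb_le_inf; first by exists 1.
    move=> r [->|[b Ub ->]]; first by rewrite ge_min lexx.
    rewrite ge_min; apply/orP; right; rewrite leNgt; apply/negP => bt.
    by apply: Ub; exact: (ht b).
  have [n hn] : exists n : nat, (del (repr x))^-1 <= n%:R.
    by exists (Num.bound (del (repr x))^-1); apply/ltW/archi_boundP; rewrite invr_ge0.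
  by exists n; rewrite chiE min_l// -ler_pdivrMr// mul1r.
Qed.

(** * Generating functions *)

Section generating_function.
Variables (R : realType) (P : probability nat R).

Definition pmf (j : nat) : R := fine (P [set j]).
Definition pgf (s : R) : R := limn (series (fun j => pmf j * s ^+ j)).

Lemma pmf_ge0 j : 0 <= pmf j. Proof. exact: fine_ge0. Qed.

Lemma pmf_EFin j : (pmf j)%:E = P [set j].
Proof. by rewrite fineK// fin_num_measure. Qed.

Lemma pmf_sum1 : series pmf @ \oo --> (1 : R).
Proof.
have h := @measure_semi_sigma_additive _ _ _ P (fun j : nat => [set j]).
have /h {}h : forall i : nat, measurable [set i] by [].
have /h {}h : trivIset [set: nat] (fun j : nat => [set j]).
  by apply/trivIsetP => i j _ _ ij; apply/seteqP; split => // x /= [-> /eqP]; rewrite (negbTE ij).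
have /h {}h : measurable (\bigcup_(n : nat) [set n]) by [].
have U : \bigcup_n [set n] = [set: nat] by apply/seteqP; split => // n _; exists n.
rewrite U in h; have PT : (P [set: nat] = 1%:E)%E := probability_setT P.
rewrite [X in _ --> X](_ : _ = 1%:E) in h; last exact: PT.
have {}h : fine \o (fun n => \sum_(0 <= i < n) P [set i])%E @ \oo --> (1 : R).
  exact: fine_cvg h.
rewrite (_ : fine \o _ = series pmf) in h; first exact: h.
apply/funext => n /=; rewrite /series/=.
by under eq_bigr do rewrite -pmf_EFin; rewrite sumEFin.
Qed.

Let term_le s j : 0 <= s -> s <= 1 -> pmf j * s ^+ j <= pmf j.
Proof. by move=> s0 s1; rewrite ler_piMr ?pmf_ge0// exprn_ile1. Qed.

Lemma is_cvg_pgf s : 0 <= s -> s <= 1 -> cvgn (series (fun j => pmf j * s ^+ j)).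
Proof.
move=> s0 s1; apply: (@series_le_cvg _ _ pmf) => [n|n|n|].
- by rewrite mulr_ge0 ?exprn_ge0 ?pmf_ge0.
- exact: pmf_ge0.
- exact: term_le.
- by apply/cvg_ex; exists 1; exact: pmf_sum1.
Qed.

Lemma pgf1 : pgf 1 = 1.
Proof.
apply: cvg_lim => //; rewrite (_ : (fun j => _) = pmf); first exact: pmf_sum1.
by apply/funext => j; rewrite expr1n mulr1.
Qed.

Let part s n := series (fun j => pmf j * s ^+ j) n.

Let part_cvg s : 0 <= s -> s <= 1 -> part s n @[n --> \oo] --> pgf s.
Proof. by move=> s0 s1; exact: is_cvg_pgf. Qed.

Let cvg_le (u v : R ^nat) (l m : R) : u @ \oo --> l -> v @ \oo --> m ->
  (\forall n \near \oo, u n <= v n) -> l <= m.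
Proof.
move=> ul vm uv; rewrite -(cvg_lim (@Rhausdorff R) ul) -(cvg_lim (@Rhausdorff R) vm).
by apply: ler_lim => //; apply/cvg_ex; eexists; eassumption.
Qed.

Lemma pgf0 : pgf 0 = pmf 0.
Proof.
apply: cvg_lim => //; apply: cvg_near_cst; exists 1%N => //= -[|n] //= _.
rewrite /series/= big_nat_recl//= expr0 mulr1 big1 ?addr0// => i _.
by rewrite expr0n mulr0.
Qed.

Lemma pgf_le s t : 0 <= s -> s <= t -> t <= 1 -> pgf s <= pgf t.
Proof.
move=> s0 st t1; have t0 := le_trans s0 st; have s1 := le_trans st t1.
apply: (cvg_le (part_cvg s0 s1) (part_cvg t0 t1)); apply: nearW => n.
apply: ler_sum => j _; rewrite ler_wpM2l ?pmf_ge0//.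
by rewrite lerXn2r ?nnegrE.
Qed.

Lemma pgf_ge0 s : 0 <= s -> s <= 1 -> 0 <= pgf s.
Proof.
by move=> s0 s1; apply: (@le_trans _ _ (pgf 0)); [rewrite pgf0 pmf_ge0|exact: pgf_le].
Qed.

Lemma pgf_le1 s : 0 <= s -> s <= 1 -> pgf s <= 1.
Proof. by move=> s0 s1; rewrite -pgf1 pgf_le. Qed.

(** Comparison of consecutive chord slopes, multiplied out so that points may coincide. Termwise it
    follows from the factorization of [t ^+ j - s ^+ j]. *)
Lemma pgf_convex s t r : 0 <= s -> s <= t -> t <= r -> r <= 1 ->
  (pgf t - pgf s) * (r - t) <= (pgf r - pgf t) * (t - s).
Proof.
move=> s0 st tr r1; have t0 := le_trans s0 st; have t1 := le_trans tr r1.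
have s1 := le_trans st t1; have r0 := le_trans t0 tr.
apply: (@cvg_le (fun n => (part t n - part s n) * (r - t))
                (fun n => (part r n - part t n) * (t - s))).
- by apply: cvgM; [apply: cvgB; exact: part_cvg|exact: cvg_cst].
- by apply: cvgM; [apply: cvgB; exact: part_cvg|exact: cvg_cst].
apply: nearW => n; rewrite /part /series/= -!sumrB !mulr_suml; apply: ler_sum => j _.
rewrite -!mulrBr -!mulrA ler_wpM2l ?pmf_ge0// !subrXX.
rewrite mulrAC [leRHS]mulrAC (mulrC (r - t)) ler_wpM2l//.
  by rewrite mulr_ge0// subr_ge0.
apply: ler_sum => i _; apply: ler_pM; rewrite ?exprn_ge0//.
  by rewrite lerXn2r ?nnegrE.
by rewrite lerXn2r ?nnegrE.
Qed.

(** Both sides compare slopes of chords ending at 1. Terms of order 0 and 1 contribute equally to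
    the two sides, and each [j >= 2] of positive mass contributes strictly. *)
Lemma pgf_slope_lt s t j : 0 <= s -> s < t -> t < 1 -> (2 <= j)%N -> 0 < pmf j ->
  (1 - pgf s) * (1 - t) < (1 - pgf t) * (1 - s).
Proof.
move=> s0 st t1 j2 pj.
have t0 : 0 <= t := le_trans s0 (ltW st); have s1 : s <= 1 := ltW (lt_trans st t1).
pose D i := (1 - t ^+ i) * (1 - s) - (1 - s ^+ i) * (1 - t).
have DE i : D i = (1 - t) * (1 - s) *
    (\sum_(k < i) (t ^+ k - s ^+ k)).
  rewrite sumrB.
  have g u : 1 - u ^+ i = (1 - u) * \sum_(k < i) u ^+ k.
    by rewrite -[1 - _]opprB subrX1 -mulNr opprB.
  by rewrite /D !g; ring.
have D0 i : 0 <= D i.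
  rewrite DE mulr_ge0// ?mulr_ge0 ?subr_ge0 ?(ltW t1)//.
  by apply: sumr_ge0 => k _; rewrite subr_ge0 lerXn2r ?nnegrE// ltW.
have Dj : 0 < D j.
  rewrite DE mulr_gt0// ?mulr_gt0 ?subr_gt0// ?(lt_trans st)//.
  case: j j2 {pj} => // -[|j] // _; rewrite !big_ord_recl/= !expr0 subrr add0r !expr1.
  rewrite ltr_pwDl ?subr_gt0//; apply: sumr_ge0 => k _.
  by rewrite subr_ge0 lerXn2r ?nnegrE// ltW.
apply: (@lt_le_trans _ _ ((1 - pgf s) * (1 - t) + pmf j * D j)).
  by rewrite ltrDl mulr_gt0.
rewrite addrC -lerBrDr.
apply: (@cvg_le (fun=> pmf j * D j) (fun n => (part 1 n - part t n) * (1 - s) -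
    (part 1 n - part s n) * (1 - t))).
- exact: cvg_cst.
- rewrite [X in _ --> X](_ : _ = (pgf 1 - pgf t) * (1 - s) - (pgf 1 - pgf s) * (1 - t)); last first.
    by rewrite pgf1.
  have s1' := le_trans s1 (lexx 1).
  by apply: cvgB; apply: cvgM; (try exact: cvg_cst); apply: cvgB;
    apply: part_cvg => //; exact: ltW.
exists j.+1 => // n /= jn; rewrite /part /series/= -!sumrB !mulr_suml -sumrB.
rewrite (bigD1_seq j) ?mem_index_iota ?iota_uniq//=.
have E i : (pmf i * 1 ^+ i - pmf i * t ^+ i) * (1 - s) -
  (pmf i * 1 ^+ i - pmf i * s ^+ i) * (1 - t) = pmf i * D i.
  by rewrite expr1n /D; ring.
rewrite E lerDl sumr_ge0// => i _; by rewrite E mulr_ge0// pmf_ge0.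
Qed.

Lemma pgf_affine : (forall j, (2 <= j)%N -> pmf j = 0) -> pmf 1 = 1 - pmf 0 /\
  forall s, 0 <= s -> s <= 1 -> 1 - pgf s = (1 - pmf 0) * (1 - s).
Proof.
move=> p0.
have E t : 0 <= t -> t <= 1 -> pgf t = pmf 0 + pmf 1 * t.
  move=> t0 t1; apply: cvg_lim => //; apply: cvg_near_cst; exists 2%N => //= -[|[|n]] //= _.
  rewrite /series/= big_nat_recl//= big_nat_recl//= expr0 mulr1 expr1 big1 ?addr0// => i _.
  by rewrite p0// mul0r.
have p1 : pmf 1 = 1 - pmf 0.
  by have := E 1 ler01 (lexx 1); rewrite pgf1 mulr1 => ->; ring.
by split=> // s s0 s1; rewrite E// p1; ring.
Qed.

Lemma pmf1_dirac j : pmf j = 1 -> P = \d_j :> (set nat -> \bar R).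
Proof.
move=> pj; have Pj : P [set j] = 1%E by rewrite -pmf_EFin pj.
apply/funext => A; rewrite diracE; have [jA|jA] := boolP (j \in A).
  apply/eqP; rewrite eq_le probability_le1//=; rewrite -Pj le_measure ?inE//.
  by move=> x ->; rewrite -in_setE.
apply/eqP; rewrite eq_le measure_ge0 andbT.
have : (P A <= P (~` [set j]))%E.
  rewrite le_measure ?inE// => x Ax xj; move: jA; rewrite -xj => /negP; apply.
  by rewrite in_setE.
by rewrite probability_setC// Pj subee.
Qed.

Lemma pgf_derive_le (s d : R) : 0 < s -> s < 1 -> is_derive s 1 pgf d ->
  d * (1 - s) <= 1 - pgf s.
Proof.
move=> s0 s1 hd; have s10 : 0 < 1 - s by rewrite subr_gt0.
suff H e : 0 < e -> d * (1 - s) <= 1 - pgf s + e * (1 - s).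
  apply/ler_addgt0Pr => e e0.
  by have := H (e / (1 - s)); rewrite divfK ?gt_eqF// divr_gt0//; apply.
move=> e0; have [t t0 ht] := (is_deriveP _ _ _).1 hd e e0.
(* A point to the right of [s], near enough for the difference quotient to be within [e] of [d], and
   still at most 1. *)
pose r := s + Num.min (t / 2) ((1 - s) / 2).
have m0 : 0 < Num.min (t / 2) ((1 - s) / 2) by rewrite lt_min !divr_gt0.
have rs0 : 0 < r - s by rewrite /r addrAC subrr add0r.
have rs : s <= r by rewrite -subr_ge0 ltW.
have r1 : r <= 1.
  rewrite /r -lerBrDl ge_min; apply/orP; right.
  by rewrite ler_pdivrMr// ler_peMr ?ler1n// ltW.
have rt : `|r - s| < t.
  rewrite gtr0_norm// /r addrAC subrr add0r gt_min; apply/orP; left.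
  by rewrite ltr_pdivrMr// ltr_pMr// ltr1n.
have h1 := pgf_convex (ltW s0) rs r1 (lexx 1); rewrite pgf1 in h1.
have := ht _ rt; rewrite (gtr0_norm rs0) => /ler_normlP[h2 _].
rewrite -(ler_pM2r rs0); nra.
Qed.

(** The slope at [s] dominates that of a chord arriving from the left; the difference quotient is
    again taken to the right of [s], where convexity compares it with that chord. *)
Lemma pgf_derive_ge (s r d : R) : 0 < s -> s < 1 -> 0 <= r -> r <= s -> is_derive s 1 pgf d ->
  pgf s - pgf r <= d * (s - r).
Proof.
move=> s0 s1 r0 rs hd; have s10 : 0 < 1 - s by rewrite subr_gt0.
suff H e : 0 < e -> pgf s - pgf r <= d * (s - r) + e * (s - r).
  apply/ler_addgt0Pr => e e0; apply: (le_trans (H e e0)); rewrite lerD2l.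
  by rewrite ler_piMr ?(ltW e0)//; lra.
move=> e0; have [t t0 ht] := (is_deriveP _ _ _).1 hd e e0.
pose u := s + Num.min (t / 2) ((1 - s) / 2).
have m0 : 0 < Num.min (t / 2) ((1 - s) / 2) by rewrite lt_min !divr_gt0.
have us0 : 0 < u - s by rewrite /u addrAC subrr add0r.
have us : s <= u by rewrite -subr_ge0 ltW.
have u1 : u <= 1.
  rewrite /u -lerBrDl ge_min; apply/orP; right.
  by rewrite ler_pdivrMr// ler_peMr ?ler1n// ltW.
have ut : `|u - s| < t.
  rewrite gtr0_norm// /u addrAC subrr add0r gt_min; apply/orP; left.
  by rewrite ltr_pdivrMr// ltr_pMr// ltr1n.
have h1 := pgf_convex r0 rs us u1.
have := ht _ ut; rewrite (gtr0_norm us0) => /ler_normlP[_ h2].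
have sr : 0 <= s - r by rewrite subr_ge0.
rewrite -(ler_pM2r us0); nra.
Qed.

Lemma pgf_derive_ge0 (s d : R) : 0 < s -> s < 1 -> is_derive s 1 pgf d -> 0 <= d.
Proof.
move=> s0 s1 hd; have h := pgf_derive_ge s0 s1 (lexx 0) (ltW s0) hd.
have : 0 <= d * s.
  by apply: le_trans (_ : pgf s - pgf 0 <= _); rewrite ?subr_ge0 ?pgf_le ?(ltW s0) ?(ltW s1)// -[s in leRHS]subr0.
by rewrite pmulr_lge0.
Qed.

End generating_function.

(** * Extreme linear functionals *)

Section extreme_functional.
Variables (R : realType) (V : lmodType R) (C : set V).
Hypothesis C0 : C 0.
Hypothesis CD : forall u v, C u -> C v -> C (u + v).
Hypothesis CZ : forall a u, C u -> C (a *: u).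

(** Homogeneity is required only as an inequality, which passes easily to infima; applied to [t^-1]
    as well, it gives equality ([subZ]). *)
Definition sublinear_on (q : V -> R) : Prop :=
  (forall u v, C u -> C v -> q (u + v) <= q u + q v) /\
  (forall (t : R) u, 0 < t -> C u -> q (t *: u) <= t * q u).

Definition linear_on (L : V -> R) : Prop :=
  (forall u v, C u -> C v -> L (u + v) = L u + L v) /\
  (forall (a : R) u, C u -> L (a *: u) = a * L u).

Let CN u : C u -> C (- u).
Proof. by rewrite -scaleN1r; exact: CZ. Qed.

Let sub0 q : sublinear_on q -> q 0 = 0.
Proof.
move=> [qD qZ]; have := qZ 2^-1 0; rewrite scaler0 invr_gt0 => /(_ (ltr0Sn _ _) C0).
have := qD 0 0 C0 C0; rewrite addr0 => h1 h2.
by apply/eqP; rewrite eq_le; apply/andP; split; lra.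
Qed.

Let subZ q (t : R) u : sublinear_on q -> 0 <= t -> C u -> q (t *: u) = t * q u.
Proof.
move=> qs; rewrite le_eqVlt => /orP[/eqP <- _|t0 Cu].
  by rewrite scale0r mul0r sub0.
apply/eqP; rewrite eq_le qs.2//=.
have := qs.2 t^-1 (t *: u); rewrite invr_gt0 => /(_ t0 (CZ _ Cu)).
by rewrite scalerA mulVf ?gt_eqF// scale1r -(ler_pM2l t0) mulVKf ?gt_eqF.
Qed.

Let subN q u : sublinear_on q -> C u -> - q (- u) <= q u.
Proof.
move=> qs Cu; have := qs.1 u (- u) Cu (CN Cu).
by rewrite subrr (sub0 qs) -lerBlDr sub0r.
Qed.

Variable p : V -> R.
Hypothesis ps : sublinear_on p.

Let below q := forall u, C u -> q u <= p u.

Let face q := [/\ sublinear_on q, below q &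
  forall L1 L2 (a : R), linear_on L1 -> linear_on L2 -> below L1 -> below L2 ->
    0 < a < 1 -> (forall u, C u -> a * L1 u + (1 - a) * L2 u <= q u) ->
    forall u, C u -> L1 u <= q u].

Let linN L u : linear_on L -> C u -> L (- u) = - L u.
Proof. by move=> [_ LZ] Cu; rewrite -scaleN1r LZ// mulN1r. Qed.

(** Zorn's lemma: the pointwise infimum of a chain of faces is a face, and it is finite because
    [- p (- u) <= - q (- u) <= q u]. *)
Let face_min : exists2 q, face q &
  forall q', face q' -> (forall u, C u -> q' u <= q u) -> forall u, C u -> q u <= q' u.
Proof.
have pface : face p by split.
pose T := {q | face q}.
pose Rel : rel T := [rel q q' | `[< forall u, C u -> sval q' u <= sval q u >]].
have [||A totA|t ht] := @ZL_preorder T (exist _ p pface) Rel.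
- by move=> q; apply/asboolP.
- move=> q1 q2 q3 /asboolP h1 /asboolP h2; apply/asboolP => u Cu.
  exact: le_trans (h2 u Cu) (h1 u Cu).
- have [[q0 Aq0]|A0] := pselect (exists q, A q); last first.
    by exists (exist _ p pface) => q Aq; exfalso; apply: A0; exists q.
  pose S u := [set sval q u | q in A].
  have Sinf u : C u -> has_inf (S u).
    move=> Cu; split; first by exists (sval q0 u), q0.
    exists (- p (- u)) => _ [[q fq] Aq <-] /=; have [qs qp _] := fq.
    by apply: le_trans (subN qs Cu); rewrite lerN2 qp//; exact: CN.
  pose m u := inf (S u).
  have mle u q : C u -> A q -> m u <= sval q u.
    by move=> Cu Aq; apply: ge_inf; [exact: (Sinf u Cu).2|exists q].
  have le_m u x : C u -> (forall q, A q -> x <= sval q u) -> x <= m u.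
    move=> Cu h; apply: lb_le_inf; first exact: (Sinf u Cu).1.
    by move=> _ [q Aq <-]; exact: h.
  have mface : face m.
    split.
    - split=> [u v Cu Cv|t u t0 Cu].
        have Cuv := CD Cu Cv.
        rewrite -lerBlDr; apply: (le_m _ _) => // q1 Aq1; rewrite lerBlDr -lerBlDl.
        apply: (le_m _ _) => // q2 Aq2; rewrite lerBlDl.
        have [/asboolP h|/asboolP h] := totA _ _ Aq1 Aq2.
          apply: (le_trans (mle _ _ Cuv Aq2)); have [[qD _] _ _] := svalP q2.
          by apply: (le_trans (qD _ _ Cu Cv)); rewrite lerD2r h.
        apply: (le_trans (mle _ _ Cuv Aq1)); have [[qD _] _ _] := svalP q1.
        by apply: (le_trans (qD _ _ Cu Cv)); rewrite lerD2l h.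
      rewrite mulrC -ler_pdivrMr//; apply: (le_m _ _) => // q Aq; rewrite ler_pdivrMr// mulrC.
      apply: (le_trans (mle _ _ (CZ _ Cu) Aq)); have [[_ qZ] _ _] := svalP q.
      exact: qZ.
    - move=> u Cu; apply: (le_trans (mle _ _ Cu Aq0)).
      by have [_ qp _] := svalP q0; exact: qp.
    - move=> L1 L2 a l1 l2 b1 b2 a01 h u Cu; apply: (le_m _ _) => // q Aq.
      have [_ _ qf] := svalP q; apply: (qf L1 L2 a) => // v Cv.
      exact: le_trans (h v Cv) (mle _ _ Cv Aq).
  exists (exist _ m mface) => q Aq; apply/asboolP => u Cu /=; exact: mle.
exists (sval t); first exact: svalP.
move=> q' fq' h u Cu.
by have /asboolP := ht (exist _ q' fq') (introT (asboolP _) h); apply.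
Qed.

(** A minimal face is a single functional. Restricting it further in a direction [f] gives a face
    [m <= q]; minimality yields [q <= m], and at [- f] this reads [q (- f) <= - q f]. An odd
    sublinear function is linear. *)
Lemma extreme_linear : exists L, [/\ linear_on L, forall u, C u -> L u <= p u &
  forall L1 L2 (a : R), linear_on L1 -> linear_on L2 ->
    (forall u, C u -> L1 u <= p u) -> (forall u, C u -> L2 u <= p u) ->
    0 < a < 1 -> (forall u, C u -> L u = a * L1 u + (1 - a) * L2 u) ->
    forall u, C u -> L1 u = L u].
Proof.
have [q [qs qp qf] qmin] := face_min.
have qN f : C f -> q (- f) = - q f.
  move=> Cf; apply/eqP; rewrite eq_le; apply/andP; split; last first.
    by have := subN qs (CN Cf); rewrite opprK lerNl.
  (* [m] is the directional derivative of [q] at [f]: the face of [q] on which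
     the value at [f] is maximal. *)
  pose S u := [set q (u + t *: f) - t * q f | t in [set t : R | 0 <= t]].
  have Slb u : C u -> lbound (S u) (- q (- u)).
    move=> Cu _ [t /= t0 <-]; rewrite lerBrDr addrC -(subZ qs t0 Cf) lerBlDr.
    have := qs.1 _ _ (CD Cu (CZ t Cf)) (CN Cu).
    by rewrite addrAC subrr add0r.
  have S0 u : S u !=set0 by exists (q (u + 0 *: f) - 0 * q f), 0 => //=.
  pose m u := inf (S u).
  have mle u t : C u -> 0 <= t -> m u <= q (u + t *: f) - t * q f.
    by move=> Cu t0; apply: ge_inf; [exists (- q (- u)); exact: Slb|exists t].
  have le_m u x : C u -> (forall t, 0 <= t -> x <= q (u + t *: f) - t * q f) -> x <= m u.
    by move=> Cu h; apply: lb_le_inf => // _ [t t0 <-]; exact: h.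
  have mq u : C u -> m u <= q u.
    by move=> Cu; have := mle u 0 Cu (lexx 0); rewrite scale0r mul0r addr0 subr0.
  have mface : face m.
    split.
    - split=> [u v Cu Cv|c u c0 Cu].
        have Cuv := CD Cu Cv.
        rewrite -lerBlDr; apply: (le_m _ _) => // t t0; rewrite lerBlDr -lerBlDl.
        apply: (le_m _ _) => // s s0; rewrite lerBlDl.
        apply: (le_trans (mle _ _ Cuv (addr_ge0 t0 s0))).
        have := qs.1 _ _ (CD Cu (CZ t Cf)) (CD Cv (CZ s Cf)).
        by rewrite addrACA -scalerDl; lra.
      rewrite mulrC -ler_pdivrMr//; apply: (le_m _ _) => // t t0; rewrite ler_pdivrMr//.
      apply: (le_trans (mle _ _ (CZ _ Cu) (mulr_ge0 (ltW c0) t0))).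
      rewrite -scalerA -scalerDr (subZ qs (ltW c0)); last exact: CD (CZ _ Cf).
      by rewrite le_eqVlt; apply/orP; left; apply/eqP; ring.
    - by move=> u Cu; exact: le_trans (mq u Cu) (qp u Cu).
    - move=> L1 L2 a l1 l2 b1 b2 a01 h.
      have h' v : C v -> a * L1 v + (1 - a) * L2 v <= q v.
        by move=> Cv; exact: le_trans (h v Cv) (mq v Cv).
      have L1q := qf L1 L2 a l1 l2 b1 b2 a01 h'.
      have a01' : 0 < 1 - a < 1 by move: a01 => /andP[? ?]; apply/andP; split; lra.
      have L2q : forall u, C u -> L2 u <= q u.
        apply: (qf L2 L1 (1 - a)) => // v Cv; have -> : 1 - (1 - a) = a by ring.
        rewrite addrC.
        exact: h'.
      (* At [- f] the hypothesis says that the combination at [f] is at least [q f], while both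
         summands are at most [q f]; hence equality in each. *)
      have L1f : L1 f = q f.
        have := le_trans (h _ (CN Cf)) (mle (- f) 1 (CN Cf) ler01).
        rewrite scale1r mul1r addNr (sub0 qs) sub0r (linN l1 Cf) (linN l2 Cf).
        have := L1q f Cf; have := L2q f Cf; move: a01 => /andP[a0 a1] x1 x2 x3.
        by apply/eqP; rewrite eq_le x2/=; nra.
      move=> u Cu; apply: (le_m _ _) => // t t0.
      have := L1q _ (CD Cu (CZ t Cf)).
      by rewrite (l1.1 _ _ Cu (CZ t Cf)) (l1.2 _ _ Cf) L1f lerBrDr.
  have := qmin m mface mq _ (CN Cf); move/le_trans; apply.
  by have := mle (- f) 1 (CN Cf) ler01; rewrite scale1r mul1r addNr (sub0 qs) sub0r.
have qlin : linear_on q.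
  split=> [u v Cu Cv|a u Cu].
    apply/eqP; rewrite eq_le qs.1//=.
    have := qs.1 _ _ (CD Cu Cv) (CN Cv); rewrite addrK qN//; lra.
  have [a0|/ltW a0] := leP 0 a; first exact: subZ.
  rewrite -[a in LHS]opprK scaleNr qN; last exact: CZ.
  by rewrite (subZ qs) ?oppr_ge0// mulNr opprK.
exists q; split => // L1 L2 a l1 l2 b1 b2 a01 h u Cu.
have L1q : forall u, C u -> L1 u <= q u.
  by apply: (qf L1 L2 a) => // v Cv; rewrite -h.
apply/eqP; rewrite eq_le L1q//=.
by have := L1q _ (CN Cu); rewrite (linN l1 Cu) qN// lerN2.
Qed.

End extreme_functional.

(** * The Riesz representation theorem on the circle *)

Section continuous_real_functions.
Variables (R : realType) (X : topologicalType).
Implicit Types f g : X -> R.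

Lemma contD f g : continuous f -> continuous g -> continuous (fun x => f x + g x).
Proof. by move=> fc gc x; apply: cvgD; [exact: fc|exact: gc]. Qed.

Lemma contB f g : continuous f -> continuous g -> continuous (fun x => f x - g x).
Proof. by move=> fc gc x; apply: cvgB; [exact: fc|exact: gc]. Qed.

Lemma contM f g : continuous f -> continuous g -> continuous (fun x => f x * g x).
Proof. by move=> fc gc x; apply: cvgM; [exact: fc|exact: gc]. Qed.

Lemma cont_cst (c : R) : continuous ((fun=> c) : X -> R).
Proof. by move=> x; exact: cvg_cst. Qed.

Lemma cont_min f g : continuous f -> continuous g -> continuous (fun x => Num.min (f x) (g x)).
Proof. by move=> fc gc x; apply: (@continuous_min R X f g x); [exact: fc|exact: gc]. Qed.

Lemma cont_max f g : continuous f -> continuous g -> continuous (fun x => Num.max (f x) (g x)).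
Proof. by move=> fc gc x; apply: (@continuous_max R X f g x); [exact: fc|exact: gc]. Qed.

Lemma cont_sum n (f : nat -> X -> R) : (forall i, continuous (f i)) ->
  continuous (fun x => \sum_(i < n) f i x).
Proof.
move=> fc; elim: n => [|n IH].
  by under eq_fun do rewrite big_ord0; exact: cont_cst.
by under eq_fun do rewrite big_ord_recr/=; exact: contD.
Qed.

Lemma cont_comp (Y : topologicalType) (g : Y -> R) (h : X -> Y) :
  continuous g -> continuous h -> continuous (fun x => g (h x)).
Proof. by move=> gc hc x; apply: (@continuous_comp _ _ _ h g); [exact: hc|exact: gc]. Qed.

Lemma compact_cont_bounded f : compact [set: X] -> continuous f ->
  exists M, 0 < M /\ forall x, `|f x| <= M.
Proof.
move=> cX fc.
have [t t' x t'0 tt'|x _|t t0 ht] :=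
  @compact_uniform R X [set: X] (fun t x => `|f x| <= t^-1) cX.
- by move/le_trans; apply; rewrite lef_pV2// posrE// (lt_le_trans t'0).
- have M0 : 0 < `|f x| + 1 by rewrite ltr_wpDl.
  exists (`|f x| + 1)^-1; first by rewrite invr_gt0.
  have /cvgrPdist_le/(_ 1 ltr01) := fc x.
  apply: filterS => y; rewrite invrK distrC => h.
  by rewrite -(subrK (f x) (f y)) (le_trans (ler_normD _ _))// addrC lerD2l.
by exists t^-1; split=> [|x]; [rewrite invr_gt0|exact: ht].
Qed.

Lemma compact_cont_min f : compact [set: X] -> continuous f -> (forall x, 0 < f x) ->
  exists2 c : R, 0 < c & forall x, c <= f x.
Proof.
move=> cX fc f0.
have [t t' x t'0 tt'|x _|t t0 ht] := @compact_uniform R X [set: X] (fun t x => t <= f x) cX.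
- exact: le_trans.
- have f20 : 0 < f x / 2 by rewrite divr_gt0.
  exists (f x / 2) => //; have /cvgrPdist_le/(_ _ f20) := fc x.
  apply: filterS => y; rewrite ler_norml => /andP[_ h].
  by rewrite -subr_ge0 in h *; move: h; rewrite {1}(splitr (f x)); lra.
by exists t => // x; exact: ht.
Qed.
End continuous_real_functions.

Section probability_of_sigma_additive.
Context d (T : measurableType d) (R : realType) (m : set T -> \bar R).
Hypotheses (m0 : m set0 = 0%E) (m_ge0 : forall A, (0 <= m A)%E).
Hypotheses (m_sigma : semi_sigma_additive m) (m1 : m setT = 1%E).

Let m' := m.
HB.instance Definition _ := isMeasure.Build d T R m' m0 m_ge0 m_sigma.
HB.instance Definition _ := Measure_isProbability.Build d T R m' m1.

Lemma probability_of_sigma_additive :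
  exists P : probability T R, P = m :> (set T -> \bar R).
Proof. by exists m'. Qed.

End probability_of_sigma_additive.

Section riesz.
Variables (R : realType) (L : (circle R -> R) -> R).
Local Notation X := (circle R).
Hypothesis LD : forall f g : X -> R, continuous f -> continuous g ->
  L (fun x => f x + g x) = L f + L g.
Hypothesis LZ : forall (a : R) (f : X -> R), continuous f -> L (fun x => a * f x) = a * L f.
Hypothesis L_ge0 : forall f : X -> R, continuous f -> (forall x, 0 <= f x) -> 0 <= L f.
Hypothesis L1 : L (fun=> 1) = 1.

Lemma L_cst c : L (fun=> c) = c.
Proof.
have h := LZ c (@cont_cst R X 1); rewrite L1 mulr1 in h; rewrite -[RHS]h.
by congr L; apply/funext => x; rewrite mulr1.
Qed.

Lemma L_B (f g : X -> R) : continuous f -> continuous g -> L (fun x => f x - g x) = L f - L g.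
Proof.
move=> fc gc; have := LD fc (contM (@cont_cst R X (-1)) gc); rewrite (LZ _ gc) mulN1r => <-.
by congr L; apply/funext => x; rewrite mulN1r.
Qed.

Lemma L_le (f g : X -> R) : continuous f -> continuous g -> (forall x, f x <= g x) -> L f <= L g.
Proof.
move=> fc gc fg; rewrite -subr_ge0 -L_B//; apply: L_ge0; first exact: contB.
by move=> x; rewrite subr_ge0.
Qed.

Lemma L_sum n (f : nat -> X -> R) : (forall i, continuous (f i)) ->
  L (fun x => \sum_(i < n) f i x) = \sum_(i < n) L (f i).
Proof.
move=> fc; elim: n => [|n IH].
  by rewrite big_ord0 -[RHS]L_cst; congr L; apply/funext => x; rewrite big_ord0.
rewrite big_ord_recr/= -IH -LD//; last exact: cont_sum.
by congr L; apply/funext => x; rewrite big_ord_recr.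
Qed.

(* Covering by nondecreasing sequences of continuous functions, rather than by
   open sets, makes countable subadditivity a matter of adding up sequences. *)
Definition riesz_cover (A : set X) (c : R) (f : nat -> X -> R) : Prop :=
  [/\ forall n, continuous (f n), forall n x, 0 <= f n x,
      forall x n m, (n <= m)%N -> f n x <= f m x,
      forall n, L (f n) <= c & forall x, A x -> exists n, 1 <= f n x].

Definition riesz_outer (A : set X) : R := inf [set c | exists f, riesz_cover A c f].

Let S A := [set c | exists f, riesz_cover A c f].

Let S_ge0 A : lbound (S A) 0.
Proof.
move=> c [f [fc f0 _ fL _]]; apply: le_trans (fL 0%N).
exact: L_ge0.
Qed.

Let S1 A : S A 1.
Proof.
exists (fun _ _ => 1); split=> //.
- by move=> _; exact: cont_cst.
- by move=> n; rewrite L1.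
- by move=> x _; exists 0%N.
Qed.

Let Sinf A : has_inf (S A).
Proof. by split; [exists 1; exact: S1|exists 0; exact: S_ge0]. Qed.

Let outer_ge0 A : 0 <= riesz_outer A.
Proof. by apply: lb_le_inf; [exists 1; exact: S1|exact: S_ge0]. Qed.

Lemma riesz_outer_le A c f : riesz_cover A c f -> riesz_outer A <= c.
Proof. by move=> h; apply: ge_inf; [exists 0; exact: S_ge0|exists f]. Qed.

Let outer_adherent A (e : R) : 0 < e -> exists c f, riesz_cover A c f /\ c < riesz_outer A + e.
Proof.
move=> e0; have [c [f h] ce] := inf_adherent e0 (Sinf A).
by exists c, f.
Qed.

Let outer0 : riesz_outer set0 = 0.
Proof.
apply/eqP; rewrite eq_le outer_ge0 andbT; apply: (@riesz_outer_le _ _ (fun _ _ => 0)).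
by split=> //; [move=> _; exact: cont_cst|move=> n; rewrite L_cst].
Qed.

(** Dini's argument: a nondecreasing cover of the compact circle exceeds [1 - e] everywhere from
    some index on. *)
Lemma riesz_outerT : riesz_outer setT = 1.
Proof.
apply/eqP; rewrite eq_le; apply/andP; split; first by apply: ge_inf; [exists 0; exact: S_ge0|exact: S1].
apply: lb_le_inf; first by exists 1; exact: S1.
move=> c [f [fc f0 fm fL f1]]; apply/ler_addgt0Pr => e e0; rewrite -lerBlDr.
have /compact_near_coveringP/(_ nat \oo (fun n x => 1 - e <= f n x)) := @circle_compact R.
move=> /(_ _)[x _|N _ /(_ N (leqnn N)) h].
- have [n hn] := f1 x I; have /cvgrPdist_le/(_ _ e0) := fc n x.
  move=> h; exists ([set y | `|f n x - f n y| <= e], [set m | (n <= m)%N]).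
    by split => //=; exists n.
  move=> [y m] /= [hy nm]; apply: le_trans (fm y _ _ nm).
  by move: hy; rewrite ler_norml => /andP[_]; lra.
- rewrite -[leLHS]L_cst; apply: le_trans (fL N).
  by apply: L_le => //; [exact: cont_cst|move=> x; exact: h].
Qed.

Let outer_subadd (A : set X) (F : nat -> set X) : A `<=` \bigcup_n F n ->
  ((riesz_outer A)%:E <= \sum_(n <oo) (riesz_outer (F n))%:E)%E.
Proof.
move=> AF.
have s0 n : (0 <= (riesz_outer (F n))%:E)%E by rewrite lee_fin.
have S_0 : (0 <= \sum_(n <oo) (riesz_outer (F n))%:E)%E by exact: nneseries_ge0.
case E : (\sum_(n <oo) (riesz_outer (F n))%:E)%E S_0 => [s| |] // _; last by rewrite leey.
rewrite lee_fin; apply/ler_addgt0Pr => e e0.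
have en n : 0 < e / 2 ^+ n.+1 by rewrite divr_gt0// exprn_gt0.
have [c hc] := choice (fun n => outer_adherent (F n) (en n)).
have [f hf] := choice hc.
have sumc n : \sum_(i < n) c i <= s + e.
  apply: (@le_trans _ _ (\sum_(i < n) (riesz_outer (F i) + e / 2 ^+ i.+1))).
    by apply: ler_sum => i _; have [_ /ltW] := hf i.
  rewrite big_split/= lerD//.
    rewrite -lee_fin -E -sumEFin -(big_mkord xpredT (fun i => (riesz_outer (F i))%:E)).
    exact: nneseries_lim_ge.
  have -> : \sum_(i < n) e / 2 ^+ i.+1 = e * (1 - 2^-1 ^+ n).
    elim: n => [|n IH]; first by rewrite big_ord0 expr0 subrr mulr0.
    by rewrite big_ord_recr/= IH -exprVn !exprS; field.
  by rewrite ler_piMr ?(ltW e0)// gerBl exprn_ge0.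
(* Diagonal sum: one more of the covers enters at each index, which keeps every function a finite
   sum, hence continuous. *)
apply: (@riesz_outer_le _ _ (fun n x => \sum_(i < n) f i n x)).
have fc i n : continuous (f i n) by have [[]] := hf i.
have f0 i n x : 0 <= f i n x by have [[]] := hf i.
have fm i x n m : (n <= m)%N -> f i n x <= f i m x by have [[_ _ + _ _] _] := hf i; exact.
split.
- by move=> n; apply: (@cont_sum R X n (fun i => f i n)).
- by move=> n x; apply: sumr_ge0.
- move=> x n m nm; apply: (@le_trans _ _ (\sum_(i < n) f i m x)).
    by apply: ler_sum => i _; exact: fm.
  by rewrite -(subnKC nm) big_split_ord/= lerDl sumr_ge0.
- move=> n; rewrite (@L_sum n (fun i => f i n))//; apply: le_trans (sumc n).
  by apply: ler_sum => i _; have [[_ _ _ + _] _] := hf i; exact.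
- move=> x /AF[i _ Fx]; have [[_ _ _ _ /(_ x Fx)[n hn]] _] := hf i.
  exists (maxn i.+1 n); rewrite (bigD1 (Ordinal (leq_maxl i.+1 n)))//=.
  apply: le_trans hn _; apply: (@le_trans _ _ (f i (maxn i.+1 n) x)).
    exact/fm/leq_maxr.
  by rewrite lerDl sumr_ge0.
Qed.

Let omeasure := fun A : set X => (riesz_outer A)%:E.

Let omeasure0 : omeasure set0 = 0%E. Proof. by rewrite /omeasure outer0. Qed.
Let omeasure_ge0 A : (0 <= omeasure A)%E. Proof. by rewrite lee_fin. Qed.
Let omeasure_sub A F : subset_sigma_subadditive omeasure A F.
Proof. exact: outer_subadd. Qed.

HB.instance Definition _ := isSubsetOuterMeasure.Build R X omeasure
  omeasure0 omeasure_ge0 omeasure_sub.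

(** A cover [f] of [A] is split by functions [chi n] increasing to the indicator of [U]. The part
    inside uses the moving factor [chi n]; the part outside uses a frozen [1 - chi k], with [k] such
    that [L (f k * chi k)] nearly attains its supremum. The two costs then add up to little more
    than [c]. *)
Let open_caratheodory (U : set X) : open U -> caratheodory_measurable omeasure U.
Proof.
move=> /circle_urysohnP; set chi := circle_urysohn U => -[chic chi01 chim chi0 chi1].
apply: le_caratheodory_measurable => A; rewrite -EFinD lee_fin.
apply/ler_addgt0Pr => e e0; have e20 : 0 < e / 2 by rewrite divr_gt0.
have [c [f [fcov cA]]] := outer_adherent A e20.
have [fc f0 fm fL fA] := fcov.
have chi_ge0 n x : 0 <= chi n x by have /andP[] := chi01 n x.
have chi_le1 n x : chi n x <= 1 by have /andP[] := chi01 n x.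
pose g n x := f n x * chi n x.
have gc n : continuous (g n) by apply: contM.
have gm x n m : (n <= m)%N -> g n x <= g m x by move=> nm; apply: ler_pM => //; [exact: fm|exact: chim].
have g_le n : L (g n) <= c.
  by apply: le_trans (fL n); apply: L_le => // x; rewrite ler_piMr.
pose s := sup (range (fun n => L (g n))).
have hs : has_sup (range (fun n => L (g n))).
  by split; [exists (L (g 0%N)), 0%N|exists c => _ [n _ <-]].
have gs n : L (g n) <= s by apply: ub_le_sup; [exact: hs.2|exists n].
have [_ [k _ <-] sk] := sup_adherent e20 hs.
have h1 : riesz_outer (A `&` U) <= s.
  apply: (@riesz_outer_le _ _ g); split=> //.
    by move=> n x; rewrite mulr_ge0.
  move=> x [/fA[n hn] /chi1[m hm]]; exists (maxn n m).
  rewrite /g (_ : chi _ x = 1) ?mulr1.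
    by apply: le_trans hn _; exact/fm/leq_maxl.
  by apply/eqP; rewrite eq_le chi_le1/= -hm; exact/chim/leq_maxr.
have h2 : riesz_outer (A `&` ~` U) <= c - s + e / 2.
  pose h n x := f n x * (1 - chi k x).
  have hc n : continuous (h n) by apply: contM => //; apply: contB => //; exact: cont_cst.
  have hm x n m : (n <= m)%N -> h n x <= h m x.
    by move=> nm; rewrite ler_wpM2r ?subr_ge0//; exact: fm.
  apply: (@riesz_outer_le _ _ h); split=> //.
  - by move=> n x; rewrite mulr_ge0// subr_ge0.
  - move=> n; apply: (@le_trans _ _ (L (h (maxn n k)))).
      by apply: L_le => // x; exact/hm/leq_maxl.
    have E : L (h (maxn n k)) = L (f (maxn n k)) - L (fun x => f (maxn n k) x * chi k x).
      rewrite -L_B//; last exact: contM.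
      by congr L; apply/funext => x; rewrite /h mulrBr mulr1.
    have : L (g k) <= L (fun x => f (maxn n k) x * chi k x).
      apply: L_le => //; first exact: contM.
      by move=> x; rewrite ler_wpM2r//; exact/fm/leq_maxr.
    by rewrite E; have := fL (maxn n k); move: sk; rewrite -/s; lra.
  - move=> x [/fA[n hn] Ux]; exists n; rewrite /h chi0// subr0 mulr1//.
by move: h1 h2 cA; lra.
Qed.

Lemma riesz_measure : exists nu : probability (borel_circle R) R,
  forall A : set (borel_circle R), measurable A -> nu A = (riesz_outer A)%:E.
Proof.
have sub (A : set (borel_circle R)) : measurable A -> caratheodory_measurable omeasure A.
  move: A; apply: smallest_sub; last exact: open_caratheodory.
  split.
  - exact: caratheodory_measurable_set0.
  - by move=> A hA; rewrite setTD; exact: caratheodory_measurable_setC.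
  - by move=> F hF; exact: caratheodory_measurable_bigcup.
have sadd : semi_sigma_additive (omeasure : set (borel_circle R) -> \bar R).
  move=> F mF tF mUF.
  apply: (@caratheodory_measure_sigma_additive R X omeasure F) => //.
    by move=> i; exact: sub.
  exact: sub.
have [nu nuE] := @probability_of_sigma_additive _ (borel_circle R) R
  (omeasure : set (borel_circle R) -> \bar R) omeasure0 omeasure_ge0 sadd
  (congr1 EFin riesz_outerT).
by exists nu => A _; rewrite nuE.
Qed.

End riesz.

(** * Integrals of bounded measurable functions against a probability *)

Section bounded_integral.
Context d (T : measurableType d) (R : realType) (nu : probability T R).

Definition bmeas (f : T -> R) : Prop :=
  measurable_fun setT f /\ exists M, forall x, `|f x| <= M.

Local Notation I := (Rintegral nu setT).

Lemma bmeas_integrable f : bmeas f -> nu.-integrable setT (EFin \o f).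
Proof.
move=> [mf [M fM]]; apply: measurable_bounded_integrable => //.
  by rewrite (le_lt_trans (probability_le1 nu _))// ltry.
by exists M; split; [exact: num_real|move=> N MN x _; exact: le_trans (fM x) (ltW MN)].
Qed.

Lemma bmeas_cst c : bmeas (fun=> c).
Proof. by split; [exact: measurable_cst|exists `|c|]. Qed.

Lemma bmeasD f g : bmeas f -> bmeas g -> bmeas (fun x => f x + g x).
Proof.
move=> [mf [M fM]] [mg [N gN]]; split; first exact: measurable_funD.
by exists (M + N) => x; rewrite (le_trans (ler_normD _ _))// lerD.
Qed.

Lemma bmeasM f g : bmeas f -> bmeas g -> bmeas (fun x => f x * g x).
Proof.
move=> [mf [M fM]] [mg [N gN]]; split; first exact: measurable_funM.
by exists (M * N) => x; rewrite normrM ler_pM.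
Qed.

Lemma bmeas_indic (A : set T) : measurable A -> bmeas (\1_A : T -> R).
Proof.
move=> mA; split; first exact: measurable_indic.
by exists 1 => x; rewrite indicE; case: (_ \in _); rewrite ?normr1 ?normr0.
Qed.

Lemma bintD f g : bmeas f -> bmeas g -> I (fun x => f x + g x) = I f + I g.
Proof. by move=> hf hg; apply: RintegralD => //; exact: bmeas_integrable. Qed.

Lemma bintZ a f : bmeas f -> I (fun x => a * f x) = a * I f.
Proof. by move=> hf; apply: RintegralZl => //; exact: bmeas_integrable. Qed.

Lemma bintB f g : bmeas f -> bmeas g -> I (fun x => f x - g x) = I f - I g.
Proof. by move=> hf hg; apply: RintegralB => //; exact: bmeas_integrable. Qed.

Lemma bint_cst c : I (fun=> c) = c.
Proof.
rewrite Rintegral_cst// [X in fine X](_ : _ = 1%E) ?mulr1//.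
exact: (probability_setT nu).
Qed.

Lemma bint_le f g : bmeas f -> bmeas g -> (forall x, f x <= g x) -> I f <= I g.
Proof. by move=> hf hg fg; apply: le_Rintegral => //; exact: bmeas_integrable. Qed.

Lemma bint_indic (A : set T) : measurable A -> I (\1_A) = fine (nu A).
Proof. by move=> mA; rewrite /Rintegral integral_indic// setIT. Qed.

Lemma bint_sum n (f : nat -> T -> R) : (forall i, bmeas (f i)) ->
  bmeas (fun x => \sum_(i < n) f i x) /\
  I (fun x => \sum_(i < n) f i x) = \sum_(i < n) I (f i).
Proof.
move=> hf; elim: n => [|n [IH1 IH2]].
  rewrite (_ : (fun x => _) = fun=> 0); last by apply/funext => x; rewrite big_ord0.
  by rewrite big_ord0 bint_cst; split => //; exact: bmeas_cst.
rewrite (_ : (fun x => _) = fun x => \sum_(i < n) f i x + f n x).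
  by rewrite bintD// IH2 big_ord_recr; split => //; exact: bmeasD.
by apply/funext => x; rewrite big_ord_recr.
Qed.

Lemma bint_markov f (e : R) (A : set T) : bmeas f -> measurable A -> 0 < e ->
  (forall x, 0 <= f x) -> (forall x, A x -> e <= f x) -> e * fine (nu A) <= I f.
Proof.
move=> hf mA e0 f0 fA; rewrite -bint_indic// -bintZ; last exact: bmeas_indic.
apply: bint_le => //; first by apply: bmeasM; [exact: bmeas_cst|exact: bmeas_indic].
move=> x; rewrite indicE; have [/set_mem/fA|_] := boolP (x \in A); first by rewrite mulr1.
by rewrite mulr0.
Qed.

Lemma bint_gt0 f (Z : set T) : bmeas f -> measurable Z -> nu Z = 0%E ->
  (forall x, ~ Z x -> 0 < f x) -> 0 < I f.
Proof.
move=> hf mZ nuZ fZ; have [mf [M fM]] := hf.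
(* Raised on the null set to become positive everywhere, without changing the integral. *)
pose g x := f x + (M + 1) * \1_Z x.
have hg : bmeas g.
  by apply: bmeasD => //; apply: bmeasM; [exact: bmeas_cst|exact: bmeas_indic].
have g0 x : 0 < g x.
  rewrite /g indicE; have [/set_mem Zx|Zx] := boolP (x \in Z).
    by have := fM x; rewrite ler_norml mulr1 => /andP[h _]; lra.
  by rewrite mulr0 addr0; apply: fZ => /mem_set; exact/negP.
have Ig : I g = I f.
  rewrite /g bintD//; last by apply: bmeasM; [exact: bmeas_cst|exact: bmeas_indic].
  by rewrite bintZ ?bint_indic// ?nuZ ?mulr0 ?addr0//; exact: bmeas_indic.
rewrite -Ig lt0r; apply/andP; split; last first.
  rewrite -[leLHS]bint_cst; apply: bint_le => //; first exact: bmeas_cst.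
  by move=> x; exact: ltW.
apply/eqP => I0.
pose A n := [set x | n.+1%:R^-1 <= g x].
have mA n : measurable (A n).
  rewrite -[A n]setTI.
  have -> : A n = g @^-1` `[n.+1%:R^-1, +oo[%classic.
    by apply/seteqP; split => x; rewrite /A/= in_itv/= andbT.
  by apply: hg.1.
have nuA n : nu (A n) = 0%E.
  have e0 : (0 : R) < n.+1%:R^-1 by rewrite invr_gt0.
  have := bint_markov hg (mA n) e0 (fun x => ltW (g0 x)) (fun x h => h).
  rewrite I0 pmulr_rle0// => h.
  have nuA0 : fine (nu (A n)) = 0 by apply/eqP; rewrite eq_le h fine_ge0.
  by rewrite -(fineK (fin_num_measure nu _ (mA n))) nuA0.
have : (nu (\bigcup_n A n) <= \sum_(n <oo) nu (A n))%E.
  by apply: measure_sigma_subadditive => //; exact: bigcup_measurable.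
rewrite eseries0// (_ : \bigcup_n _ = setT).
  rewrite [X in (X <= _)%E](_ : _ = 1%E); first by rewrite lee_fin ler10.
  exact: (probability_setT nu).
apply/seteqP; split => // x _.
exists (Num.bound (g x)^-1) => //; rewrite /A/= invf_ple ?posrE//.
by rewrite ltW// (lt_trans (archi_boundP _)) ?ltr_nat// invr_ge0 ltW.
Qed.

Lemma bmeas_comp (h : T -> T) f : measurable_fun setT h -> bmeas f -> bmeas (f \o h).
Proof.
move=> mh [mf [M fM]]; split; last by exists M => x; exact: fM.
exact: measurableT_comp.
Qed.

Lemma bint_invariant (h : T -> T) f : measurable_fun setT h -> bmeas f ->
  (forall A, measurable A -> nu (h @^-1` A) = nu A) -> I (f \o h) = I f.
Proof.
move=> mh hf nuh; rewrite /Rintegral; congr fine.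
transitivity (\int[pushforward nu h]_y (f y)%:E)%E.
  rewrite integral_pushforward//.
    by apply/measurable_EFinP; exact: hf.1.
  exact: (bmeas_integrable (bmeas_comp mh hf)).
by apply: eq_measure_integral => A mA _; rewrite /pushforward; exact: nuh.
Qed.

End bounded_integral.

Section riesz_integral.
Variables (R : realType) (L : (circle R -> R) -> R).
Local Notation X := (circle R).
Hypothesis LD : forall f g : X -> R, continuous f -> continuous g ->
  L (fun x => f x + g x) = L f + L g.
Hypothesis LZ : forall (a : R) (f : X -> R), continuous f -> L (fun x => a * f x) = a * L f.
Hypothesis L_ge0 : forall f : X -> R, continuous f -> (forall x, 0 <= f x) -> 0 <= L f.
Hypothesis L1 : L (fun=> 1) = 1.
Variable nu : probability (borel_circle R) R.
Hypothesis nuE : forall A : set (borel_circle R), measurable A -> nu A = (riesz_outer L A)%:E.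

Lemma circle_open_measurable (U : set (borel_circle R)) : open (U : set X) -> measurable U.
Proof. by move=> Uo; exact: sub_sigma_algebra. Qed.

Lemma continuous_borel_circle (f : X -> R) : continuous f ->
  measurable_fun setT (f : borel_circle R -> R).
Proof.
move=> /continuousP fc; apply: (measurability _ (RGenOInfty.measurableE R)).
move=> _ [_ [x ->] <-]; apply: measurableI => //.
by apply: circle_open_measurable; exact/fc/interval_open.
Qed.

Lemma continuous_borel_circle_map (T : X -> X) : continuous T ->
  measurable_fun setT (T : borel_circle R -> borel_circle R).
Proof.
move=> /continuousP Tc.
have := @measurability _ _ (borel_circle R) (borel_circle R) setT T (@open X) (erefl _).
apply; move=> _ [U Uo <-]; apply: measurableI => //.
by apply: circle_open_measurable; exact/Tc.
Qed.

Lemma continuous_bmeas (f : X -> R) : continuous f -> bmeas (f : borel_circle R -> R).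
Proof.
move=> fc; split; first exact: continuous_borel_circle.
by have [M [_ fM]] := compact_cont_bounded (@circle_compact R) fc; exists M.
Qed.

Local Notation I := (Rintegral nu setT).

(** Layer cake with step [dl]: [f] is the sum of the slices [g i], and [g i / dl] is a cover of
    [A i], so [dl * nu (A i) <= L (g i)]. On the other side [f] exceeds the sum of the
    [dl * \1_(A i)] by at most [dl]. *)
Let upper (f : X -> R) : continuous f -> (forall x, 0 <= f x <= 1) -> I f <= L f.
Proof.
move=> fc f01; apply/ler_addgt0Pr => e e0.
have [N hN] : exists N : nat, e^-1 < N.+1%:R.
  exists (Num.bound e^-1); apply: (lt_trans (archi_boundP _)); rewrite ?ltr_nat//.
  by rewrite invr_ge0 ltW.
pose dl : R := N.+1%:R^-1; have dl0 : 0 < dl by rewrite invr_gt0.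
have dle : dl <= e by rewrite /dl invf_ple ?posrE//; exact: ltW.
pose g i x := Num.min dl (Num.max 0 (f x - i%:R * dl)).
have gc i : continuous (g i).
  apply: cont_min; first exact: cont_cst.
  apply: cont_max; first exact: cont_cst.
  by apply: contB => //; exact: cont_cst.
have g0 i x : 0 <= g i x by rewrite /g le_min ltW//= le_max lexx.
have gsum n x : \sum_(i < n) g i x = Num.min (n%:R * dl) (f x).
  have /andP[fx0 fx1] := f01 x.
  elim: n => [|n IH]; first by rewrite big_ord0 mul0r min_l.
  rewrite big_ord_recr/= IH /g -natr1 mulrDl mul1r.
  by rewrite /Num.min /Num.max; repeat case: ifPn; rewrite -?leNgt; lra.
have Ndl : N.+1%:R * dl = 1 by rewrite /dl mulfV.
have fE x : f x = \sum_(i < N.+1) g i x.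
  by rewrite gsum Ndl min_r//; have /andP[] := f01 x.
pose A i : set (borel_circle R) := [set x | i.+1%:R * dl <= f x].
have mA i : measurable (A i).
  rewrite -[A i]setTI.
  have -> : A i = f @^-1` `[i.+1%:R * dl, +oo[%classic.
    by apply/seteqP; split => x; rewrite /A/= in_itv/= andbT.
  by apply: (continuous_borel_circle fc).
have hA i : bmeas (fun x => dl * \1_(A i) x).
  by apply: bmeasM; [exact: bmeas_cst|exact: bmeas_indic].
have [hS IS] := bint_sum nu N.+1 hA.
apply: (@le_trans _ _ (I (fun x => dl + \sum_(i < N.+1) dl * \1_(A i) x))).
  apply: bint_le => //; first exact: continuous_bmeas.
    by apply: bmeasD => //; exact: bmeas_cst.
  move=> x; have H n : Num.min (n%:R * dl) (f x) <= dl + \sum_(i < n) dl * \1_(A i) x.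
    elim: n => [|n IH]; first by rewrite big_ord0 addr0 mul0r ge_min ltW.
    rewrite big_ord_recr/= indicE.
    have [/set_mem|] := boolP (x \in A n).
      rewrite /A/= mulr1 => h; rewrite min_l//.
      rewrite min_l in IH; last first.
        by apply: le_trans h; rewrite ler_wpM2r ?(ltW dl0)// ler_nat.
      by rewrite -natr1 mulrDl mul1r addrA lerD2r.
    rewrite mulr0 addr0 => /negP h.
    have {}h : f x < n.+1%:R * dl.
      by rewrite ltNge; apply/negP => h'; apply: h; exact/mem_set.
    rewrite (min_r (ltW h)); have [h2|h2] := leP (f x) (n%:R * dl).
      by rewrite (min_r h2) in IH.
    rewrite (min_l (ltW h2)) in IH.
    have {IH} : f x <= dl + \sum_(i < n) dl.
      rewrite sumr_const card_ord; move: h; rewrite -mulr_natl -natr1; lra.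
    move/le_trans; apply; rewrite lerD2l; apply: ler_sum => i _.
    rewrite indicE mem_set ?mulr1// /A/=; apply: le_trans (ltW h2).
    by rewrite ler_wpM2r ?(ltW dl0)// ler_nat.
  by have := H N.+1; rewrite Ndl min_r//; have /andP[] := f01 x.
rewrite bintD//; last exact: bmeas_cst.
rewrite bint_cst addrC lerD// IS.
rewrite [X in _ <= L X](_ : _ = fun x => \sum_(i < N.+1) g i x); last exact/funext.
rewrite (@L_sum R L LD LZ L1 N.+1 g gc); apply: ler_sum => i _.
rewrite bintZ; last exact: bmeas_indic.
rewrite bint_indic// nuE//= mulrC -ler_pdivlMr//.
apply: (@riesz_outer_le R L L_ge0 (A i) (L (g i) / dl) (fun _ x => dl^-1 * g i x)); split.
- by move=> _; apply: contM => //; exact: cont_cst.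
- by move=> _ x; rewrite mulr_ge0// invr_ge0 ltW.
- by [].
- by move=> _; rewrite LZ// mulrC.
- move=> x Ax; exists 0%N; rewrite ler_pdivlMl// mulr1 /g le_min lexx/=.
  by rewrite le_max; apply/orP; right; move: Ax; rewrite /A/= -natr1 mulrDl mul1r; lra.
Qed.

(** [upper] for [g] and for [1 - g] gives equality when the values lie in [[0, 1]]; an affine change
    of values does the rest. *)
Lemma riesz_integral (f : X -> R) : continuous f -> I f = L f.
Proof.
have H01 (g : X -> R) : continuous g -> (forall x, 0 <= g x <= 1) -> I g = L g.
  move=> gc g01; apply/eqP; rewrite eq_le upper//=.
  have h1c : continuous (fun x => 1 - g x) by apply: contB => //; exact: cont_cst.
  have := @upper (fun x => 1 - g x) h1c _.
  rewrite (@L_B R L LD LZ _ _ (@cont_cst R X 1) gc) L1 bintB ?bint_cst//.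
  - by rewrite lerD2l lerN2; apply => x; have := g01 x => /andP[? ?]; apply/andP; split; lra.
  - exact: bmeas_cst.
  - exact: continuous_bmeas.
move=> fc; have [M [M0 fM]] := compact_cont_bounded (@circle_compact R) fc.
pose g x := (2 * M)^-1 * (f x + M).
have gc : continuous g.
  by apply: contM; [exact: cont_cst|apply: contD => //; exact: cont_cst].
have M20 : 0 < 2 * M by rewrite mulr_gt0.
have fE : f = fun x => 2 * M * g x + (- M).
  by apply/funext => x; rewrite /g mulVKf ?lt0r_neq0// addrK.
have gb : bmeas (g : borel_circle R -> R) by exact: continuous_bmeas.
rewrite fE bintD; last 2 first.
- by apply: bmeasM => //; exact: bmeas_cst.
- exact: bmeas_cst.
rewrite bintZ// bint_cst LD; last 2 first.
- by apply: contM => //; exact: cont_cst.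
- exact: cont_cst.
rewrite (LZ (2 * M) gc) (L_cst LZ L1) H01// => x; have := fM x; rewrite ler_norml => /andP[h1 h2].
rewrite /g; apply/andP; split.
  by rewrite mulr_ge0 ?invr_ge0 ?(ltW M20)//; lra.
by rewrite ler_pdivrMl// mulr1; lra.
Qed.

End riesz_integral.

(** * Ergodic optimization *)

Section ergodic_optimization.
Variables (R : realType) (T : circle R -> circle R).
Local Notation X := (circle R).
Variables (psi : nat -> X -> R) (beta : R).
Hypothesis Tc : continuous T.
Hypothesis psic : forall i, continuous (psi i).
Arguments psic : clear implicits.
Hypothesis psim : forall i j x, (i <= j)%N -> psi i x <= psi j x.
Hypothesis beta_ub : forall i (h : X -> R) (c : R), continuous h ->
  (forall x, c <= psi i x - h x + h (T x)) -> c <= beta.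
Hypothesis beta_sup : forall e : R, 0 < e -> exists i (h : X -> R), continuous h /\
  forall x, beta - e <= psi i x - h x + h (T x).

Let V := X -> R^o.
Let C : set V := [set f | continuous (f : X -> R)].

Let C0 : C 0. Proof. exact: cont_cst. Qed.
Let CD u v : C u -> C v -> C (u + v). Proof. exact: contD. Qed.
Let CZ a u : C u -> C (a *: u).
Proof. by move=> Cu; apply: (@contM R X (fun=> a) u) => //; exact: cont_cst. Qed.

Let cT (f : X -> R) : continuous f -> continuous (fun x => f (T x)).
Proof. by move=> fc; exact: cont_comp. Qed.

(* [p] is the support function of the set of invariant states [L] such that
   [L (psi i) <= beta] for all [i]. *)
Let S (f : V) : set R := [set c | exists (h : X -> R) (t : R) (i : nat),
  [/\ continuous h, 0 <= t &
      forall x, f x + h x - h (T x) - t * (psi i x - beta) <= c]].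

Let p (f : V) : R := inf (S f).

Let S_inh f c : (forall x, f x <= c) -> S f c.
Proof.
move=> fc; exists (fun=> 0), 0, 0%N; split; [exact: cont_cst|by []|move=> x].
by rewrite mul0r subr0 addrK.
Qed.

(** Finiteness of [p], from the upper bound property of [beta]: a value below [- M] would make
    [t * (psi i - beta)] plus a coboundary at least a positive constant, and division by [t] would
    improve on [beta]. *)
Let S_lb f M : (forall x, `|f x| <= M) -> lbound (S f) (- M).
Proof.
move=> fM c [h [t [i [hc t0 hfc]]]]; rewrite leNgt; apply/negP => cM.
have e0 : 0 < - M - c by rewrite subr_gt0.
have key x : - M - c <= t * (psi i x - beta) - h x + h (T x).
  by have := hfc x; have := fM x; rewrite ler_norml => /andP[? _]; lra.
have [t00|tn0] := eqVneq t 0.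
  have [m [m0 pm]] := compact_cont_bounded (@circle_compact R) (psic 0%N).
  (* For [t = 0] a coboundary alone is bounded below by a positive constant; its multiple by [l] is
     large enough to lift [psi 0] above [beta]. *)
  pose l := (`|beta| + m + 1) / (- M - c).
  have l0 : 0 <= l by rewrite divr_ge0 ?(ltW e0)// !addr_ge0// ltW.
  have := @beta_ub 0%N (fun x => l * h x) (- m + l * (- M - c)).
  rewrite /l divfK ?gt_eqF// -/l => H.
  have : - m + (`|beta| + m + 1) <= beta.
    apply: H; first by apply: contM => //; exact: cont_cst.
    move=> x; have := key x; rewrite t00 mul0r sub0r => kx.
    have := ler_wpM2l l0 kx; rewrite {1}/l divfK ?gt_eqF//.
    by have := pm x; rewrite ler_norml => /andP[? _]; rewrite mulrDr mulrN; lra.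
  by have := ler_norm beta; lra.
have tp : 0 < t by rewrite lt0r tn0.
have : beta + (- M - c) / t <= beta.
  apply: (@beta_ub i (fun x => t^-1 * h x)); first by apply: contM => //; exact: cont_cst.
  move=> x.
  have : (- M - c) / t <= psi i x - beta - t^-1 * h x + t^-1 * h (T x).
    rewrite ler_pdivrMr// (_ : _ * t = t * (psi i x - beta) - h x + h (T x)) ?key//.
    by field.
  lra.
by rewrite gerDl leNgt divr_gt0.
Qed.

Let S_lbC f : C f -> exists l, lbound (S f) l.
Proof.
move=> fc; have [M [_ fM]] := compact_cont_bounded (@circle_compact R) fc.
by exists (- M); exact: S_lb.
Qed.

Let p_le f c : C f -> S f c -> p f <= c.
Proof. by move=> /S_lbC[l hl] Sc; apply: ge_inf => //; exists l. Qed.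

Let S_ne f : C f -> S f !=set0.
Proof.
move=> fc; have [M [_ fM]] := compact_cont_bounded (@circle_compact R) fc.
by exists M; apply: S_inh => x; have := fM x; rewrite ler_norml => /andP[].
Qed.

Let le_p f c : C f -> (forall c', S f c' -> c <= c') -> c <= p f.
Proof. by move=> /S_ne Sf h; apply: lb_le_inf. Qed.

(** Monotonicity of [psi] in the index allows two witnesses to be merged at the larger index. *)
Let p_sublinear : sublinear_on C p.
Proof.
split=> [u v Cu Cv|t u t0 Cu].
  have Cuv := CD Cu Cv.
  rewrite -lerBlDr; apply: (le_p _) => // c1 [h1 [t1 [i1 [h1c t10 H1]]]].
  rewrite lerBlDr -lerBlDl; apply: (le_p _) => // c2 [h2 [t2 [i2 [h2c t20 H2]]]].
  rewrite lerBlDl; apply: p_le => //.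
  exists (fun x => h1 x + h2 x), (t1 + t2), (maxn i1 i2); split.
  - exact: contD.
  - exact: addr_ge0.
  move=> x; have := H1 x; have := H2 x.
  have := ler_wpM2l t10 (psim x (leq_maxl i1 i2)).
  have := ler_wpM2l t20 (psim x (leq_maxr i1 i2)).
  change ((u + v) x) with (u x + v x); lra.
rewrite mulrC -ler_pdivrMr//; apply: le_p => // c [h [s [i [hc s0 H]]]].
rewrite ler_pdivrMr// mulrC; apply: p_le; first exact: CZ.
exists (fun x => t * h x), (t * s), i; split.
- by apply: contM => //; exact: cont_cst.
- by rewrite mulr_ge0// ltW.
- move=> x; change ((t *: u) x) with (t * u x).
  by have := ler_wpM2l (ltW t0) (H x); lra.
Qed.

Definition invariant_state (L : V -> R) : Prop :=
  [/\ linear_on C L, forall f, C f -> (forall x, 0 <= f x) -> 0 <= L f,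
      L (fun=> 1) = 1 & forall f, C f -> L (fun x => f (T x)) = L f].

(** One explicit witness in [S] for each property: the trivial one of [S_inh] for positivity and
    normalization, [h = f] or [h = - f] with [t = 0] for invariance, and [t = 1] for the bound on
    [psi i]. *)
Let below_p_state L : linear_on C L -> (forall f, C f -> L f <= p f) ->
  invariant_state L /\ forall i, L (psi i) <= beta.
Proof.
move=> Ll Lp.
have LN f : C f -> L (- f) = - L f.
  by move=> Cf; rewrite -scaleN1r Ll.2// mulN1r.
have CN f : C f -> C (- f) by move=> Cf; rewrite -scaleN1r; exact: CZ.
have C1 c : C (fun=> c) by exact: cont_cst.
split; last first.
  move=> i; apply: (le_trans (Lp _ (psic i))); apply: p_le; first exact: psic.
  exists (fun=> 0), 1, i; split; [exact: cont_cst|by []|move=> x; lra].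
split => //.
- move=> f Cf f0; rewrite -oppr_le0 -LN//; apply: (le_trans (Lp _ (CN _ Cf))).
  by apply: p_le; [exact: CN|apply: S_inh => x; rewrite oppr_le0].
- apply/eqP; rewrite eq_le; apply/andP; split.
    by apply: (le_trans (Lp _ (C1 1))); apply: p_le => //; exact: S_inh.
  rewrite -lerN2 -(LN _ (C1 1)); apply: (le_trans (Lp _ (CN _ (C1 1)))).
  by apply: p_le; [exact: CN|exact: S_inh].
- move=> f Cf; have CfT := cT Cf.
  pose g : V := fun x => f (T x).
  have gf0 : p (g - f) <= 0.
    apply: p_le; first exact/CD/CN.
    exists f, 0, 0%N; split => // x; change ((g - f) x) with (f (T x) - f x); lra.
  have fg0 : p (f - g) <= 0.
    apply: p_le; first exact/CD/CN.
    exists (- f), 0, 0%N; split => // [|x]; first exact: CN.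
    change ((f - g) x) with (f x - f (T x)); change ((- f) x) with (- f x).
    change ((- f) (T x)) with (- f (T x)); lra.
  have Cg : C g := CfT.
  have LB u v : C u -> C v -> L (u - v) = L u - L v.
    by move=> Cu Cv; rewrite Ll.1// ?LN//; exact: CN.
  have h1 := le_trans (Lp (g - f) (CD Cg (CN _ Cf))) gf0.
  have h2 := le_trans (Lp (f - g) (CD Cf (CN _ Cg))) fg0.
  rewrite LB// subr_le0 in h1; rewrite LB// subr_le0 in h2.
  by apply/eqP; rewrite eq_le h1.
Qed.

Let state_below_p L : invariant_state L -> (forall i, L (psi i) <= beta) ->
  forall f, C f -> L f <= p f.
Proof.
move=> [Ll L0 L1 LT] Lpsi f Cf; apply: le_p => // c [h [t [i [hc t0 H]]]].
have LDx (u v : X -> R) : continuous u -> continuous v ->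
  L (fun x => u x + v x) = L u + L v := Ll.1 u v.
have LZx (a : R) (u : X -> R) : continuous u -> L (fun x => a * u x) = a * L u := Ll.2 a u.
have c1 : continuous (fun x => f x + h x) by exact: contD.
have c2 : continuous (fun x => f x + h x - h (T x)) by apply: contB => //; exact: cT.
have c3 : continuous (fun x => psi i x - beta) by apply: contB => //; exact: cont_cst.
have c4 : continuous (fun x => t * (psi i x - beta)) by apply: contM => //; exact: cont_cst.
have := L_le LDx LZx L0 (contB c2 c4) (@cont_cst R X c) H.
rewrite (L_B LDx LZx c2 c4) (L_B LDx LZx c1 (cT hc)) (LDx _ _ Cf hc) (LT _ hc).
rewrite (LZx _ _ c3) (L_B LDx LZx (psic i) (@cont_cst R X beta)) !(L_cst LZx L1).
have := Lpsi i; rewrite -subr_le0 => h1.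
have : t * (L (psi i) - beta) <= 0 by rewrite mulr_ge0_le0.
lra.
Qed.

(** An invariant state does not see the coboundary in [beta_sup]. So no state falls asymptotically
    below [beta], whether or not it is below [p]. *)
Let state_beta (L : V -> R) : invariant_state L -> forall e : R, 0 < e ->
  exists i, forall j, (i <= j)%N -> beta - e <= L (psi j).
Proof.
move=> [Ll L0 L1 LT] e e0.
have LDx (u v : X -> R) : continuous u -> continuous v ->
  L (fun x => u x + v x) = L u + L v := Ll.1 u v.
have LZx (a : R) (u : X -> R) : continuous u -> L (fun x => a * u x) = a * L u := Ll.2 a u.
have [i [h [hc H]]] := beta_sup e0; exists i => j ij.
have c1 : continuous (fun x => psi i x - h x) by exact: contB.
apply: (@le_trans _ _ (L (psi i))); last by apply: (L_le LDx LZx L0) => // x; exact: psim.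
have := L_le LDx LZx L0 (@cont_cst R X (beta - e)) (contD c1 (cT hc)) H.
by rewrite (L_cst LZx L1) (LDx _ _ c1 (cT hc)) (L_B LDx LZx (psic i) hc) (LT _ hc) subrK.
Qed.

(** An invariant set of intermediate measure splits [L] into two conditional states, both still
    below [p]. Extremality identifies [L] with the one living on the complement, which then has
    outer measure at least 1. *)
Lemma ergodic_optimization : exists nu : probability (borel_circle R) R,
  ergodic T nu /\ forall i, Rintegral nu setT (psi i) <= beta.
Proof.
have [L [Ll Lp Lext]] := extreme_linear C0 CD CZ p_sublinear.
have [Lst Lpsi] := below_p_state Ll Lp.
have [_ L0 L1 LT] := Lst.
have LDx (u v : X -> R) : continuous u -> continuous v ->
  L (fun x => u x + v x) = L u + L v := Ll.1 u v.
have LZx (a : R) (u : X -> R) : continuous u -> L (fun x => a * u x) = a * L u := Ll.2 a u.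
have [nu nuE] := riesz_measure LDx LZx L0 L1.
have IL := riesz_integral LDx LZx L0 L1 nuE.
have mT := continuous_borel_circle_map Tc.
have mTA (A : set (borel_circle R)) : measurable A -> measurable (T @^-1` A : set (borel_circle R)).
  by move=> mA; rewrite -[X in measurable X]setTI; exact: mT.
(* Covers are pulled back by [T] at the same cost; the reverse inequality will come from the
   complement. *)
have inv_le (A : set (borel_circle R)) : measurable A -> (nu (T @^-1` A) <= nu A)%E.
  move=> mA; rewrite nuE; last exact: mTA.
  rewrite nuE// lee_fin; apply: lb_le_inf.
    exists 1, (fun _ _ => 1); split=> //.
    - by move=> _; exact: cont_cst.
    - by move=> _; rewrite L1.
    - by move=> x _; exists 0%N.
  move=> c [f [fc f0 fm fL fA]].
  apply: (@riesz_outer_le _ L L0 _ c (fun n x => f n (T x))); split => //.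
  - by move=> n; exact: cT.
  - by move=> x n m; exact: fm.
  - by move=> n; rewrite (LT (f n) (fc n)).
  - by move=> x; exact: fA.
have inv (A : set (borel_circle R)) : measurable A -> nu (T @^-1` A) = nu A.
  move=> mA; apply/eqP; rewrite eq_le inv_le//=.
  have := inv_le _ (measurableC mA); rewrite -preimage_setC.
  have -> := probability_setC nu (mTA _ mA); have -> := probability_setC nu mA.
  rewrite -(fineK (fin_num_measure nu _ mA)) -(fineK (fin_num_measure nu _ (mTA _ mA))).
  by rewrite -!EFinB !lee_fin lerD2l lerN2.
exists nu; split; last by move=> i; rewrite IL.
split=> // A mA TA.
have [->|nuA0] := eqVneq (nu A) 0%E; [by left|right].
apply/eqP; apply: contraT => nuA1; exfalso.
pose a := fine (nu A).
have nuAa : nu A = a%:E by rewrite fineK// fin_num_measure.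
have a0 : 0 < a.
  by rewrite lt0r fine_ge0// andbT; move: nuA0; rewrite nuAa eqe.
have a1 : a < 1.
  have := probability_le1 nu mA; rewrite nuAa lee_fin le_eqVlt => /orP[/eqP a1|//].
  by move: nuA1; rewrite nuAa a1 eqxx.
have a10 : 0 < 1 - a by rewrite subr_gt0.
have mAC := measurableC mA.
have nuAC : fine (nu (~` A)) = 1 - a.
  by have := probability_setC nu mA; rewrite nuAa -EFinB => ->.
have cond_state (B : set (borel_circle R)) (b : R) : measurable B -> T @^-1` B = B ->
    0 < b -> fine (nu B) = b ->
    invariant_state (fun f => b^-1 * Rintegral nu setT (fun x => f x * \1_B x)).
  move=> mB TB b0 nuB.
  have hB : bmeas (\1_B : borel_circle R -> R) by exact: bmeas_indic.
  have hf (f : X -> R) : C f -> bmeas ((fun x => f x * \1_B x) : borel_circle R -> R).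
    by move=> Cf; apply: bmeasM => //; exact: continuous_bmeas.
  split.
  - split=> [u v Cu Cv|s u Cu].
      rewrite -mulrDr -bintD; [|exact: hf|exact: hf].
      by congr (_ * Rintegral _ _ _); apply/funext => x; rewrite -mulrDl.
    rewrite mulrCA -(@bintZ _ _ R nu s _ (hf u Cu)).
    by congr (_ * Rintegral _ _ _); apply/funext => x; rewrite mulrA.
  - move=> f Cf f0; rewrite mulr_ge0 ?invr_ge0 ?(ltW b0)//.
    by apply: Rintegral_ge0 => x _; rewrite mulr_ge0// indicE.
  - rewrite (_ : (fun x => _) = \1_B); last by apply/funext => x; rewrite mul1r.
    by rewrite bint_indic// nuB mulVf// gt_eqF.
  - move=> f Cf; congr (_ * _).
    rewrite -(bint_invariant mT (hf f Cf) inv); congr Rintegral.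
    apply/funext => x /=; congr (_ * _); rewrite !indicE; congr ((_ : bool)%:R).
    by rewrite -{1}TB; apply/idP/idP => /set_mem h; apply/mem_set.
have st1 := cond_state A a mA TA a0 erefl.
have TAC : T @^-1` (~` A) = ~` A by rewrite -preimage_setC TA.
have st2 := cond_state (~` A) (1 - a) mAC TAC a10 nuAC.
set M1 := (fun f : V => _) in st1; set M2 := (fun f : V => _) in st2.
have dec (f : V) : C f -> L f = a * M1 f + (1 - a) * M2 f.
  move=> Cf; rewrite /M1 /M2 !mulVKf ?gt_eqF//.
  rewrite -bintD; last 2 first.
  - by apply: bmeasM; [exact: continuous_bmeas|exact: bmeas_indic].
  - by apply: bmeasM; [exact: continuous_bmeas|exact: bmeas_indic].
  rewrite -[LHS]IL//; congr Rintegral; apply/funext => x.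
  rewrite -mulrDr !indicE in_setC; case: (x \in A); rewrite /= ?addr0 ?add0r mulr1//.
(* [L] is at most [beta] on every [psi i] and the other part is asymptotically at least [beta], so
   this part cannot exceed [beta]. *)
have psi_le (b : R) (K1 K2 : V -> R) : 0 < b -> b < 1 -> invariant_state K1 -> invariant_state K2 ->
    (forall f, C f -> L f = b * K1 f + (1 - b) * K2 f) -> forall i, K1 (psi i) <= beta.
  move=> b0 b1 s1 s2 LK i; have b10 : 0 < 1 - b by rewrite subr_gt0.
  apply/ler_addgt0Pr => e e0.
  have e'0 : 0 < e * b / (1 - b) by rewrite divr_gt0// mulr_gt0.
  have [i' hi'] := state_beta s2 e'0.
  have k1 : K1 (psi i) <= K1 (psi (maxn i i')).
    have [Kl K0 K1' KT] := s1.
    by apply: (@L_le R K1 (Kl.1) (Kl.2) K0) => // x; exact/psim/leq_maxl.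
  have k2 := hi' _ (leq_maxr i i').
  have := LK _ (psic (maxn i i')); have := Lpsi (maxn i i') => h1 h2.
  have h3 := ler_wpM2l (ltW b10) k2.
  have h4 : (1 - b) * (e * b / (1 - b)) = e * b by rewrite mulrC divfK// gt_eqF.
  rewrite mulrBr h4 in h3.
  apply: (le_trans k1); rewrite -(ler_pM2l b0); lra.
have b1 := state_below_p st1 (psi_le a M1 M2 a0 a1 st1 st2 dec).
have dec' f : C f -> L f = (1 - a) * M2 f + (1 - (1 - a)) * M1 f.
  by move=> Cf; rewrite dec// addrC; congr (_ + _ * _); ring.
have a11 : 1 - a < 1 by rewrite ltrBlDr ltrDl.
have b2 := state_below_p st2 (psi_le (1 - a) M2 M1 a10 a11 st2 st1 dec').
have a01 : 0 < 1 - a < 1 by rewrite a10.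
have [l1 _ _ _] := st1; have [l2 _ _ _] := st2.
have M2L := Lext M2 M1 (1 - a) l2 l1 b2 b1 a01 dec'.
(* [M2] agrees with [L] on continuous functions but integrates only over the complement of [A]: a
   cover of cost [c] gives [nu (B n) <= c * (1 - a)], and the sets [B n] exhaust the complement, of
   measure [1 - a]. *)
have : 1 <= riesz_outer L (~` A).
  apply: lb_le_inf.
    exists 1, (fun _ _ => 1); split=> //.
    - by move=> _; exact: cont_cst.
    - by move=> _; rewrite L1.
    - by move=> x _; exists 0%N.
  move=> c [f [fc f0 fm fL fA]].
  pose B n : set (borel_circle R) := [set x | 1 <= f n x] `&` ~` A.
  have mB n : measurable (B n).
    apply: measurableI => //.
    rewrite (_ : [set x | _] = setT `&` (f n) @^-1` `[1, +oo[%classic).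
      by apply: (continuous_borel_circle (fc n)).
    by apply/seteqP; split => x /=; rewrite in_itv/= andbT => // -[].
  have nuB n : fine (nu (B n)) <= c * (1 - a).
    apply: (@le_trans _ _ (L (f n) * (1 - a))); last by rewrite ler_pM2r.
    rewrite -M2L; last exact: fc.
    rewrite /M2 mulrAC mulVf ?gt_eqF// mul1r -bint_indic//.
    apply: bint_le; first exact: bmeas_indic.
      by apply: bmeasM; [exact: continuous_bmeas|exact: bmeas_indic].
    move=> x; rewrite !indicE.
    have [/set_mem[/= h1 h2]|_] := boolP (x \in B n); last by rewrite mulr_ge0.
    by rewrite mem_set// mulr1.
  have Bm : nondecreasing_seq B.
    move=> n m nm; apply/subsetPset => x [/= h1 h2]; split => //=.
    exact: le_trans h1 (fm _ _ _ nm).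
  have BU : \bigcup_n B n = ~` A.
    apply/seteqP; split => x; first by move=> [n _ []].
    by move=> Ax; have [n hn] := fA x Ax; exists n.
  have hB : nu (B n) @[n --> \oo] --> nu (~` A).
    by rewrite -BU; apply: nondecreasing_cvg_mu => //; exact: bigcup_measurable.
  have : (nu (~` A) <= (c * (1 - a))%:E)%E.
    rewrite -(cvg_lim _ hB)//; apply: lime_le; first by apply/cvg_ex; eexists; exact: hB.
    by apply: nearW => n; have := nuB n; rewrite -lee_fin fineK// fin_num_measure.
  have -> : nu (~` A) = (1 - a)%:E by rewrite -nuAC fineK// fin_num_measure.
  by rewrite lee_fin -{1}[1 - a]mul1r ler_pM2r.
have : riesz_outer L (~` A) = 1 - a by rewrite -nuAC nuE.
by move=> ->; rewrite lerBrDr gerDl leNgt a0.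
Qed.

End ergodic_optimization.

(** * The extinction probability *)

Section extinction_basics.
Variables (R : realType) (T : circle R -> circle R) (mu : circle R -> probability nat R).
Local Notation X := (circle R).
Local Notation phi := (genfun mu).
Local Notation q := (extinction T mu).
Local Notation qn := (fun n x => genfun_iter T mu n x 0).
Hypothesis Tc : continuous T.
Hypothesis mu0 : forall x, mu x <> \d_0%N :> (set nat -> \bar R).
Hypothesis phic : strip_continuous (fun a s => phi (circle_pi a) s).

Lemma genfunE x : phi x = pgf (mu x). Proof. by []. Qed.

Lemma pmf0_lt1 x : pmf (mu x) 0 < 1.
Proof.
have h : pmf (mu x) 0 <= 1 by rewrite -pgf0 pgf_le1// ler01.
by rewrite lt_neqAle h andbT; apply/eqP => /pmf1_dirac; exact: mu0.
Qed.

Lemma genfun_compl_ge x w : 0 <= w -> w <= 1 ->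
  (1 - pmf (mu x) 0) * w <= 1 - phi x (1 - w).
Proof.
move=> w0 w1; have h0 : 0 <= 1 - w by rewrite subr_ge0.
have h1 : 1 - w <= 1 by rewrite gerBl.
have := @pgf_convex R (mu x) 0 (1 - w) 1 (lexx 0) h0 h1 (lexx 1).
by rewrite pgf1 pgf0 genfunE subr0; lra.
Qed.

Lemma genfun_compl_gt0 x w : 0 < w -> w <= 1 -> 0 < 1 - phi x (1 - w).
Proof.
move=> w0 w1; apply: lt_le_trans (genfun_compl_ge x (ltW w0) w1).
by rewrite mulr_gt0// subr_gt0 pmf0_lt1.
Qed.

Lemma genfun_compl_slope x w w' : 0 <= w -> w <= w' -> w' <= 1 ->
  (1 - phi x (1 - w')) * w <= (1 - phi x (1 - w)) * w'.
Proof.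
move=> w0 ww' w'1.
have h1 : 0 <= 1 - w' by rewrite subr_ge0.
have h2 : 1 - w' <= 1 - w by rewrite lerD2l lerN2.
have h3 : 1 - w <= 1 by rewrite gerBl.
have := @pgf_convex R (mu x) (1 - w') (1 - w) 1 h1 h2 h3 (lexx 1).
by rewrite pgf1 genfunE; lra.
Qed.

Lemma genfun_compl_le x w w' : 0 <= w -> w <= w' -> w' <= 1 ->
  1 - phi x (1 - w) <= 1 - phi x (1 - w').
Proof.
move=> w0 ww' w'1; rewrite lerD2l lerN2; apply: pgf_le.
- by rewrite subr_ge0.
- by rewrite lerD2l lerN2.
- by rewrite gerBl.
Qed.

Lemma genfun_comp_continuous (v : X -> R) : continuous v -> (forall x, 0 <= v x < 1) ->
  continuous (fun x => phi x (v x)).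
Proof.
move=> vc v01; apply/circle_continuousP.
apply: (@strip_comp_continuous R _ (v \o @circle_pi R) phic).
  by move=> a; exact: v01.
exact/circle_continuousP.
Qed.

Lemma genfun_left_continuous x s : 0 <= s < 1 -> forall e : R, 0 < e ->
  exists2 t : R, 0 < t & forall y, `|y - s| < t -> 0 <= y < 1 -> `|phi x y - phi x s| <= e.
Proof.
move=> s01 e e0; have [t t0 ht] := strip_continuousP phic (repr x) s01 e0.
exists t => // y ys y01; have := ht (repr x) y; rewrite circle_pi_repr.
by apply => //; rewrite subrr normr0.
Qed.

Lemma genfun_iter_itv n x : 0 <= qn n x < 1.
Proof.
elim: n x => [|n IH] x /=; first by rewrite lexx ltr01.
have /andP[h0 h1] := IH (T x).
rewrite pgf_ge0 ?(ltW h1)//= -subr_gt0.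
by have := @genfun_compl_gt0 x (1 - qn n (T x)); rewrite /= subKr; apply; rewrite ?subr_gt0 ?gerBl.
Qed.

Lemma genfun_iter_continuous n : continuous (qn n).
Proof.
elim: n => [|n IH] /=; first exact: cont_cst.
apply: genfun_comp_continuous; first exact: (cont_comp IH Tc).
by move=> x; exact: genfun_iter_itv.
Qed.

Lemma genfun_iter_nondecreasing x : nondecreasing_seq (qn ^~ x).
Proof.
apply/nondecreasing_seqP => n; elim: n x => [|n IH] x.
  by have /andP[] := genfun_iter_itv 1 x.
apply: pgf_le; [|exact: IH|]; first by have /andP[] := genfun_iter_itv n (T x).
by have /andP[_ /ltW] := genfun_iter_itv n.+1 (T x).
Qed.

Lemma extinction_cvg x : qn n x @[n --> \oo] --> q x.
Proof.
apply: nondecreasing_is_cvgn; first exact: genfun_iter_nondecreasing.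
by exists 1 => _ [n _ <-]; have /andP[_ /ltW] := genfun_iter_itv n x.
Qed.

Lemma genfun_iter_le_extinction n x : qn n x <= q x.
Proof.
apply: nondecreasing_cvgn_le; first exact: genfun_iter_nondecreasing.
by apply/cvg_ex; eexists; exact: extinction_cvg.
Qed.

Lemma extinction_le x (c : R) : (forall n, qn n x <= c) -> q x <= c.
Proof.
move=> h; rewrite -(cvg_lim (@Rhausdorff R) (extinction_cvg (x := x))).
apply: limr_le; first by apply/cvg_ex; eexists; exact: extinction_cvg.
exact: nearW.
Qed.

Lemma extinction_ge0 x : 0 <= q x.
Proof. exact: (genfun_iter_le_extinction 0 x). Qed.

Lemma extinction_le1 x : q x <= 1.
Proof. by apply: extinction_le => n; have /andP[_ /ltW] := genfun_iter_itv n x. Qed.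

Lemma extinction_adherent x (e : R) : 0 < e -> exists n, q x - e < qn n x.
Proof.
move=> e0; have /cvgrPdist_lt/(_ e e0)[n _ /(_ n (leqnn n))] := extinction_cvg (x := x).
by move=> /= /ltr_normlP[_ h]; exists n; lra.
Qed.

(** The limit passes through [phi x] by continuity on [[0, 1[], where the hypothesis [q (T x) < 1]
    places the argument. *)
Lemma extinction_fixed x : q (T x) < 1 -> q x = phi x (q (T x)).
Proof.
move=> qT1; have qT0 := extinction_ge0 (T x).
apply/eqP; rewrite eq_le; apply/andP; split.
  apply: extinction_le => -[|n] /=; first exact: pgf_ge0 qT0 (ltW qT1).
  apply: pgf_le; [|exact: genfun_iter_le_extinction|exact: ltW].
  by have /andP[] := genfun_iter_itv n (T x).
apply/ler_addgt0Pr => e e0.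
have qT01 : 0 <= q (T x) < 1 by rewrite qT0.
have [t t0 ht] := genfun_left_continuous x qT01 e0.
have [n hn] := extinction_adherent (T x) t0.
have := ht (qn n (T x)); rewrite genfun_iter_itv => /(_ _ isT).
have h := genfun_iter_le_extinction n (T x).
have -> : `|qn n (T x) - q (T x)| < t.
  by rewrite ler0_norm ?subr_le0// opprB; lra.
move=> /(_ isT)/ler_normlP[+ _].
have := genfun_iter_le_extinction n.+1 x; rewrite /=; lra.
Qed.

(** A substitute for the fixed point equation that remains available when [q (T x) = 1]: a positive
    [t] leaves room for some iterate to exceed [1 - t]. *)
Lemma extinction_compl_le x t : 1 - q (T x) <= t -> 0 < t -> t <= 1 ->
  1 - q x <= 1 - phi x (1 - t).
Proof.
move=> wt t0 t1; have := extinction_le1 (T x); rewrite le_eqVlt => /orP[/eqP q1|q1].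
  have [n hn] := extinction_adherent (T x) t0.
  have := genfun_iter_le_extinction n.+1 x => /=.
  have : phi x (1 - t) <= phi x (qn n (T x)).
    apply: pgf_le; first by rewrite subr_ge0.
      by rewrite -q1 ltW.
    by have /andP[_ /ltW] := genfun_iter_itv n (T x).
  rewrite /=; lra.
rewrite (extinction_fixed q1) -[q (T x)](subKr 1).
by apply: genfun_compl_le => //; rewrite subr_ge0 ltW.
Qed.

Lemma extinction_measurable : measurable_fun setT (q : borel_circle R -> R).
Proof.
apply: (measurability _ (RGenOInfty.measurableE R)).
move=> _ [_ [t ->] <-]; apply: measurableI => //.
apply: circle_open_measurable.
have -> : q @^-1` `]t, +oo[%classic = \bigcup_n (qn n @^-1` `]t, +oo[%classic).
  apply/seteqP; split => x.
    rewrite /= in_itv/= andbT -subr_gt0 => /(extinction_adherent x)[n hn].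
    by exists n => //=; rewrite in_itv/= andbT; lra.
  move=> [n _]; rewrite /= !in_itv/= !andbT => /lt_le_trans; apply.
  exact: genfun_iter_le_extinction.
apply: bigcup_open => n _; have /continuousP := @genfun_iter_continuous n; apply.
exact: interval_open.
Qed.

End extinction_basics.

Lemma measurable_superlevel d (T : measurableType d) (R : realType) (f : T -> R) (c : R) :
  measurable_fun setT f -> measurable [set x | c <= f x].
Proof.
move=> mf; rewrite (_ : [set x | _] = setT `&` f @^-1` `[c, +oo[%classic); first exact: mf.
by apply/seteqP; split => x /=; rewrite in_itv/= andbT => // -[].
Qed.

(** * Extinction probability bounded away from 1 *)

Section supercritical.
Variables (R : realType) (T : circle R -> circle R) (mu : circle R -> probability nat R).
Local Notation X := (circle R).
Local Notation phi := (genfun mu).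
Local Notation q := (extinction T mu).
Hypothesis Tc : continuous T.
Hypothesis mu0 : forall x, mu x <> \d_0%N :> (set nat -> \bar R).
Hypothesis mu1 : forall x, mu x <> \d_1%N :> (set nat -> \bar R).
Hypothesis phic : strip_continuous (fun a s => phi (circle_pi a) s).

Let s i : R := i.+1%:R^-1.
Let s0 i : 0 < s i. Proof. by rewrite invr_gt0. Qed.
Let s1 i : s i <= 1. Proof. by rewrite invf_le1// ler1n. Qed.
Let sm i j : (i <= j)%N -> s j <= s i.
Proof. by move=> ij; rewrite lef_pV2 ?posrE// ler_nat. Qed.
Let s_small (e : R) : 0 < e -> exists j, s j <= e.
Proof.
move=> e0; exists (Num.bound e^-1); rewrite invf_ple ?posrE//.
by rewrite ltW// (lt_trans (archi_boundP _)) ?ltr_nat// invr_ge0 ltW.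
Qed.

Let W x w := 1 - phi x (1 - w).
Let psi i x := ln (W x (s i) / s i).

Let W0 x w : 0 < w -> w <= 1 -> 0 < W x w. Proof. exact: genfun_compl_gt0. Qed.
Let Ws0 x i : 0 < W x (s i) / s i. Proof. by rewrite divr_gt0// W0. Qed.

Let psi_exp i x : W x (s i) = s i * expR (psi i x).
Proof. by rewrite /psi lnK ?posrE// mulrC divfK// gt_eqF. Qed.

Let psic i : continuous (psi i).
Proof.
have hc : continuous (fun x => W x (s i) / s i).
  apply: contM; last exact: cont_cst.
  apply: contB; first exact: cont_cst.
  apply: (genfun_comp_continuous phic (@cont_cst R X (1 - s i))) => x.
  by rewrite subr_ge0 s1 ltrBlDr ltrDl s0.
move=> x; apply: (@continuous_comp _ _ _ (fun x => W x (s i) / s i) (@ln R)); first exact: hc.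
exact: continuous_ln.
Qed.
Arguments psic : clear implicits.

Let psim i j x : (i <= j)%N -> psi i x <= psi j x.
Proof.
move=> ij; rewrite ler_ln ?posrE// ler_pdivrMr// mulrAC ler_pdivlMr//.
by apply: genfun_compl_slope => //; [exact: ltW|exact: sm].
Qed.

(** As [s 0 = 1], [psi 0] is the logarithm of [1 - phi x 0], which is continuous and positive on a
    compact space; the other [psi i] are larger. *)
Let C_exists : exists2 C : R, 0 <= C & forall i x, - C <= psi i x.
Proof.
have hc : continuous (fun x => W x (s 0)).
  have := @psic 0%N => h.
  rewrite (_ : (fun x => _) = fun x => s 0 * expR (psi 0 x)); last first.
    by apply/funext => x; exact: psi_exp.
  apply: contM; first exact: cont_cst.
  by apply: (cont_comp (@continuous_expR R) h).
have [c c0 hW] := compact_cont_min (@circle_compact R) hc (fun x => W0 x (s0 0) (s1 0)).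
exists (`|ln c|) => // i x; apply: (@le_trans _ _ (psi 0 x)); last exact: psim.
apply: (@le_trans _ _ (ln c)); first by have := ler_norm (- ln c); rewrite normrN; lra.
rewrite ler_ln ?posrE//; have s01 : (s 0)^-1 = 1 by rewrite invrK.
by rewrite s01 mulr1.
Qed.

Let coboundary_bound i (h : X -> R) : continuous h ->
  (forall x, 0 <= psi i x - h x + h (T x)) -> exists2 dl : R, 0 < dl & forall x, q x <= 1 - dl.
Proof.
move=> hc H; have [M [M0 hM]] := compact_cont_bounded (@circle_compact R) hc.
have [C C0 hC] := C_exists.
pose w n x := 1 - genfun_iter T mu n x 0.
(* A bound that survives both cases of the induction: when [w n (T x) <= s i], it is transported
   from [T x] to [x] by the coboundary inequality; otherwise the next [w] is at least
   [s i * expR (- C)], and [M] pays for [h]. *)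
pose m0 := ln (s i) - C - M.
have lns : ln (s i) <= 0 by rewrite ln_le0.
have w01 n x : 0 < w n x /\ w n x <= 1.
  by have /andP[] := genfun_iter_itv T mu0 n x; rewrite /w subr_gt0 gerBl.
have key n x : m0 <= ln (w n x) - h x.
  elim: n x => [|n IH] x.
    rewrite /w /= subr0 ln1 /m0; have := hM x; rewrite ler_norml => /andP[_ ?]; lra.
  have [wT0 wT1] := w01 n (T x); have [wx0 wx1] := w01 n.+1 x.
  have wE : w n.+1 x = W x (w n (T x)) by rewrite /w/= /W subKr.
  have [ws|sw] := leP (w n (T x)) (s i).
    have : w n (T x) * expR (psi i x) <= w n.+1 x.
      have : W x (s i) * w n (T x) <= W x (w n (T x)) * s i.
        exact: genfun_compl_slope (ltW wT0) ws (s1 i).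
      by rewrite psi_exp -wE => sl; rewrite -(ler_pM2l (s0 i)); lra.
    rewrite -ler_ln ?posrE ?mulr_gt0 ?expR_gt0//.
    rewrite lnM ?posrE ?expR_gt0// expRK.
    have := IH (T x); have := H x; lra.
  have : s i * expR (psi i x) <= w n.+1 x.
    by rewrite wE -psi_exp; apply: genfun_compl_le => //; exact: ltW.
  rewrite -ler_ln ?posrE ?mulr_gt0 ?expR_gt0//.
  rewrite lnM ?posrE ?expR_gt0// expRK.
  have := hM x; rewrite ler_norml => /andP[_ ?]; have := hC i x; rewrite /m0; lra.
exists (expR (m0 - M)); first exact: expR_gt0.
move=> x; apply: (extinction_le mu0) => n.
suff : expR (m0 - M) <= w n x by rewrite /w; lra.
have [wx0 _] := w01 n x.
rewrite -[leRHS]lnK ?posrE// ler_expR.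
have := key n x; have := hM x; rewrite ler_norml => /andP[? _]; lra.
Qed.

Section critical_measure.
Variable nu : probability (borel_circle R) R.
Hypothesis nuT : forall A : set (borel_circle R), measurable A -> nu (T @^-1` A) = nu A.
Hypothesis nu_q1 : nu (q @^-1` [set 1]) = 0%E.
Hypothesis nu_psi : forall i, Rintegral nu setT (psi i) <= 0.

Let w x := 1 - q x.
Let w0 x : 0 <= w x. Proof. by rewrite subr_ge0; exact: extinction_le1. Qed.
Let w1 x : w x <= 1. Proof. by rewrite gerBl; exact: extinction_ge0. Qed.

Let wb : bmeas (w : borel_circle R -> R).
Proof.
split; last by exists 1 => x; rewrite ger0_norm.
by apply: measurable_funB => //; apply: extinction_measurable.
Qed.

Let mT : measurable_fun setT (T : borel_circle R -> borel_circle R).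
Proof. exact: continuous_borel_circle_map. Qed.

(* [- u i] is [- log w] truncated at height [- log (s i)]. *)
Let u i x := ln (Num.max (w x) (s i)).
Let max0 i x : 0 < Num.max (w x) (s i). Proof. by rewrite lt_max s0 orbT. Qed.

Let ub i : bmeas (u i : borel_circle R -> R).
Proof.
split.
  apply: measurableT_comp; first exact: measurable_ln.
  by apply: measurable_maxr; [exact: wb.1|exact: measurable_cst].
exists (- ln (s i)) => x; rewrite ler0_norm; last by rewrite ln_le0// ge_max w1 s1.
by rewrite lerN2 ler_ln ?posrE// le_max lexx orbT.
Qed.

Let dd i x := u i x - u i (T x).

Let ddb i : bmeas (dd i : borel_circle R -> R).
Proof.
rewrite (_ : dd i = fun x => u i x + (- 1) * (u i \o T) x).
  apply: bmeasD => //; apply: bmeasM; first exact: bmeas_cst.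
  exact: (bmeas_comp mT (ub i)).
by apply/funext => x /=; rewrite mulN1r.
Qed.

Let dd0 i : Rintegral nu setT (dd i) = 0.
Proof.
rewrite bintB//; first by rewrite (bint_invariant mT (ub i) nuT) subrr.
exact: (bmeas_comp mT (ub i)).
Qed.

(** Truncation keeps the inequality between [log w x - log w (T x)] and [psi i x] where [w x] is at
    least [s i]. Elsewhere [u i x] is at its minimum, so the difference is nonpositive. *)
Let dd_le i x : (s i <= w x -> dd i x <= psi i x) /\ (w x < s i -> dd i x <= Num.max (psi i x) 0).
Proof.
have [C C0 hC] := C_exists.
have [wTs|swT] := leP (w (T x)) (s i).
  have h1 : u i (T x) = ln (s i) by rewrite /u max_r.
  have h2 : w x <= s i * expR (psi i x).
    by rewrite -psi_exp; exact: (extinction_compl_le mu0 phic wTs).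
  split => [sw|ws]; last by rewrite /dd h1 /u (max_r (ltW ws)) subrr le_max lexx orbT.
  rewrite /dd h1 /u (max_l sw) lerBlDl -[psi i x]expRK -lnM ?posrE ?expR_gt0//.
  by rewrite ler_ln ?posrE ?mulr_gt0 ?expR_gt0// (lt_le_trans (s0 i)).
have wT0 : 0 < w (T x) by apply: lt_trans swT.
have h1 : u i (T x) = ln (w (T x)) by rewrite /u max_l// ltW.
split => [sw|ws]; last first.
  rewrite /dd h1 /u (max_r (ltW ws)) le_max; apply/orP; right.
  by rewrite subr_le0 ler_ln ?posrE// ltW.
have wx0 : 0 < w x by apply: lt_le_trans sw.
rewrite /dd h1 /u (max_l sw) lerBlDl -[psi i x]expRK -lnM ?posrE ?expR_gt0//.
rewrite ler_ln ?posrE ?mulr_gt0 ?expR_gt0//.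
have wE : w x = W x (w (T x)).
  rewrite /w /W subKr -(extinction_fixed mu0 phic)//; by rewrite -subr_gt0.
have : W x (w (T x)) * s i <= W x (s i) * w (T x).
  exact: genfun_compl_slope (ltW (s0 i)) (ltW swT) (w1 (T x)).
by rewrite -wE psi_exp => sl; rewrite -(ler_pM2l (s0 i)); lra.
Qed.

Let low i : set (borel_circle R) := ~` [set x | s i <= w x].
Let low_m i : measurable (low i).
Proof. by apply: measurableC; apply: measurable_superlevel; exact: wb.1. Qed.

(** Points where [log w x - log w (T x)] is below [psi j x] by at least [s j], and where neither
    logarithm is truncated at any level from [j] on. *)
Let Y j : set (borel_circle R) := [set x | s j <= w x] `&` [set x | s j <= (w \o T) x] `&`
  [set x | s j <= psi j x - dd j x].

Let Ym j : measurable (Y j).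
Proof.
apply: measurableI; [apply: measurableI|]; apply: measurable_superlevel.
- exact: wb.1.
- exact: (bmeas_comp mT wb).1.
- apply: measurable_funB; last exact: (ddb j).1.
  exact: continuous_borel_circle (psic j).
Qed.

Let dd_stable i j x : (j <= i)%N -> s j <= w x -> s j <= w (T x) -> dd i x = dd j x.
Proof.
move=> ji h1 h2; have sij := sm ji.
by rewrite /dd /u !max_l// (le_trans sij).
Qed.

(** Markov's inequality for [k], whose integral is at most [C * nu (low i)]. On [Y j] the function
    [k] is at least [s j] whatever [i >= j], so [i] can tend to infinity with [j] fixed. *)
Let Y_bound C : 0 <= C -> (forall i x, - C <= psi i x) -> forall i j, (j <= i)%N ->
  s j * fine (nu (Y j)) <= C * fine (nu (low i)).
Proof.
move=> C0 hC i j ji.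
pose k x := psi i x - dd i x + C * \1_(low i) x.
have hpsi : bmeas (psi i : borel_circle R -> R) by exact: continuous_bmeas (psic i).
have hi : bmeas (\1_(low i) : borel_circle R -> R) by exact: bmeas_indic.
have hCi : bmeas ((fun x => C * \1_(low i) x) : borel_circle R -> R).
  by apply: bmeasM => //; exact: bmeas_cst.
have hpd : bmeas ((fun x => psi i x - dd i x) : borel_circle R -> R).
  rewrite (_ : (fun x => _) = fun x => psi i x + (- 1) * dd i x).
    by apply: bmeasD => //; apply: bmeasM => //; exact: bmeas_cst.
  by apply/funext => x; rewrite mulN1r.
have hk : bmeas (k : borel_circle R -> R) by apply: bmeasD.
have k0 x : 0 <= k x.
  have [dd1 dd2] := dd_le i x; rewrite /k indicE.
  have [/set_mem lx|lx] := boolP (x \in low i).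
    have ws : w x < s i by rewrite ltNge; exact/negP.
    have := dd2 ws; have := hC i x; rewrite mulr1 le_max => h1 /orP[]; lra.
  have sw : s i <= w x.
    by rewrite leNgt; apply/negP => ws; move/negP: lx; apply; apply/mem_set => /=; apply/negP; rewrite -ltNge.
  by have := dd1 sw; rewrite mulr0; lra.
apply: (@le_trans _ _ (Rintegral nu setT k)).
  apply: bint_markov => // x [[h1 h2] h3].
  rewrite /k (dd_stable ji h1 h2); apply: (le_trans h3).
  have : 0 <= C * \1_(low i) x by rewrite mulr_ge0.
  by have := psim x ji; lra.
rewrite bintD// bintB// dd0 subr0 bintZ// bint_indic//.
by rewrite gerDr.
Qed.

Let low_cvg : fine (nu (low i)) @[i --> \oo] --> (0 : R).
Proof.
have : nu (low i) @[i --> \oo] --> nu (\bigcap_i low i).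
  apply: nonincreasing_cvg_mu => //.
  - by rewrite (le_lt_trans (probability_le1 nu (low_m 0)))// ltry.
  - exact: bigcap_measurable.
  - move=> n m nm; apply/subsetPset => x /= h1 h2; apply: h1.
    exact: le_trans (sm nm) h2.
have -> : \bigcap_i low i = q @^-1` [set 1].
  apply/seteqP; split => x; last first.
    by move=> /= qx i _; rewrite /low/= /w qx subrr; apply/negP; rewrite -ltNge.
  move=> h; apply/eqP; rewrite -subr_eq0 -oppr_eq0 opprB -/(w x) eq_le w0 andbT.
  rewrite leNgt; apply/negP => wx; have [j hj] := s_small wx.
  exact: (h j I).
by rewrite nu_q1 => /fine_cvg.
Qed.

Let Y_null j : nu (Y j) = 0%E.
Proof.
have [C C0 hC] := C_exists.
have : s j * fine (nu (Y j)) <= C * 0.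
  have h : C * fine (nu (low i)) @[i --> \oo] --> C * 0.
    by apply: cvgM => //; exact: cvg_cst.
  rewrite -(cvg_lim (@Rhausdorff R) h); apply: limr_ge.
    by apply/cvg_ex; eexists; exact: h.
  by exists j => // i /= ji; exact: Y_bound.
rewrite mulr0 pmulr_rle0// => h.
have Y0 : fine (nu (Y j)) = 0 by apply/eqP; rewrite eq_le h fine_ge0.
by rewrite -(fineK (fin_num_measure nu _ (Ym j))) Y0.
Qed.

Let Z : set (borel_circle R) := q @^-1` [set 1] `|` T @^-1` (q @^-1` [set 1]) `|` \bigcup_j Y j.

Let mq1 : measurable (q @^-1` [set 1] : set (borel_circle R)).
Proof.
have := @extinction_measurable R T mu Tc mu0 phic.
move/(_ measurableT [set 1] (measurable_set1 1)).
by rewrite setTI.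
Qed.

Let Z_null : measurable Z /\ nu Z = 0%E.
Proof.
have mTq : measurable (T @^-1` (q @^-1` [set 1]) : set (borel_circle R)).
  by rewrite -[X in measurable X]setTI; exact: mT.
have mY : measurable (\bigcup_j Y j) by exact: bigcup_measurable.
have nuY : nu (\bigcup_j Y j) = 0%E.
  apply/eqP; rewrite eq_le measure_ge0 andbT.
  rewrite (@le_trans _ _ (\sum_(j <oo) nu (Y j))%E)//.
    exact: measure_sigma_subadditive.
  by rewrite eseries0.
split; first by apply: measurableU => //; exact: measurableU.
have U0 (A B : set (borel_circle R)) : measurable A -> measurable B ->
    nu A = 0%E -> nu B = 0%E -> nu (A `|` B) = 0%E.
  move=> mA mB A0 B0; apply/eqP; rewrite eq_le measure_ge0 andbT.
  apply: (le_trans (measureU2 nu mA mB)); change (nu A + nu B <= 0)%E.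
  by rewrite A0 B0 adde0.
apply: (U0 _ _) => //; first exact: measurableU.
by apply: (U0 _ _) => //; rewrite nuT.
Qed.

(** Off the null set the ratio [W x w / w] is no larger at [w = s j] than at the larger point
    [w (T x)]. Strict convexity being thus excluded, only masses at 0 and 1 remain, and the mass at
    0 is positive since [mu x] is not the Dirac mass at 1. *)
Let off_Z x : ~ Z x -> 0 < w (T x) - w x.
Proof.
move=> Zx; have wpos y : q y <> 1 -> 0 < w y.
  move=> qy; rewrite lt_neqAle w0 andbT eq_sym subr_eq0; apply/eqP => h; exact: qy.
have wx0 : 0 < w x by apply: wpos => h; apply: Zx; left; left.
have wT0 : 0 < w (T x) by apply: wpos => h; apply: Zx; left; right.
have YN j : ~ Y j x by move=> h; apply: Zx; right; exists j.
have wE : w x = W x (w (T x)).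
  rewrite /w /W subKr -(extinction_fixed mu0 phic)//; by rewrite -subr_gt0.
(* The half makes [s j] strictly smaller than [w (T x)], as [pgf_slope_lt] requires. *)
have m20 : 0 < Num.min (w x) (w (T x) / 2) by rewrite lt_min wx0 divr_gt0.
have [j] := s_small m20; rewrite le_min => /andP[jx jT].
have jT1 : s j < w (T x) by rewrite (le_lt_trans jT)// ltr_pdivrMr// ltr_pMr// ltr1n.
have ddE i : (j <= i)%N -> dd i x = ln (w x) - ln (w (T x)).
  by move=> ji; rewrite (dd_stable ji jx (ltW jT1)) /dd /u !max_l// ltW.
have psi_le : psi j x <= ln (w x) - ln (w (T x)).
  apply/ler_addgt0Pr => e e0; have [i hi] := s_small e0.
  have ji := leq_maxl j i; have ii := leq_maxr j i.
  have : psi (maxn j i) x - dd (maxn j i) x < s (maxn j i).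
    rewrite ltNge; apply/negP => h; apply: (YN (maxn j i)); split; [split|] => //=.
      exact: le_trans (sm ji) jx.
    exact: le_trans (sm ji) (ltW jT1).
  rewrite (ddE _ ji); have := psim x ji; have := sm ii; lra.
have WW : W x (s j) * w (T x) <= w x * s j.
  have : expR (psi j x) <= w x / w (T x).
    by rewrite -[leRHS]lnK ?posrE ?divr_gt0// ler_expR ln_div.
  rewrite ler_pdivlMr// psi_exp => h.
  by rewrite -mulrA (mulrC (w x)) ler_pM2l.
have p0 i : (2 <= i)%N -> pmf (mu x) i = 0.
  move=> i2; apply/eqP; rewrite eq_le pmf_ge0 andbT leNgt; apply/negP => pi.
  have q0 : 0 <= q (T x) by exact: extinction_ge0.
  have qs : q (T x) < 1 - s j by move: jT1; rewrite /w; lra.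
  have s1' : 1 - s j < 1 by rewrite gtrBl.
  have := pgf_slope_lt q0 qs s1' i2 pi; rewrite -!genfunE subKr.
  rewrite -/(W x (s j)) -/(w (T x)).
  have -> : 1 - phi x (q (T x)) = w x by rewrite wE /W /w subKr.
  by rewrite ltNge WW.
have [p1 aff] := pgf_affine p0.
have p00 : 0 < pmf (mu x) 0.
  rewrite lt_neqAle pmf_ge0 andbT; apply/eqP => p00.
  by move: p1; rewrite -p00 subr0 => /pmf1_dirac; exact: mu1.
have -> : w x = (1 - pmf (mu x) 0) * w (T x).
  by rewrite wE /W /w subKr; apply: aff; [exact: extinction_ge0|exact: extinction_le1].
by rewrite mulrBl mul1r subKr mulr_gt0.
Qed.

Lemma critical_measure_absurd : False.
Proof.
have [mZ nuZ] := Z_null.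
have wTb : bmeas (w \o T : borel_circle R -> R) := bmeas_comp mT wb.
have hf : bmeas ((fun x => (w \o T) x - w x) : borel_circle R -> R).
  rewrite (_ : (fun x => _) = fun x => (w \o T) x + (- 1) * w x).
    by apply: bmeasD => //; apply: bmeasM => //; exact: bmeas_cst.
  by apply/funext => x; rewrite mulN1r.
have := bint_gt0 hf mZ nuZ off_Z.
by rewrite bintB// (bint_invariant mT wb nuT) subrr ltxx.
Qed.

End critical_measure.

Lemma extinction_bounded_away :
  (forall nu : probability (borel_circle R) R, ergodic T nu -> nu (q @^-1` [set 1]) = 0%E) ->
  exists2 dl : R, 0 < dl & forall x, q x <= 1 - dl.
Proof.
move=> hc.
pose B := [set c : R | exists i (h : X -> R), continuous h /\
  forall x, c <= psi i x - h x + h (T x)].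
(* Either a coboundary makes some [psi i] nonnegative, or all elements of [B] are negative; in the
   latter case [sup B], possibly equal to 0, serves as [beta]. *)
have [[c [Bc c0]]|noB] := pselect (exists c, B c /\ 0 <= c).
  have [i [h [hcont H]]] := Bc.
  by apply: (coboundary_bound hcont) => x; exact: le_trans c0 (H x).
have [C C0 hC] := C_exists.
have Bub : ubound B 0.
  move=> c Bc; rewrite leNgt; apply/negP => c0; apply: noB; exists c; split => //.
  exact: ltW.
have Bsup : has_sup B.
  split; last by exists 0.
  exists (- C), 0%N, (fun=> 0); split; first exact: cont_cst.
  by move=> x; rewrite subr0 addr0.
exfalso.
have [nu [nuerg nupsi]] := @ergodic_optimization R T psi (sup B) Tc (fun i => psic i)
  (fun i j x ij => psim x ij)
  (fun i h c hcont H => ub_le_sup Bsup.2 (ex_intro _ i (ex_intro _ h (conj hcont H))))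
  ltac:(move=> e e0; have [c [i [h [hcont H]]] ce] := sup_adherent e0 Bsup;
        exists i, h; split => // x; exact: le_trans (ltW ce) (H x)).
apply: (@critical_measure_absurd nu).
- exact: nuerg.1.
- exact: hc.
- move=> i; apply: (le_trans (nupsi i)).
  by apply: ge_sup => //; exact: Bsup.1.
Qed.

End supercritical.

(** The linear lower bound keeps the infimum finite. Euclidean division of [n] by a nearly optimal
    index [m.+1] costs at most the constant [L], which division by a large [n] makes negligible. *)
Lemma fekete (R : realType) (u : nat -> R) (c : R) :
  (forall n m, u (n + m)%N <= u n + u m) -> (forall n, c * n%:R <= u n) ->
  exists2 l : R, c <= l & u n / n%:R @[n --> \oo] --> l.
Proof.
move=> usub uc.
pose S := [set u n.+1 / n.+1%:R | n in [set: nat]].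
have Slb : lbound S c by move=> _ [n _ <-]; rewrite ler_pdivlMr.
have Sinf : has_inf S by split; [exists (u 1 / 1%:R), 0%N|exists c].
exists (inf S); first by apply: lb_le_inf => //; exact: Sinf.1.
apply/cvgrPdist_le => e e0; have e20 : 0 < e / 2 by rewrite divr_gt0.
have [_ [m _ <-] hm] := inf_adherent e20 Sinf.
have [M M0 hM] : exists2 M : R, 0 <= M & forall r, (r < m.+1)%N -> `|u r| <= M.
  exists (\sum_(i < m.+1) `|u i|); first exact: sumr_ge0.
  by move=> r rm; rewrite (bigD1 (Ordinal rm))//= lerDl sumr_ge0.
have uq q : u (q * m.+1)%N <= u 0%N + q%:R * u m.+1.
  elim: q => [|q IH]; first by rewrite mul0n mul0r addr0.
  by rewrite mulSnr (le_trans (usub _ _))// -natr1 mulrDl mul1r addrA lerD2r.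
pose L := M + M + `|u m.+1|.
have L0 : 0 <= L by rewrite !addr_ge0.
have [N hN] : exists N : nat, L / (e / 2) <= N%:R.
  exists (Num.bound (L / (e / 2))); apply/ltW/archi_boundP.
  by rewrite divr_ge0// ltW.
exists (maxn 1 N) => // n /=; rewrite geq_max => /andP[n1 Nn].
have n0 : (0 : R) < n%:R by rewrite ltr0n.
have infle : inf S <= u n / n%:R.
  by apply: ge_inf; [exact: Sinf.2|exists n.-1 => //; rewrite prednK].
rewrite distrC ger0_norm ?subr_ge0// lerBlDr.
have nE := divn_eq n m.+1; set q := (n %/ m.+1)%N in nE; set r := (n %% m.+1)%N in nE.
have rm : (r < m.+1)%N by exact: ltn_pmod.
have un : u n <= u m.+1 / m.+1%:R * n%:R + L.
  have h1 : u n <= u 0%N + q%:R * u m.+1 + u r.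
    by rewrite {1}nE (le_trans (usub _ _))// lerD2r.
  have h2 : q%:R * u m.+1 = u m.+1 / m.+1%:R * n%:R - u m.+1 * (r%:R / m.+1%:R).
    by rewrite [in n%:R]nE natrD natrM; field.
  have h3 : `|u m.+1 * (r%:R / m.+1%:R)| <= `|u m.+1|.
    by rewrite normrM ler_piMr// ger0_norm ?divr_ge0// ler_pdivrMr// mul1r ler_nat ltnW.
  have h4 := ler_norm (u 0%N); have h5 := ler_norm (u r).
  have := hM 0%N isT; have := hM _ rm; move: h3; rewrite ler_norml => /andP[h3 _].
  rewrite h2 in h1; rewrite /L; move: h1 h3 h4 h5.
  set Y := u m.+1 * (r%:R / _); set Z := u m.+1 / _ * _; set U := `|u m.+1|.
  by clearbody Y Z U; lra.
rewrite ler_pdivrMr//; apply: (le_trans un).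
have h6 : L <= e / 2 * n%:R.
  rewrite -ler_pdivrMl// mulrC; apply: (le_trans hN); by rewrite ler_nat.
have : u m.+1 / m.+1%:R * n%:R <= (inf S + e / 2) * n%:R by rewrite ler_wpM2r ?ltW// ltW.
by set Z := u m.+1 / _ * _; clearbody Z L; lra.
Qed.

(** Uniqueness of [lim] requires a proper filter; the point [r] in the proof shows that [[0, 1]]
    accumulates at [s]. *)
Lemma ederive_withinE (R : realType) (f : R -> R) (s d : R) :
  0 < s < 1 -> is_derive s 1 f d -> ederive_within `[0, 1] f s = d%:E.
Proof.
move=> /andP[s0 s1] fd.
have PF : ProperFilter (within `[0, 1]%classic s^').
  apply: Build_ProperFilter_ex => A hA.
  have {hA} : \forall x \near s^', `[0, 1]%classic x -> A x by [].
  rewrite near_withinE => /nbhs_ballP[t /= t0 ht].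
  pose r := s + Num.min (t / 2) ((1 - s) / 2).
  have m0 : 0 < Num.min (t / 2) ((1 - s) / 2) by rewrite lt_min !divr_gt0// subr_gt0.
  exists r; apply: ht.
  - rewrite /ball/= /r opprD addrA subrr sub0r normrN gtr0_norm// gt_min.
    by rewrite ltr_pdivrMr// ltr_pMr ?ltr1n.
  - by rewrite /r -subr_eq0 addrAC subrr add0r gt_eqF.
  - rewrite /= in_itv/= /r; apply/andP; split; first by rewrite addr_ge0 ?ltW.
    have : Num.min (t / 2) ((1 - s) / 2) <= (1 - s) / 2 by rewrite ge_min lexx orbT.
    lra.
apply: cvg_lim => //; apply: cvg_EFin; first exact: nearW.
apply/cvgrPdist_le => e e0; have [t t0 ht] := (is_deriveP _ _ _).1 fd e e0.
rewrite near_withinE near_withinE; apply/nbhs_ballP; exists t => // r.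
rewrite /ball/= distrC => rt rs _.
have rs0 : r - s != 0 by rewrite subr_eq0.
rewrite -[d](mulfK rs0) -mulrBl normf_div distrC ler_pdivrMr ?normr_gt0//.
exact: ht.
Qed.

(* [lim] of a divergent sequence is the default point of the type. *)
Lemma lim_ereal_dvg (R : realType) (u : nat -> \bar R) : ~ cvgn u -> limn u = 0%E.
Proof. by move=> /dvgP. Qed.

(** * Lyapunov exponents *)

Section lyapunov_exponents.
Variables (R : realType) (T : circle R -> circle R) (mu : circle R -> probability nat R).
Local Notation X := (circle R).
Local Notation phi := (genfun mu).
Local Notation q := (extinction T mu).
Variables (F F' : R -> R) (A : X -> R) (kap dl : R).
Hypothesis TF : is_lift T F.
Hypothesis Fd : forall a, is_derive a (1 : R) F (F' a).
Hypothesis F'c : continuous F'.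
Hypothesis kap1 : 1 < kap.
Hypothesis F'kap : forall a, kap <= `|F' a|.
Hypothesis mu0 : forall x, mu x <> \d_0%N :> (set nat -> \bar R).
Hypothesis phic : strip_continuous (fun a s => phi (circle_pi a) s).
Hypothesis q_gt0 : forall x, 0 < q x.
Hypotheses (dl0 : 0 < dl) (q_dl : forall x, q x <= 1 - dl).
Hypothesis Ad : forall x, is_derive (q (T x)) 1 (phi x) (A x).

Definition lift_expansion n a := \prod_(i < n) `|F' (iter i F a)|.
Definition extinction_slope n x := \prod_(i < n) A (iter i T x).
Local Notation D := lift_expansion.
Local Notation f := extinction_slope.

Let q_lt1 x : q x < 1. Proof. by apply: le_lt_trans (q_dl x) _; rewrite gtrBl. Qed.

Let Fc : continuous F. Proof. by move=> a; exact: is_derive_continuous (Fd a). Qed.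

Let F'p : periodic F'.
Proof.
by have [d Fdeg] := lift_degree TF Fc; exact: degree_derive_periodic Fd Fdeg.
Qed.

Let iter_lift n : is_lift (iter n T) (iter n F).
Proof. by elim: n => [|n IH] a //=; rewrite IH TF. Qed.

Let iter_derive n a : is_derive a (1 : R) (iter n F) (\prod_(i < n) F' (iter i F a)).
Proof.
elim: n => [|n IH]; first by rewrite big_ord0; exact: is_derive_id.
by rewrite big_ord_recr/= mulrC; apply: (@is_derive1_comp R F (iter n F)).
Qed.

Lemma circle_map_derive_iter n a :
  `|circle_map_derive (iter n T) (circle_pi a)| = D n a.
Proof. by rewrite (circle_map_deriveE (iter_lift n) (iter_derive n)) normr_prod. Qed.

Let DD n m a : D (n + m) a = D n a * D m (iter n F a).
Proof.
rewrite /D big_split_ord/=; congr (_ * _); apply: eq_bigr => i _.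
by rewrite addnC iterD.
Qed.

Let kap0 : 0 < kap. Proof. exact: lt_trans kap1. Qed.

Let D_ge n a : kap ^+ n <= D n a.
Proof.
elim: n => [|n IH]; first by rewrite /D big_ord0 expr0.
by rewrite /D big_ord_recr/= exprSr ler_pM// ?exprn_ge0// ltW.
Qed.

Let D_gt0 n a : 0 < D n a. Proof. by apply: lt_le_trans (D_ge n a); exact: exprn_gt0. Qed.

Let alpha n := sup (range (fun a => ln (D n a))).

Let alpha_sup n : has_sup (range (fun a => ln (D n a))).
Proof.
split; first by exists (ln (D n 0)), 0.
have [M hM] := periodic_bounded F'c F'p.
have M0 : 0 < M by apply: lt_le_trans (le_trans (F'kap 0) (hM 0)).
exists (ln (M ^+ n)) => _ [a _ <-].
rewrite ler_ln ?posrE ?exprn_gt0//.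
elim: n => [|n IH]; first by rewrite /D big_ord0 expr0.
by rewrite /D big_ord_recr/= exprSr ler_pM// prodr_ge0.
Qed.

Let alpha_ub n a : ln (D n a) <= alpha n.
Proof. by apply: ub_le_sup; [exact: (alpha_sup n).2|exists a]. Qed.

(** Subadditivity is the chain rule, and expansion gives the lower bound [ln kap * n]; so the
    exponent is finite and positive, and dividing by it is legitimate. *)
Let alpha_cvg : exists2 l : R, 0 < l & lyap_u T = l%:E /\ alpha n / n%:R @[n --> \oo] --> l.
Proof.
have asub n m : alpha (n + m)%N <= alpha n + alpha m.
  apply: ge_sup; first exact: (alpha_sup _).1.
  by move=> _ [a _ <-]; rewrite DD lnM ?posrE// lerD.
have age n : ln kap * n%:R <= alpha n.
  apply: le_trans (alpha_ub n 0); rewrite mulr_natr -lnXn//.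
  by rewrite ler_ln ?posrE ?exprn_gt0.
have [l kl lcvg] := fekete asub age.
exists l; first by apply: lt_le_trans kl; exact: ln_gt0.
split=> //; apply: cvg_lim => //.
rewrite (_ : (fun n => _) = EFin \o (fun n => alpha n / n%:R)).
  by apply: cvg_EFin => //; exact: nearW.
apply/funext => n /=; rewrite mulrC EFinM; congr (_ * _)%E.
rewrite /alpha -ereal_sup_EFin; [|exact: (alpha_sup n).2|exact: (alpha_sup n).1].
congr ereal_sup; apply/seteqP; split => y.
  move=> [x _ <-]; exists (ln (D n (repr x))); first by exists (repr x).
  have hx := circle_map_derive_iter n (repr x); rewrite circle_pi_repr in hx.
  by rewrite hx leNgt D_gt0.
move=> [_ [a _ <-] <-]; exists (circle_pi a) => //.
by rewrite /= circle_map_derive_iter leNgt D_gt0.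
Qed.

Let q01 x : 0 < q x < 1. Proof. by rewrite q_gt0 q_lt1. Qed.

Lemma extinction_derive_ge0 x : 0 <= A x.
Proof. by have /andP[h1 h2] := q01 (T x); exact: (pgf_derive_ge0 h1 h2 (Ad x)). Qed.

Let f_ge0 n x : 0 <= f n x.
Proof. by apply: prodr_ge0 => i _; exact: extinction_derive_ge0. Qed.

Let fS n x : f n.+1 x = A x * f n (T x).
Proof.
rewrite /f big_ord_recl/=; congr (_ * _); apply: eq_bigr => i _.
by rewrite -iterSr.
Qed.

(** Convexity between [q (T x)] and 1, combined with the fixed point equation. Along an orbit the
    inequality telescopes, which bounds all the products [f n] by [dl^-1]. *)
Lemma extinction_derive_le x : A x * (1 - q (T x)) <= 1 - q x.
Proof.
have /andP[h1 h2] := q01 (T x).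
by have := pgf_derive_le h1 h2 (Ad x); rewrite -genfunE -(extinction_fixed mu0 phic).
Qed.

Let f_le n x : f n x <= dl^-1.
Proof.
rewrite -[leRHS]mul1r ler_pdivlMr//.
apply: (@le_trans _ _ (f n x * (1 - q (iter n T x)))).
  by rewrite ler_wpM2l//; have := q_dl (iter n T x); lra.
apply: (@le_trans _ _ (1 - q x)); last by rewrite gerBl ltW.
elim: n x => [|n IH] x; first by rewrite /f big_ord0 mul1r.
rewrite fS iterSr -mulrA; apply: (le_trans _ (extinction_derive_le x)).
by rewrite ler_wpM2l// extinction_derive_ge0.
Qed.

Let genfun_iter_q n x : genfun_iter T mu n x (q (iter n T x)) = q x.
Proof.
elim: n x => [|n IH] x //=.
by rewrite -iterS iterSr IH -(extinction_fixed mu0 phic).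
Qed.

Let iter_derive_q n x : is_derive (q (iter n T x)) 1 (genfun_iter T mu n x) (f n x).
Proof.
elim: n x => [|n IH] x; first by rewrite /f big_ord0; exact: is_derive_id.
rewrite fS iterSr; apply: (@is_derive1_comp R (phi x) (genfun_iter T mu n (T x))) => //.
by rewrite genfun_iter_q.
Qed.

Let ds_q n x : ds_genfun_iter T mu n x (q (iter n T x)) = (f n x)%:E.
Proof. exact: ederive_withinE (q01 _) (iter_derive_q n x). Qed.

(** A chord ending at [q (T x)] from the left has slope at most [A x]. Iterating multiplies the
    initial defect, a value of [q], by [f n x]. *)
Lemma extinction_approx n x : q x - genfun_iter T mu n x 0 <= f n x.
Proof.
elim: n x => [|n IH] x.
  by rewrite /f big_ord0 /= subr0; exact: ltW.
have /andP[h1 h2] := q01 (T x).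
have /andP[h3 _] := genfun_iter_itv T mu0 n (T x).
have h4 := genfun_iter_le_extinction T mu0 n (T x).
rewrite fS (extinction_fixed mu0 phic)//=.
apply: (le_trans (pgf_derive_ge h1 h2 h3 h4 (Ad x))).
by rewrite ler_wpM2l// extinction_derive_ge0.
Qed.

Let G n := ereal_sup (range (fun x => lne (ds_genfun_iter T mu n x (q (iter n T x))))).

Let G_ub n x : (lne (f n x)%:E <= G n)%E.
Proof. by apply: ereal_sup_ubound; exists x => //; rewrite ds_q. Qed.

Let v n := ((n%:R)^-1%:E * G n)%E.

Let v_le n : (v n <= (`|ln dl^-1| / n%:R)%:E)%E.
Proof.
rewrite /v mulrC EFinM; apply: lee_wpmul2l; first by rewrite lee_fin.
apply: ge_ereal_sup => _ [x _ <-]; rewrite ds_q.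
apply: (@le_trans _ _ (lne (dl^-1)%:E)).
  by rewrite lee_lne ?in_itv/= ?lee_fin ?f_ge0 ?f_le ?invr_ge0 ?(ltW dl0) ?leey.
by rewrite lne_EFin ?invr_gt0// lee_fin ler_norm.
Qed.

(** Were the defining sequence divergent, [lyap_F] would be 0 by default, against [g < |lyap_F|]. As
    [v_le] gives [lyap_F <= 0], its modulus is a rate of decay, uniform in [x] because of the
    supremum. *)
Let lyapF_neg (g : R) : 0 < g -> (g%:E < `|lyap_F T mu|)%E ->
  exists2 r : R, g < r & exists N, forall n, (N <= n)%N -> forall x, f n x <= expR (- r * n%:R).
Proof.
move=> g0; have [vcvg|vdvg] := pselect (cvgn v); last first.
  by rewrite /lyap_F (lim_ereal_dvg vdvg) abse0 lte_fin => h; have := lt_trans g0 h; rewrite ltxx.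
have vl : v n @[n --> \oo] --> lyap_F T mu by exact: vcvg.
set lF := lyap_F T mu in vl *.
have lF0 : (lF <= 0)%E.
  have h : (`|ln dl^-1| / n%:R)%:E @[n --> \oo] --> 0%E.
    apply: cvg_EFin; first exact: nearW.
    rewrite -(mulr0 `|ln dl^-1|); apply: cvgM; first exact: cvg_cst.
    by rewrite -cvg_shiftS; exact: cvg_harmonic.
  rewrite -(cvg_lim _ vl)// -(cvg_lim _ h)//; apply: lee_lim => //.
    by apply/cvg_ex; eexists; exact: h.
  exact: nearW.
move=> glF.
have [r gr lFr] : exists2 r : R, g < r & (lF < (- r)%:E)%E.
  case: lF lF0 glF {vl} => [t| |] //=.
    rewrite lee_fin lte_fin => t0; rewrite ler0_norm// => gt.
    (* Halfway between [g] and [- t]; an exponent equal to minus infinity would allow any rate. *)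
    by exists ((g - t) / 2); rewrite ?lte_fin; lra.
  by move=> _ _; exists (g + 1); [lra|exact: ltNyr].
exists r => //; have r0 : 0 < r := lt_trans g0 gr.
have := vl _ (open_ereal_lt' lFr) => -[N _ hN].
exists (maxn 1 N) => n; rewrite geq_max => /andP[n1 Nn] x.
have n0 : (0 : R) < n%:R by rewrite ltr0n.
have Gn : (G n < (- r * n%:R)%:E)%E.
  have : (n%:R%:E * v n < n%:R%:E * (- r)%:E)%E by rewrite lte_pmul2l// hN.
  by rewrite /v muleA -!EFinM mulfV ?gt_eqF// mul1e mulrC.
have := le_lt_trans (G_ub n x) Gn.
have := f_ge0 n x; rewrite le_eqVlt => /orP[/eqP <- _|fp]; first exact: expR_ge0.
rewrite lne_EFin// lte_fin => /ltW h.
by rewrite -[leLHS]lnK ?posrE// ler_expR.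
Qed.

Lemma lyapunov_contraction (g : R) : 0 < g -> (g%:E < `|lyap_F T mu| / lyap_u T)%E ->
  (exists n (th : R), [/\ (0 < n)%N, 0 < th, th < 1 &
    forall a, f n (circle_pi a) * D n a `^ g <= th ^+ n]) /\
  (forall e : R, 0 < e -> exists n, forall x, f n x <= e).
Proof.
move=> g0; have [l l0 [-> lcvg]] := alpha_cvg.
rewrite inver gt_eqF// => hg.
have hg' : ((g * l)%:E < `|lyap_F T mu|)%E.
  by move: hg; rewrite lte_pdivlMr// EFinM.
have [r gr [N hN]] := lyapF_neg (mulr_gt0 g0 l0) hg'.
have r0 : 0 < r := lt_trans (mulr_gt0 g0 l0) gr.
split; last first.
  move=> e e0; have [m hm] : exists m : nat, expR (- r * m%:R) <= e.
    exists (Num.bound (- ln e / r)).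
    rewrite -[leRHS]lnK ?posrE// ler_expR mulNr lerNl -ler_pdivrMl// mulrC.
    have [h|h] := leP 0 (- ln e / r); first exact/ltW/archi_boundP.
    by rewrite (le_trans (ltW h)).
  exists (maxn N m) => x; apply: (le_trans (hN _ (leq_maxl _ _) x)); apply: le_trans hm.
  by rewrite ler_expR !mulNr lerN2 ler_wpM2l ?(ltW r0)// ler_nat leq_maxr.
(* Spends half of the gap: [- r + g * (l + ep) = - ((r - g * l) / 2)], the logarithm of the
   contraction factor. *)
pose ep := (r - g * l) / (2 * g).
have ep0 : 0 < ep by rewrite divr_gt0 ?subr_gt0// mulr_gt0.
have /cvgrPdist_lt/(_ _ ep0)[N' _ hN'] := lcvg.
pose n := maxn 1 (maxn N N').
have n1 : (1 <= n)%N by exact: leq_maxl.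
have Nn : (N <= n)%N by rewrite /n !leq_max leqnn orbT.
have N'n : (N' <= n)%N by rewrite /n !leq_max leqnn !orbT.
have n0 : (0 : R) < n%:R by rewrite ltr0n.
have an : alpha n <= (l + ep) * n%:R.
  have := hN' n N'n => /= /ltr_normlP[h _]; rewrite -ler_pdivrMr//; lra.
exists n, (expR (- ((r - g * l) / 2))); split => //.
- exact: expR_gt0.
- by rewrite expR_lt1 oppr_lt0 divr_gt0 ?subr_gt0.
move=> a.
rewrite -expRM_natr.
have -> : - ((r - g * l) / 2) * n%:R = - r * n%:R + g * ((l + ep) * n%:R).
  by rewrite /ep; field; rewrite gt_eqF.
rewrite expRD ler_pM ?powR_ge0 ?f_ge0 ?hN//.
rewrite /powR gt_eqF// ler_expR ler_wpM2l ?(ltW g0)//.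
exact: le_trans (alpha_ub n a) an.
Qed.

End lyapunov_exponents.

(** * Adapted weight and conclusion *)

Lemma adapted_weight (R : realType) (F b : R -> R) (n : nat) (th M : R) :
  0 < th -> (0 < n)%N -> (forall a, 0 <= b a) -> (forall a, b a <= M) ->
  (forall a, \prod_(i < n) b (iter i F a) <= th ^+ n) ->
  exists (W : R -> R) (Wm : R), [/\ forall a, 1 <= W a, forall a, W a <= Wm &
    forall a, b a * W (F a) <= th * W a].
Proof.
move=> th0 n0 b0 bM bn.
pose B i a := \prod_(j < i) b (iter j F a).
have B0 i a : 0 <= B i a by apply: prodr_ge0.
have BS i a : B i.+1 a = b a * B i (F a).
  by rewrite /B big_ord_recl/=; congr (_ * _); apply: eq_bigr => j _; rewrite -iterSr.
have BM i a : B i a <= M ^+ i.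
  elim: i => [|i IH]; first by rewrite /B big_ord0 expr0.
  by rewrite /B big_ord_recr/= exprSr; exact: ler_pM (B0 i a) (b0 _) IH (bM _).
have thV i : 0 <= th ^- i by rewrite invr_ge0 exprn_ge0// ltW.
(* An adapted norm in finite form: [b a * W (F a)] is [th] times the same sum shifted by one index,
   which loses the term 1 and gains [th ^- n * B n a], at most 1. *)
pose W a := \sum_(i < n) th ^- i * B i a.
exists W, (\sum_(i < n) th ^- i * M ^+ i); split => a.
- rewrite /W -(prednK n0) big_ord_recl/= expr0 invr1 mul1r /B big_ord0 lerDl.
  by apply: sumr_ge0 => i _; exact: mulr_ge0 (thV _) (B0 _ _).
- by apply: ler_sum => i _; rewrite ler_wpM2l.
have -> : b a * W (F a) = th * (\sum_(i < n) th ^- i.+1 * B i.+1 a).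
  rewrite /W !mulr_sumr; apply: eq_bigr => i _; rewrite BS exprS.
  by field; rewrite ?expf_neq0 ?gt_eqF.
rewrite ler_pM2l//.
have h1 : \sum_(i < n.+1) th ^- i * B i a = W a + th ^- n * B n a.
  by rewrite big_ord_recr.
have h2 : \sum_(i < n.+1) th ^- i * B i a = 1 + \sum_(i < n) th ^- i.+1 * B i.+1 a.
  by rewrite big_ord_recl /= expr0 invr1 mul1r {1}/B big_ord0.
have : th ^- n * B n a <= 1 by rewrite mulrC ler_pdivrMr ?exprn_gt0// mul1r; exact: bn.
by rewrite h1 in h2; move: h2; lra.
Qed.

Lemma expanding_lift_bounds (R : realType) (F F' : R -> R) (kap K : R) :
  (forall a, is_derive a (1 : R) F (F' a)) -> (forall a, kap <= `|F' a|) ->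
  (forall a, `|F' a| <= K) ->
  forall a b, kap * `|a - b| <= `|F a - F b| /\ `|F a - F b| <= K * `|a - b|.
Proof.
move=> Fd kF FK a b.
have [||x _ ->] := @mvt_ball R F F' b (`|a - b| + 1) a b (fun x _ => Fd x).
- by rewrite ltrDl.
- by rewrite subrr normr0 ltr_wpDl.
by rewrite normrM; split; rewrite ler_wpM2r.
Qed.

Lemma uniform_limit_continuous (R : realType) (X : topologicalType) (g : X -> R) :
  (forall e : R, 0 < e -> exists2 h : X -> R, continuous h & forall x, `|g x - h x| <= e) ->
  continuous g.
Proof.
move=> H x; apply/cvgrPdist_le => e e0.
have e30 : 0 < e / 3 by rewrite divr_gt0.
have [h hc gh] := H _ e30; have /cvgrPdist_le/(_ _ e30) := hc x.
apply: filterS => y hxy.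
have -> : g x - g y = (g x - h x) + (h x - h y) + - (g y - h y) by ring.
rewrite (le_trans (ler_normD _ _))// normrN.
have := ler_normD (g x - h x) (h x - h y); have := gh x; have := gh y; lra.
Qed.

(** [circle_dist] is an infimum over pairs of representatives. The root of order [alpha] turns the
    Hölder bound for each pair into a lower bound of the distances, and so of the infimum. *)
Lemma holder_circleP (R : realType) (alpha C : R) (f : circle R -> R) (g : R -> R) :
  0 < alpha -> 0 <= C -> (forall a, f (circle_pi a) = g a) ->
  (forall a b, `|g a - g b| <= C * `|a - b| `^ alpha) -> holder_circle alpha f.
Proof.
move=> al0 C0 fg gC; exists C => x y.
pose S := [set d : R | exists a b : R,
   [/\ circle_pi a = x, circle_pi b = y & d = `|a - b|]].
have S0 : S !=set0.
  by exists `|repr x - repr y|, (repr x), (repr y); rewrite !circle_pi_repr.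
have Sge0 d : S d -> 0 <= d by move=> [a [b [_ _ ->]]].
have Sf d : S d -> `|f x - f y| <= C * d `^ alpha.
  by move=> [a [b [<- <- ->]]]; rewrite !fg.
have inf0 : 0 <= inf S by exact: lb_le_inf.
have [Cz|Cn] := eqVneq C 0.
  by have [d Sd] := S0; have := Sf d Sd; rewrite Cz !mul0r.
have Cp : 0 < C by rewrite lt0r Cn.
rewrite mulrC -ler_pdivrMr//.
set r := _ / C; have r0 : 0 <= r by rewrite divr_ge0.
have alV : 0 <= alpha^-1 by rewrite invr_ge0 ltW.
have : r `^ alpha^-1 <= inf S.
  apply: lb_le_inf => // d Sd.
  have -> : d = (d `^ alpha) `^ alpha^-1.
    by rewrite -powRrM mulfV ?gt_eqF// powRr1// Sge0.
  rewrite ge0_ler_powR ?nnegrE ?powR_ge0// /r ler_pdivrMr// mulrC.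
  exact: Sf.
move=> h; have -> : r = (r `^ alpha^-1) `^ alpha.
  by rewrite -powRrM mulVf ?gt_eqF// powRr1.
by rewrite ge0_ler_powR ?nnegrE ?powR_ge0// ltW.
Qed.

Theorem theorem1p0p2 (R : realType) (T : circle R -> circle R)
    (mu : circle R -> probability nat R) (k : nat) (alpha : R)
    (hTC1 : Cr_circle_map 1 T) (hTexp : uniformly_expanding T)
    (hmu_cont : l1_continuous mu)
    (hmu0 : forall x, mu x <> \d_0%N :> (set nat -> \bar R))
    (hmu1 : forall x, mu x <> \d_1%N :> (set nat -> \bar R))
    (halpha0 : 0 < alpha) (halpha1 : alpha <= 1)
    (ha : ((k%:R + alpha)%:E < `|lyap_F T mu| / lyap_u T)%E)
    (hb : Cr_circle_map k.+1 T)
    (hc : forall nu : probability (borel_circle R) R,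
        ergodic T nu -> nu (extinction T mu @^-1` [set 1]) = 0%E)
    (hd : Cr_circle_strip k.+1 (genfun mu))
    (he : forall x, 0 < extinction T mu x) :
  Cr_circle_fun k (extinction T mu) /\
  holder_circle alpha (circle_deriven k (extinction T mu)).
Proof.
have [F [TF /Cr_lineP Fr]] := hb.
have [F' Fd F'r] := Fr.
have Fc : continuous F := Cr_continuous Fr.
have F'c : continuous F' := Cr_continuous F'r.
have [d Fdeg] := lift_degree TF Fc.
have F'p := degree_derive_periodic Fd Fdeg.
have Tc := lift_continuous TF Fc.
have [kap [kap1 kapT]] := hTexp.
have F'kap a : kap <= `|F' a| by rewrite -(circle_map_deriveE TF Fd).
have [K hK] := periodic_bounded F'c F'p.
have K1 : 1 <= K by rewrite (le_trans (ltW kap1))// (le_trans (F'kap 0)).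
have bounds := expanding_lift_bounds Fd F'kap hK.
have phic : strip_continuous (fun a s => genfun mu (circle_pi a) s) :=
  Cr_strip_continuous hd.
have [dl dl0 q_dl] := extinction_bounded_away Tc hmu0 hmu1 phic hc.
set q := extinction T mu in q_dl he *.
have q01 x : 0 < q x < 1 by rewrite he (le_lt_trans (q_dl x))// gtrBl.
have [fc [fx [fs [dx ds _ _]]]] := hd.
(* The witness [fs] lives on the line; [Ad] identifies its value at [repr x] with a derivative of
   [genfun mu x], whatever the representative. *)
pose A x := fs (repr x) (q (T x)).
have Ad x : is_derive (q (T x)) 1 (genfun mu x) (A x).
  have /andP[/ltW qT0 qT1] := q01 (T x).
  have := is_derive_within_interior (q01 (T x)) (ds (repr x) (q (T x)) _).
  by rewrite circle_pi_repr; apply; rewrite qT0.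
have g0 : 0 < k%:R + alpha by rewrite ltr_wpDl.
have [[n [th [n0 th0 th1 hn]]] fsmall] :=
  lyapunov_contraction TF Fd F'c kap1 F'kap hmu0 phic he dl0 q_dl Ad g0 ha.
have A0 := extinction_derive_ge0 he dl0 q_dl Ad.
have qc : continuous q.
  apply: uniform_limit_continuous => e e0; have [m hm] := fsmall e e0.
  exists (fun x => genfun_iter T mu m x 0); first exact: genfun_iter_continuous.
  move=> x; rewrite ger0_norm ?subr_ge0 ?genfun_iter_le_extinction//.
  exact: le_trans (extinction_approx hmu0 phic he dl0 q_dl Ad m x) (hm x).
have [lo lo0 hlo] := compact_cont_min (@circle_compact R) qc he.
(* Products of [b] along [n] steps are [extinction_slope] times a power of [lift_expansion], the
   quantity that [lyapunov_contraction] makes small. *)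
pose b a := `|A (circle_pi a)| * `|F' a| `^ (k%:R + alpha).
have b0 a : 0 <= b a by rewrite mulr_ge0 ?powR_ge0.
have bM a : b a <= dl^-1 * K `^ (k%:R + alpha).
  rewrite ler_pM ?powR_ge0//; last by rewrite ge0_ler_powR ?nnegrE ?(ltW g0)// (le_trans ler01).
  rewrite ger0_norm// -[leRHS]mul1r ler_pdivlMr//.
  have := extinction_derive_le hmu0 phic he dl0 q_dl Ad (circle_pi a).
  rewrite -/q => h.
  apply: (@le_trans _ _ (A (circle_pi a) * (1 - q (T (circle_pi a))))).
    by rewrite ler_wpM2l//; have := q_dl (T (circle_pi a)); lra.
  by apply: (le_trans h); rewrite gerBl ltW.
have bn a : \prod_(i < n) b (iter i F a) <= th ^+ n.
  apply: le_trans (hn a); rewrite big_split/=.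
  rewrite le_eqVlt; apply/orP; left; apply/eqP; congr (_ * _).
    apply: eq_bigr => i _; rewrite ger0_norm//; congr A.
    by elim: (val i) => //= j IH; rewrite -TF IH.
  rewrite /lift_expansion; elim: (n) => [|m IH]; first by rewrite !big_ord0 powR1.
  by rewrite !big_ord_recr/= IH powRM// prodr_ge0.
have [W [Wm [W1 WWm AW]]] := adapted_weight th0 n0 b0 bM bn.
pose qt := q \o @circle_pi R.
have qtc : continuous qt by exact/circle_continuousP.
have qtE a : qt a = genfun mu (circle_pi a) (qt (F a)).
  rewrite /qt /= -TF; apply: (extinction_fixed hmu0 phic).
  by have /andP[] := q01 (T (circle_pi a)).
have hi1 : 1 - dl < 1 by rewrite gtrBl.
have [qr [C C0 qC]] := @fixed_point_holder R F F' qt (fun a => A (circle_pi a)) W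
  (fun a s => genfun mu (circle_pi a) s) k d kap K th alpha Wm lo (1 - dl)
  halpha0 halpha1 kap1 K1 (ltW th0) th1 lo0 hi1
  (fun a b => (bounds a b).1) (fun a b => (bounds a b).2) Fd Fdeg Fr
  (fun a => le_trans (ltW kap1) (F'kap a)) hd
  (fun a => congr1 (genfun mu) (circle_pi_periodic a)) qtc
  (circle_pi_comp_periodic q)
  ltac:(by move=> a; rewrite /qt /= hlo q_dl) qtE
  ltac:(by move=> a; rewrite /qt /= -TF; exact: Ad) W1 WWm AW.
split; first exact/Cr_lineP.
(* [circle_deriven] evaluates at [repr x]; periodicity makes every other representative give the
   same value. *)
have qp : periodic (derive1n k qt).
  elim: k {ha hb hd g0 hn Fr F'r b bM b0 bn AW fsmall qC} qr => [|j IH] qr.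
    exact: circle_pi_comp_periodic.
  have /Cr_lineP[dq _] := qr.
  apply: (@periodic_derive _ (derive1n j qt)); last exact/IH/Cr_pred.
  by move=> a; rewrite derive1nS; apply: DeriveDef; [exact: dq|rewrite derive1E].
by apply: (holder_circleP halpha0 C0 _ qC) => a; exact: circle_fun_repr.
Qed.
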